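(* Let $p\in\{2,\infty\}$ and assume that there exists a unique invariant probability measure $\mu_{\mathrm{ac}}$ belonging to $L^p(\mathbf{X})$. For every integer $r\ge r_{\min}$, let $\mathbf{y}^r$ be an optimal solution of the semidefinite program $$\sup_{\mathbf{y}=(y_\alpha)_{|\alpha|\le 2r}} y_0 \quad\text{s.t.}\quad \mathscr{I}_{\mathbf{y}}(\mathbf{x}^\alpha)=0\ \ \forall \alpha\in A_r,\qquad \mathbf{C}^p_r(\mathbf{y})\succeq 0,\qquad \mathbf{M}_{r-r_j}(g_j\,\mathbf{y})\succeq 0,\ \ j=0,1,\dots,m,$$ and let $h^r$ be the polynomial whose vector of coefficients in the monomial basis is $$\mathbf{h}^r:=\mathbf{M}_r(\mathbf{z})^{-1}\,(y^r_\alpha)_{|\alpha|\le r}.$$ Let $\mu^\star_{\mathrm{ac}}$ be the unique optimal solution of the problem $$\sup_{\mu}\Big\{ \int_{\mathbf{X}} d\mu \;:\; \mu \text{ is invariant},\ \|\mu\|_p\le 1,\ \mu\in L^p_+(\mathbf{X})\Big\},$$ with density $h^\star_{\mathrm{ac}}$ with respect to $\lambda$. Then for all $g\in\mathbb{R}[\mathbf{x}]$, $$\lim_{r\to+\infty}\int_{\mathbf{X}} g(\mathbf{x})\,h^r(\mathbf{x})\,d\lambda=\int_{\mathbf{X}} g(\mathbf{x})\,h^\star_{\mathrm{ac}}(\mathbf{x})\,d\lambda .$$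
   Context: Setting. $f=(f_1,\dots,f_n):\mathbb{R}^n\to\mathbb{R}^n$ is a polynomial map and $\mathbf{X}=\{\mathbf{x}\in\mathbb{R}^n: g_1(\mathbf{x})\ge0,\dots,g_m(\mathbf{x})\ge 0\}$ is a compact set, with $g_1,\dots,g_m\in\mathbb{R}[\mathbf{x}]$; $g_0:=1$. Standing assumptions: for some integer $N$, one of the $g_j$ equals $N-\|\mathbf{x}\|_2^2$; and the moments of the Lebesgue measure on $\mathbf{X}$ are available analytically (i.e. are regarded as known). $\lambda$ is the Lebesgue measure and $z_\beta:=\int_{\mathbf{X}}\mathbf{x}^\beta\,d\lambda$, $\mathbf{z}:=(z_\beta)_{\beta\in\mathbb{N}^n}$. Invariance. Two cases are treated in parallel, and the result holds in each. Discrete time ($\mathbf{x}_{t+1}=f(\mathbf{x}_t)$): a finite Borel measure $\mu$ on $\mathbf{X}$ is invariant if $f_\#\mu=\mu$, where $f_\#\mu(\mathbf{A})=\mu(\{\mathbf{x}\in\mathbf{X}: f(\mathbf{x})\in\mathbf{A}\})$ for Borel $\mathbf{A}\subseteq\mathbf{X}$. Continuous time ($\dot{\mathbf{x}}=f(\mathbf{x})$): $\mu$ is invariant if $\mathrm{div}(f\mu)=0$ in the sense of distributions acting on $\mathcal{C}^1(\mathbf{X})$, i.e. $\int_{\mathbf{X}} \mathrm{grad}\,v\cdot f\,d\mu=0$ for all $v\in\mathcal{C}^1(\mathbf{X})$. $L^p$ conventions. $L^p(\mathbf{X})$ (resp. $L^p_+(\mathbf{X})$) is the Lebesgue space (resp.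 its nonnegative elements) with respect to $\lambda$ on $\mathbf{X}$. For a measure $\mu$ with density $h$ w.r.t. $\lambda$, one writes $\mu\in L^p(\mathbf{X})$ if $h\in L^p(\mathbf{X})$, and $\|\mu\|_p:=\|h\|_p$. Moment notation. $r_j:=\lceil(\deg g_j)/2\rceil$ (so $r_0=0$), $r_{\min}:=\max\{1,r_1,\dots,r_m\}$, $\mathbb{N}^n_d:=\{\beta\in\mathbb{N}^n:|\beta|:=\sum_i\beta_i\le d\}$. For a real sequence $\mathbf{y}$, $\ell_{\mathbf{y}}(\sum_\beta p_\beta\mathbf{x}^\beta):=\sum_\beta p_\beta y_\beta$. $\mathbf{M}_{r-r_j}(g_j\mathbf{y})$ is the symmetric matrix with rows and columns indexed by $\mathbb{N}^n_{r-r_j}$ and $(\beta,\gamma)$ entry $\ell_{\mathbf{y}}(g_j\,\mathbf{x}^{\beta+\gamma})$; $\mathbf{M}_r(\mathbf{y}):=\mathbf{M}_{r-r_0}(g_0\mathbf{y})$ is the moment matrix. The moment matrix $\mathbf{M}_r(\mathbf{z})$ is positive definite, hence invertible, for all $r$. $\succeq0$ means positive semidefinite. For a polynomial $q$, $\mathscr{I}_{\mathbf{y}}(q):=\ell_{\mathbf{y}}(q\circ f)-\ell_{\mathbf{y}}(q)$ in discrete time and $\mathscr{I}_{\mathbf{y}}(q):=\ell_{\mathbf{y}}(\mathrm{grad}\,q\cdot f)$ in continuous time. $A_r$ is the set of $\alpha\in\mathbb{N}^n_{2r}$ for which $\mathscr{I}_{\mathbf{y}}(\mathbf{x}^\alpha)$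 only involves moments of degree at most $2r$, i.e. $\deg(\mathbf{x}^\alpha\circ f)\le 2r$ (discrete time), resp. $\deg(\mathrm{grad}(\mathbf{x}^\alpha)\cdot f)\le 2r$ (continuous time). Finally $$\mathbf{C}^2_r(\mathbf{y}):=\begin{pmatrix}\mathbf{M}_r(\mathbf{z})&\tilde{\mathbf{y}}\\ \tilde{\mathbf{y}}^T&1\end{pmatrix},\quad \tilde{\mathbf{y}}:=(y_\alpha)_{|\alpha|\le r},\qquad \mathbf{C}^\infty_r(\mathbf{y}):=\mathbf{M}_r(\mathbf{z})-\mathbf{M}_r(\mathbf{y}).$$ *)

(* Defs.v *)
From HB Require Import structures.
From mathcomp Require Import all_boot all_order all_algebra.
(* The notations of mpoly clash with those of all_analysis: mpoly n R is
   {mpoly R[n]}, multinom n is the type of multi-indices of length n, meval is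
   evaluation, mpolyX R a is the monomial x^a, comp_mpoly f q is q o f and
   mderiv is partial differentiation. *)
From mathcomp Require Import -(notations) mpoly.
From mathcomp Require Import all_classical all_reals all_analysis measurable_realfun.

Import Order.TTheory GRing.Theory Num.Theory numFieldNormedType.Exports.

Set Implicit Arguments.
Unset Strict Implicit.
Unset Printing Implicit Defensive.

Local Open Scope ring_scope.
Local Open Scope classical_set_scope.

Definition borel_rV_display : measure_display.
Proof. exact: default_measure_display. Qed.

Section borel_rV.
Context {R : realType} {n : nat}.
Implicit Types A : set 'rV[R]_n.

Let borel : set (set 'rV[R]_n) := <<s [set A | open A] >>.

Let borel0 : borel set0.
Proof. exact: sigma_algebra0. Qed.

Let borelC A : borel A -> borel (~` A).
Proof. exact: sigma_algebraC. Qed.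

Let borel_bigcup (F : (set 'rV[R]_n)^nat) :
  (forall i, borel (F i)) -> borel (\bigcup_i F i).
Proof. exact: sigma_algebra_bigcup. Qed.

(* R^n carries its Borel sigma-algebra. *)
HB.instance Definition _ :=
  @isMeasurable.Build borel_rV_display
    'rV[R]_n borel borel0 borelC borel_bigcup.

Lemma open_measurable_rV A : open A -> measurable A.
Proof. by move=> oA; exact: sub_sigma_algebra. Qed.

Lemma measurable_coord_rV (i : 'I_n) :
  measurable_fun setT (fun x : 'rV[R]_n => x 0 i).
Proof.
apply: (measurability _ (RGenOpens.measurableE R)) => _ [_ [a [b ->] <-]].
rewrite setTI; apply: open_measurable_rV.
apply: open_comp => [x _|]; last exact: interval_open.
exact: coord_continuous.
Qed.

Lemma measurable_fun_rV d (T : measurableType d) (f : T -> 'rV[R]_n) :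
  (forall i, measurable_fun setT (fun t => f t 0 i)) -> measurable_fun setT f.
Proof.
move=> mf; apply: (@measurability _ _ _ _ _ f _ erefl) => _ [U oU <-].
rewrite setTI.
pose q' (q : 'rV[rat]_n) : 'rV[R]_n := map_mx ratr q.
pose e (k : nat) : R := k.+1%:R^-1.
pose F (s : 'rV[rat]_n * nat) :=
  if `[< ball (q' s.1) (e s.2) `<=` U >] then f @^-1` ball (q' s.1) (e s.2)
  else set0.
have e0 k : 0 < e k by rewrite invr_gt0.
have -> : f @^-1` U = \bigcup_s F s.
  apply/seteqP; split=> [t /= Uft|t [[q k] _]]; rewrite /F /=; last first.
    by case: asboolP => // sU tq; exact: sU.
  have /nbhs_ballP[r /= r0 rU] : nbhs (f t) U by exact: open_nbhs_nbhs.
  have [k _ kr] : exists2 k : nat, True & e k *+ 2 < r.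
    have [k] := ltr_add_invr (divr_gt0 r0 (ltr0n R 2)).
    by rewrite add0r ltr_pdivlMr// mulr_natr => ?; exists k.
  have /choice[g gP] : forall i, exists q : rat, ball (f t 0 i) (e k) (ratr q).
    move=> i; have [|q] := @rat_in_itvoo R (f t 0 i) (f t 0 i + e k).
      by rewrite ltrDl.
    rewrite in_itv/= => /andP[q1 q2]; exists q.
    by rewrite /ball/= distrC ltr_distl q2 (le_lt_trans _ q1)// gerBl ltW.
  pose q := \row_i g i.
  have ftq : ball (f t) (e k) (q' q).
    by split=> // i j; rewrite ord1 !mxE; exact: gP.
  exists (q, k) => //=; case: asboolP => [_|]; first exact: ball_sym.
  case; move=> y qy; apply: rU; apply: (@le_ball _ _ _ (e k + e k)).
    by rewrite -mulr2n ltW.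
  exact: ball_triangle ftq qy.
apply: countable_bigcupT_measurable => [|[q k]]; first exact: countableP.
rewrite /F/=.
case: asboolP => _; last exact: measurable0.
have -> : f @^-1` ball (q' q) (e k) =
    \bigcap_(i : 'I_n) ((fun t => f t 0 i) @^-1` ball (q' q 0 i) (e k)).
  apply/seteqP; split => [t /= [_ tq] i _|t tq]; first exact: tq.
  by split => // i j; rewrite ord1; exact: tq.
apply: fin_bigcap_measurable => // i _; rewrite -[X in measurable X]setTI.
by apply: mf => //; apply: open_measurable; exact: ball_open.
Qed.

End borel_rV.

Section lebesgue_rV.
Context {R : realType}.

Definition rV_cons n (p : measurableTypeR R * 'rV[R]_n) : 'rV[R]_n.+1 :=
  \row_i (if unlift ord0 i is Some j then p.2 0 j else p.1).

Lemma rV_cons0 n p : @rV_cons n p 0 ord0 = p.1.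
Proof. by rewrite mxE unlift_none. Qed.

Lemma rV_consS n p j : @rV_cons n p 0 (lift ord0 j) = p.2 0 j.
Proof. by rewrite mxE liftK. Qed.

Lemma measurable_rV_cons n : measurable_fun setT (@rV_cons n).
Proof.
apply: measurable_fun_rV => i; case: (unliftP ord0 i) => [j|] ->.
  rewrite (_ : (fun=> _) = (fun x : 'rV[R]_n => x 0 j) \o snd).
    by apply: measurableT_comp => //; exact: measurable_coord_rV.
  by apply/funext => p; rewrite mxE liftK.
by rewrite (_ : (fun=> _) = fst) //; apply/funext => p; rewrite mxE unlift_none.
Qed.

Section step.
Variables (n : nat) (nu : {sigma_finite_measure set 'rV[R]_n -> \bar R}).

Definition lebesgue_rV_step : set 'rV[R]_n.+1 -> \bar R :=
  pushforward (lebesgue_measure \x nu)%E (@rV_cons n).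

Let mcons := @measurable_rV_cons n.

Let step0 : lebesgue_rV_step set0 = 0%E.
Proof. exact: measure0. Qed.

Let step_ge0 A : (0 <= lebesgue_rV_step A)%E.
Proof. exact: measure_ge0. Qed.

Let step_sigma_additive : semi_sigma_additive lebesgue_rV_step.
Proof. exact: measure_semi_sigma_additive. Qed.

HB.instance Definition _ := isMeasure.Build _ _ _ lebesgue_rV_step
  step0 step_ge0 step_sigma_additive.

Let step_sigma_finite : sigma_finite setT lebesgue_rV_step.
Proof.
have /sigma_finiteP[F [TF ndF Foo]] :=
  sigma_finiteT (@lebesgue_measure R : {sigma_finite_measure set _ -> \bar R}).
have /sigma_finiteP[G [TG ndG Goo]] := sigma_finiteT nu.
have TFG : \bigcup_k (F k `*` G k) = setT.
  rewrite -setXTT TF TG; apply/seteqP; split=> [[x v] [k _ []]|[x v]] /=.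
    by split; exists k.
  move=> [[k _ Fkx] [l _ Glv]]; exists (maxn k l) => //; split.
    by move: x Fkx; exact/subsetPset/ndF/leq_maxl.
  by move: v Glv; exact/subsetPset/ndG/leq_maxr.
pose uncons (v : 'rV[R]_n.+1) : measurableTypeR R * 'rV[R]_n :=
  (v 0 ord0, \row_j v 0 (lift ord0 j)).
have consK : cancel (@rV_cons n) uncons.
  case=> x v; rewrite /uncons /rV_cons mxE unlift_none; congr pair.
  by apply/rowP => j; rewrite !mxE liftK.
have muncons : measurable_fun setT uncons.
  apply/measurable_fun_pairP; split; first exact: measurable_coord_rV.
  apply: measurable_fun_rV => j.
  rewrite (_ : (fun=> _) = fun v : 'rV[R]_n.+1 => v 0 (lift ord0 j)).
    exact: measurable_coord_rV.
  by apply/funext => v; rewrite /= mxE.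
exists (fun k => uncons @^-1` (F k `*` G k)).
  by rewrite -preimage_bigcup TFG preimage_setT.
move=> k; have [mF Fkoo] := Foo k; have [mG Gkoo] := Goo k; split.
  by rewrite -[X in measurable X]setTI; apply: muncons => //; exact: measurableX.
rewrite /lebesgue_rV_step /pushforward -comp_preimage.
rewrite (_ : uncons \o _ = id) ?preimage_id; last by apply/funext => p /=.
by rewrite product_measure1E// lte_mul_pinfty// ge0_fin_numE.
Qed.

HB.instance Definition _ := Measure_isSigmaFinite.Build _ _ _ lebesgue_rV_step
  step_sigma_finite.

End step.

(* The point mass on R^0; on R^(k+1), the product of the Lebesgue measures of R
   and R^k. Its value on boxes is checked in lebesgue_rV_box. *)
Fixpoint lebesgue_rV n : {sigma_finite_measure set 'rV[R]_n -> \bar R} :=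
  if n is k.+1 then lebesgue_rV_step (lebesgue_rV k) else dirac (0 : 'rV[R]_0).

Definition box_rV n (a b : 'I_n -> R) : set 'rV[R]_n :=
  [set x | forall i, a i <= x 0 i <= b i].

Lemma measurable_box_rV n (a b : 'I_n -> R) : measurable (box_rV a b).
Proof.
rewrite (_ : box_rV _ _ = \bigcap_(i : 'I_n)
    ((fun x : 'rV[R]_n => x 0 i) @^-1` `[a i, b i])); last first.
  apply/seteqP; split => [x xab i _|x xab i]; first by rewrite /= in_itv/= xab.
  by have := xab i I; rewrite /= in_itv.
apply: fin_bigcap_measurable => // i _; rewrite -[X in measurable X]setTI.
exact: measurable_coord_rV.
Qed.

Lemma lebesgue_rV_box n (a b : 'I_n -> R) : (forall i, a i <= b i) ->
  lebesgue_rV n (box_rV a b) = (\prod_(i < n) (b i - a i))%:E.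
Proof.
elim: n => [|n IH] in a b * => ab.
  by rewrite big_ord0 /= diracE mem_set// => -[].
rewrite [LHS]/= /lebesgue_rV_step /pushforward.
rewrite (_ : _ @^-1` _ = `[a ord0, b ord0]%classic `*`
    box_rV (a \o lift ord0) (b \o lift ord0)); last first.
  apply/seteqP; split=> [[x v] xab|[x v] [/= xab vab] i].
    split => [|i] /=; first by rewrite in_itv/=; have := xab ord0; rewrite rV_cons0.
    by have := xab (lift ord0 i); rewrite rV_consS.
  case: (unliftP ord0 i) => [j|] ->; first by rewrite rV_consS; exact: vab.
  by rewrite rV_cons0; move: xab; rewrite in_itv.
rewrite product_measure1E//; last exact: measurable_box_rV.
rewrite IH => [|i]; last exact: ab.
rewrite big_ord_recl EFinM; congr (_ * _)%E.
rewrite [LHS]lebesgue_measure_itv/= lte_fin.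
by have := ab ord0; rewrite le_eqVlt => /predU1P[->|->];
  rewrite ?ltxx ?subrr ?EFinB.
Qed.

End lebesgue_rV.

Section polynomials.
Context {R : realType} {n : nat}.
Implicit Types (p q : mpoly n R) (x : 'rV[R]_n) (y : multinom n -> R).

Definition peval p x : R := meval (x 0) p.

Lemma measurable_peval p : measurable_fun setT (peval p).
Proof.
rewrite (_ : peval p = fun x =>
    \sum_(a <- msupp p) mcoeff a p * \prod_(i < n) x 0 i ^+ a i); last first.
  by apply/funext => x; rewrite /peval mevalE.
apply: measurable_sum => a; apply: measurable_funM => //.
apply: measurable_prod => i _; apply: measurable_funX.
exact: measurable_coord_rV.
Qed.

(* deg 0 = 0; mmeasure mdeg is one more than the degree of a nonzero
   polynomial. *)
Definition deg p : nat := (@mmeasure _ _ mdeg p).-1.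

Definition pmap_eval (f : n.-tuple (mpoly n R)) x : 'rV[R]_n :=
  \row_i peval (tnth f i) x.

(* grad p . f *)
Definition grad_dot (f : n.-tuple (mpoly n R)) p : mpoly n R :=
  \sum_(i < n) mderiv i p * tnth f i.

(* l_y(p) *)
Definition riesz y p : R := \sum_(a <- msupp p) mcoeff a p * y a.

End polynomials.

Section semialgebraic_set.
Context {R : realType} {n m : nat}.
Variable g : 'I_m -> mpoly n R.

Definition semialg : set 'rV[R]_n := [set x | forall j, 0 <= peval (g j) x].

Lemma measurable_semialg : measurable semialg.
Proof.
rewrite (_ : semialg = \bigcap_(j : 'I_m) (peval (g j) @^-1` `[0, +oo[)).
  apply: fin_bigcap_measurable => // j _; rewrite -[X in measurable X]setTI.
  exact: measurable_peval.
apply/seteqP; split => [x gx j _|x gx j]; first by rewrite /= in_itv/= andbT.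
by have := gx j I; rewrite /= in_itv/= andbT.
Qed.

Definition lebesgue_on : {measure set 'rV[R]_n -> \bar R} :=
  mrestr (lebesgue_rV n) measurable_semialg.

(* z_a *)
Definition lebesgue_moment (a : multinom n) : R :=
  \int[lebesgue_rV n]_(x in semialg) peval (mpolyX R a) x.

End semialgebraic_set.


Inductive time := Discrete | Continuous.

Inductive exponent := Two | Infinity.

Definition exponent_val (R : realType) (p : exponent) : \bar R :=
  if p is Two then 2%:E else +oo%E.

Section invariant_measures.
Context {R : realType} {n m : nat}.
Variables (t : time) (f : n.-tuple (mpoly n R)) (g : 'I_m -> mpoly n R).
Variable p : exponent.
Local Notation X := (semialg g).
Local Notation lambda := (lebesgue_on g).
Local Notation P := (exponent_val R p).
Implicit Types (mu : {measure set 'rV[R]_n -> \bar R}) (h : 'rV[R]_n -> R).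

(* Elements of C^1(X) are the restrictions to X of the C^1 functions on R^n. *)
Definition C1 (v : 'rV[R]_n -> R) : Prop :=
  (forall x, differentiable v x) /\
  (forall i : 'I_n, continuous ('D_(delta_mx 0 i) v)).

(* Measures on X are the measures on R^n for which the complement of X is
   null. *)
Definition invariant mu : Prop :=
  mu (~` X) = 0%E /\
  match t with
  | Discrete => forall A, measurable A -> A `<=` X ->
      mu (X `&` pmap_eval f @^-1` A) = mu A
  | Continuous => forall v, C1 v ->
      (\int[mu]_(x in X)
        (\sum_(i < n) 'D_(delta_mx 0 i) v x * pmap_eval f x 0 i)%:E = 0)%E
  end.

(* Functions on X are represented by measurable functions on R^n, whose values
   outside X are irrelevant. *)
Definition has_density mu h : Prop :=
  measurable_fun setT h /\
  forall A, measurable A -> (mu A = \int[lambda]_(x in A) (h x)%:E)%E.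

Definition in_Lp mu : Prop := exists2 h, h \in Lfun lambda P & has_density mu h.

Definition unique_invariant_probability : Prop :=
  exists mu : probability 'rV[R]_n R, [/\ invariant mu, in_Lp mu &
    forall nu : probability 'rV[R]_n R, invariant nu -> in_Lp nu ->
      forall A, measurable A -> nu A = mu A].

Definition lp_feasible mu : Prop :=
  invariant mu /\
  exists h, [/\ h \in Lfun lambda P, {ae lambda, forall x, 0 <= h x},
    has_density mu h & ('N[lambda]_P[EFin \o h] <= 1)%E].

Definition lp_optimal (mu : {finite_measure set 'rV[R]_n -> \bar R}) : Prop :=
  lp_feasible mu /\
  forall nu : {finite_measure set 'rV[R]_n -> \bar R}, lp_feasible nu ->
    (\int[nu]_(x in X) 1 <= \int[mu]_(x in X) 1)%E.

End invariant_measures.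

Definition psd (R : realType) N (A : 'M[R]_N) : Prop :=
  A^T = A /\ forall v : 'cV[R]_N, 0 <= (v^T *m A *m v) 0 0.

Section moment_hierarchy.
Context {R : realType} {n m : nat}.
Variables (t : time) (f : n.-tuple (mpoly n R)) (g : 'I_m -> mpoly n R).
Variable p : exponent.
Implicit Types (y : multinom n -> R) (q : mpoly n R).

(* bmultinom n d.+1 is the type of the multi-indices of degree at most d. *)
Local Notation basis d := (bmultinom n d.+1).

(* Here j = 0 gives the constant 1 and j + 1 gives the j-th constraint. *)
Definition constraint (j : 'I_m.+1) : mpoly n R :=
  if unlift ord0 j is Some k then g k else 1.

Definition half_deg q : nat := uphalf (deg q).

Definition rmin : nat := maxn 1 (\max_(j < m) half_deg (g j)).

Definition basis_elt d (i : 'I_#|{: basis d}|) : multinom n :=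
  (enum_val i : basis d).

(* M_d(q y) *)
Definition localizing d q y : 'M[R]_#|{: basis d}| :=
  \matrix_(i, j) riesz y (q * mpolyX R (mnm_add (basis_elt i) (basis_elt j))).

Definition moment_mx d y := localizing d 1 y.

Definition low_moments d y : 'cV[R]_#|{: basis d}| := \col_i y (basis_elt i).

Definition C2_mx d y : 'M[R]_(#|{: basis d}| + 1) :=
  block_mx (moment_mx d (lebesgue_moment g)) (low_moments d y)
           (low_moments d y)^T 1%:M.

Definition Coo_mx d y : 'M[R]_#|{: basis d}| :=
  moment_mx d (lebesgue_moment g) - moment_mx d y.

Definition norm_constraint d y : Prop :=
  if p is Two then psd (C2_mx d y) else psd (Coo_mx d y).

(* I_y(q) *)
Definition invariance_form y q : R :=
  match t with
  | Discrete => riesz y (comp_mpoly f q) - riesz y q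
  | Continuous => riesz y (grad_dot f q)
  end.

(* A_r *)
Definition index_set r (a : multinom n) : bool :=
  (mdeg a <= 2 * r)%N &&
  match t with
  | Discrete => (deg (comp_mpoly f (mpolyX R a)) <= 2 * r)%N
  | Continuous => (deg (grad_dot f (mpolyX R a)) <= 2 * r)%N
  end.

(* The decision variable of the relaxation of order r is a truncated sequence;
   its extension by zero is only evaluated in degree at most 2 * r. *)
Definition extend r (y : {ffun basis (2 * r) -> R}) (a : multinom n) : R :=
  if insub a is Some b then y b else 0.

Definition sdp_feasible r (y : {ffun basis (2 * r) -> R}) : Prop :=
  [/\ forall a, index_set r a -> invariance_form (extend y) (mpolyX R a) = 0,
      norm_constraint r (extend y) &
      forall j : 'I_m.+1, psd (localizing (r - half_deg (constraint j))
                                 (constraint j) (extend y))].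

Definition sdp_optimal r (y : {ffun basis (2 * r) -> R}) : Prop :=
  sdp_feasible y /\
  forall y' : {ffun basis (2 * r) -> R}, sdp_feasible y' ->
    extend y' mnm0 <= extend y mnm0.

(* h^r *)
Definition density_approx r (y : {ffun basis (2 * r) -> R}) : mpoly n R :=
  let c := invmx (moment_mx r (lebesgue_moment g)) *m low_moments r (extend y) in
  \sum_i c i 0 *: mpolyX R (basis_elt i).

End moment_hierarchy.

(* Main.v *)
(* Fix an ultrafilter U of relaxation orders that contains all tails. The norm
   constraint bounds the functional of y^r by l(q)^2 <= C \int_X q^2, so its
   values converge along U on every polynomial, and the limit functional l is
   represented by some h in L^2 by the Riesz theorem. Every Borel set is
   approximated in L^1 by squares of polynomials, so l(q^2) >= 0 gives h >= 0
   a.e. and, for p = oo, l(q^2) <= \int_X q^2 gives h <= 1 a.e.; no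
   Positivstellensatz is needed. By C^1 density of the polynomials the moment
   equations make h dlambda invariant, hence feasible for the infinite
   dimensional problem. Conversely the moments of the optimal measure are
   feasible for every relaxation, so h dlambda has at least, hence exactly, the
   optimal mass, and uniqueness identifies it with the optimal measure. Finally
   \int_X q h^r = l_{y^r}(q) as soon as deg q <= r, by definition of h^r. *)
Require Import Defs.
From HB Require Import structures.
From mathcomp Require Import all_boot all_order all_algebra.
From mathcomp Require Import -(notations) mpoly.
From mathcomp Require Import all_classical all_reals all_analysis measurable_realfun.
From mathcomp Require Import ess_sup_inf ring lra zify.

Import Order.TTheory GRing.Theory Num.Theory numFieldNormedType.Exports.

Set Implicit Arguments.
Unset Strict Implicit.
Unset Printing Implicit Defensive.

Local Open Scope ring_scope.
Local Open Scope classical_set_scope.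

(** * Polynomial functions and Riesz functionals *)

(** The norm constraint controls [y r] only in degree at most [r], so no single relaxation yields a
    functional on all polynomials; only the limit does, and an ultrafilter gives it on all monomials
    at once. Since every such limit turns out to be the same functional, the whole sequence
    converges. Continuous time tests invariance on gradients, so polynomials must be dense for first
    derivatives. Multivariate Bernstein polynomials are used because the derivative of one of them
    is again one, built from difference quotients; a single estimate then serves functions and
    gradients. Both the Riesz theorem and the matrix inverse in h^r need \int_X q^2 to be definite.
    This follows from lambda(X) > 0, which the existence of an invariant probability with a density
    provides. Uniqueness is assumed among probabilities only. Invariance and membership in L^p are
    stable under scaling, so every feasible measure is a multiple of one probability, and its mass
    determines it. *)

Section poly_eval.
Context {R : realType} {n : nat}.
Implicit Types (p q : mpoly n R) (x : 'rV[R]_n).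

Lemma pevalD p q x : peval (p + q) x = peval p x + peval q x.
Proof. exact: mevalD. Qed.

Lemma pevalB p q x : peval (p - q) x = peval p x - peval q x.
Proof. exact: mevalB. Qed.

Lemma pevalM p q x : peval (p * q) x = peval p x * peval q x.
Proof. exact: mevalM. Qed.

Lemma pevalZ c p x : peval (c *: p) x = c * peval p x.
Proof. exact: mevalZ. Qed.

Lemma peval1 x : peval (1 : mpoly n R) x = 1.
Proof. exact: meval1. Qed.

Lemma pevalC c x : peval (mpolyC n c) x = c.
Proof. exact: mevalC. Qed.

Lemma pevalXU i x : peval (mpolyX R (mnm1 i)) x = x 0 i.
Proof. exact: mevalXU. Qed.

Lemma pevalXn p k x : peval (p ^+ k) x = peval p x ^+ k.
Proof. exact: rmorphXn. Qed.

Lemma peval_sum (I : Type) (r : seq I) (P : pred I) (F : I -> mpoly n R) x :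
  peval (\sum_(i <- r | P i) F i) x = \sum_(i <- r | P i) peval (F i) x.
Proof. exact: raddf_sum. Qed.

Lemma peval_comp (f : n.-tuple (mpoly n R)) p x :
  peval (comp_mpoly f p) x = peval p (pmap_eval f x).
Proof.
by rewrite /peval comp_mpoly_meval; apply: meval_eq => i; rewrite mxE.
Qed.

(** Reduces facts about [peval], such as differentiability or the shape of slices, to constants,
    variables, sums and products. *)
Lemma mpoly_ring_ind (P : mpoly n R -> Prop) :
  (forall c, P (mpolyC n c)) -> (forall i, P (mpolyX R (mnm1 i))) ->
  (forall p q, P p -> P q -> P (p + q)) ->
  (forall p q, P p -> P q -> P (p * q)) -> forall p, P p.
Proof.
move=> PC PX PD PM; elim/mpolyind => [|c a p _ _ Pp]; first by rewrite -mpolyC0.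
apply: (PD) => //; rewrite -mul_mpolyC; apply: (PM) => //.
rewrite mpolyXE_id.
apply: (big_ind P) => [|? ? ? ?|i _]; [by rewrite -mpolyC1|exact: PM|].
by elim: (a i) => [|k IH]; rewrite ?exprS ?expr0 -?mpolyC1//; exact: PM.
Qed.

Lemma is_derive_peval p x i :
  is_derive x (delta_mx 0 i) (peval p) (peval (mderiv i p) x).
Proof.
move: p; apply: mpoly_ring_ind => [c|j|p q dp dq|p q dp dq].
- rewrite mderivC (_ : peval (mpolyC n c) = cst c); last first.
    by apply/funext => z; exact: pevalC.
  by rewrite /peval meval0; exact: is_derive_cst.
- rewrite (_ : peval _ = fun z : 'rV[R]_n => z 0 j); last first.
    by apply/funext => z; exact: pevalXU.
  have dj : differentiable (fun z : 'rV[R]_n => z 0 j) x.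
    exact: differentiable_coord.
  apply: DeriveDef; first exact: diff_derivable.
  apply: cvg_lim => //; apply: cvg_near_cst; near=> e.
  have e0 : e != 0 by near: e; exact: nbhs_dnbhs_neq.
  rewrite /= !mxE addrK -[_ *: _]/(e^-1 * _) mulrA mulVf// mul1r mderivX.
  rewrite eqxx /= mnm1E eq_sym pevalZ.
  case: eqP => [->|_]; last by rewrite mul0r.
  rewrite mul1r (_ : mnm_sub _ _ = mnm0) ?mpolyX0 ?peval1//.
  by apply/mnmP => k; rewrite mnmBE subnn mnm0E.
- rewrite mderivD pevalD (_ : peval (p + q) = peval p + peval q)//.
    exact: is_deriveD.
  by apply/funext => z; exact: pevalD.
- rewrite mderivM pevalD !pevalM (_ : peval (p * q) = peval p * peval q).
    by rewrite addrC [X in _ + X]mulrC; exact: is_deriveM.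
  by apply/funext => z; exact: pevalM.
Unshelve. all: by end_near. Qed.
End poly_eval.

Section poly_derivatives.
Context {R : realType} {n : nat}.
Implicit Types (p q : mpoly n R) (x : 'rV[R]_n).

Lemma differentiable_peval p x : differentiable (peval p) x.
Proof.
move: p; apply: mpoly_ring_ind => [c|j|p q dp dq|p q dp dq].
- rewrite (_ : peval (mpolyC n c) = cst c); last first.
    by apply/funext => z; exact: pevalC.
  exact: differentiable_cst.
- rewrite (_ : peval _ = fun z : 'rV[R]_n => z 0 j); last first.
    by apply/funext => z; exact: pevalXU.
  exact: differentiable_coord.
- rewrite (_ : peval (p + q) = peval p + peval q); first exact: differentiableD.
  by apply/funext => z; exact: pevalD.
- rewrite (_ : peval (p * q) = peval p * peval q); first exact: differentiableM.
  by apply/funext => z; exact: pevalM.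
Qed.

Lemma derive_peval p i :
  'D_(delta_mx 0 i) (peval p) = peval (mderiv i p) :> ('rV[R]_n -> R).
Proof. by apply/funext => x; have [] := is_derive_peval p x i. Qed.

Lemma continuous_peval p : continuous (peval p).
Proof. by move=> x; exact/differentiable_continuous/differentiable_peval. Qed.

Lemma C1_peval p : C1 (peval p).
Proof.
split => [x|i]; first exact: differentiable_peval.
by rewrite derive_peval; exact: continuous_peval.
Qed.

(** Coefficients are derivatives at 0 up to a nonzero integer factor: the constant one is the value
    at 0, and the one at [a] is, up to the factor [a i], the coefficient at [a - e_i] of the i-th
    derivative, which vanishes as a function too. *)
Lemma peval_inj p : peval p =1 cst 0 -> p = 0.
Proof.
suff H k a q : mdeg a = k -> peval q =1 cst 0 -> mcoeff a q = 0.
  by move=> p0; apply/mpolyP => a; rewrite mcoeff0 (H _ a p erefl).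
elim: k a q => [a q /eqP|k IH a q].
  rewrite mdeg_eq0 => /eqP-> q0; have := q0 0; rewrite /peval mevalE /=.
  have [m0q|m0q] := boolP (mnm0 \in msupp q); last by rewrite memN_msupp_eq0.
  rewrite (bigD1_seq mnm0)//= [X in _ + X]big1_seq ?addr0 => [|m /andP[m0 _]].
    by rewrite big1 ?mulr1 => // i _; rewrite mnm0E expr0.
  have [i mi] : exists i, m i != 0%N.
    apply/existsP; rewrite -negb_forall; apply: contra m0 => /forallP m0.
    by apply/eqP/mnmP => i; rewrite mnm0E; exact/eqP/m0.
  by rewrite (bigD1 i)//= mxE expr0n (negbTE mi) mul0r mulr0.
move=> ak q0.
have [i ai] : exists i, a i != 0%N.
  apply/existsP; rewrite -negb_forall; apply: contra_eqN ak => /forallP a0.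
  by rewrite mdegE big1// => i _; exact/eqP/a0.
have aE : a = mnm_add (mnm_sub a (mnm1 i)) (mnm1 i).
  apply/mnmP => j; rewrite mnmDE mnmBE mnm1E.
  by case: eqP => [<-|]; rewrite ?subn0 ?addn0// subnK// lt0n.
have /(congr1 (fun r => mdeg r)) := aE; rewrite mdegD mdeg1 ak addn1 => -[ek].
have := IH (mnm_sub a (mnm1 i)) (mderiv i q) (esym ek).
have dq0 : peval (mderiv i q) =1 cst 0.
  move=> x; rewrite -derive_peval (_ : peval q = cst 0) ?derive_cst//.
  by apply/funext => z; exact: q0.
move=> /(_ dq0) /eqP; rewrite mcoeff_mderiv -aE.
by rewrite mulrn_eq0 /= => /eqP.
Qed.
End poly_derivatives.

Section riesz_linear.
Context {R : realType} {n : nat}.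
Implicit Types (p q : mpoly n R) (y : multinom n -> R).

(** The sum in [riesz] runs over the support of [p]; over an index set common to several polynomials
    linearity becomes visible. *)
Lemma rieszE d y p : (mmeasure mdeg p <= d)%N ->
  riesz y p = \sum_(a : bmultinom n d) mcoeff a p * y a.
Proof.
move=> pd; rewrite /riesz (ssrcomplements.big_mksub (bmultinom n d)) ?msupp_uniq //=; last first.
  by move=> x /msize_mdeg_lt /leq_trans; apply.
rewrite big_rmcond //= => j /memN_msupp_eq0 ->.
by rewrite mul0r.
Qed.

Lemma riesz_scalar y : scalar (riesz y).
Proof.
move=> c p q.
pose d := maxn (mmeasure mdeg (c *: p + q)) (maxn (mmeasure mdeg p) (mmeasure mdeg q)).
rewrite (@rieszE d y p) ?(@rieszE d y q) ?(@rieszE d y (_ + _)) /d ?leq_max ?leqnn ?orbT//.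
rewrite mulr_sumr -big_split /=; apply: eq_bigr => a _.
by rewrite mcoeffD mcoeffZ mulrDl -mulrA.
Qed.

HB.instance Definition _ y :=
  GRing.isLinear.Build R (mpoly n R) R *%R (riesz y) (riesz_scalar y).

Lemma rieszX y a : riesz y (mpolyX R a) = y a.
Proof. by rewrite /riesz msuppX big_seq1 mcoeffX eqxx mul1r. Qed.

Lemma eq_riesz y1 y2 p : (forall a, a \in msupp p -> y1 a = y2 a) ->
  riesz y1 p = riesz y2 p.
Proof. by move=> y12; apply: eq_big_seq => a /y12->. Qed.

Lemma riesz_id (l : {scalar mpoly n R}) p :
  riesz (fun a => l (mpolyX R a)) p = l p.
Proof.
rewrite {2}[p]mpolyE raddf_sum; apply: eq_bigr => a _.
exact/esym/linearZ.
Qed.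

End riesz_linear.

(** * Weierstrass approximation in C^1 *)

Section bernstein.
Context {R : realType} {n : nat}.
Variable K : R.
Implicit Types (x : 'rV[R]_n) (F G : multinom n -> R) (w : seq 'I_n).

Definition bern_step (i : 'I_n) F (a : multinom n) : R := F (mnm_add a (mnm1 i)).

Definition bern_var (i : 'I_n) : mpoly n R :=
  (K *+ 2)^-1 *: (mpolyX R (mnm1 i) + mpolyC n K).

(* The expectation of F at the endpoint of a random walk on N^n starting at 0,
   whose successive steps are either null or the unit vectors e_i, i in w, the
   latter with probability (x_i + K) / (2 K). *)
Fixpoint bernstein w F : mpoly n R :=
  if w is i :: w' then
    bern_var i * bernstein w' (bern_step i F) + (1 - bern_var i) * bernstein w' F
  else mpolyC n (F mnm0).

Lemma bern_stepC i j F : bern_step i (bern_step j F) = bern_step j (bern_step i F).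
Proof.
apply/funext => a; rewrite /bern_step; congr F.
by apply/mnmP => k; rewrite !mnmDE addnAC.
Qed.

(** Steps of the walk commute, so any occurrence of [l] can be taken first. *)
Lemma bernstein_rem l w F : l \in w -> bernstein (l :: rem l w) F = bernstein w F.
Proof.
elim: w F => //= i w IH F; rewrite inE.
case: (eqVneq i l) => [->//|il /= lw].
by rewrite -(IH (bern_step i F))// -(IH F)//= (bern_stepC i l); ring.
Qed.

Lemma bernsteinB w F G :
  bernstein w (fun a => F a - G a) = bernstein w F - bernstein w G.
Proof.
elim: w F G => [|i w IH] F G /=; first by rewrite mpolyCB.
by rewrite IH -[bern_step i _]/(fun a => bern_step i F a - bern_step i G a) IH; ring.
Qed.

Lemma mderiv_bern_var l i :
  mderiv l (bern_var i) = mpolyC n ((l == i)%:R / (K *+ 2)).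
Proof.
rewrite /bern_var mderivZ mderivD mderivC addr0 mderivX mnm1E eq_sym.
case: eqP => [<-|_]; last by rewrite scale0r scaler0 mul0r mpolyC0.
rewrite (_ : mnm_sub _ _ = mnm0) ?mpolyX0 ?scale1r.
  by rewrite mul1r -mul_mpolyC mulr1.
by apply/mnmP => k; rewrite mnmBE subnn mnm0E.
Qed.

(** By the product rule each step in direction [l] contributes the slope 1 / (2 K) times the effect
    of taking rather than skipping it, with one step less in the walk. As the order of the steps is
    irrelevant, all these contributions are equal. *)
Lemma mderiv_bernstein l w F : mderiv l (bernstein w F) =
  ((count_mem l w)%:R / (K *+ 2)) *:
    bernstein (rem l w) (fun a => bern_step l F a - F a).
Proof.
elim: w F => [|i w IH] F /=; first by rewrite mderivC mul0r scale0r.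
rewrite mderivD !mderivM mderivB !IH.
rewrite -mpolyC1 mderivC mderiv_bern_var sub0r.
have [->|il] := eqVneq i l; last first.
  rewrite !mul0r mpolyC0 oppr0 !mul0r !add0r add0n /=.
  by rewrite bern_stepC -!scalerAr -scalerDr -mpolyC1.
rewrite natrD [X in _ = X *: _]mulrDl [RHS]scalerDl -!mul_mpolyC mpolyC1.
set c1 := _ / _; set c2 := _ / (K *+ 2).
(* If [l] does not recur, [c2] is 0. If it does, pulling it to the front of [w] on the right-hand
   side produces the terms of the product rule. *)
have [lw|lw] := boolP (l \in w); last first.
  by rewrite /c2 (count_memPn lw) mul0r mpolyC0 (bernsteinB w); ring.
rewrite -[in mpolyC n c2 * bernstein w _](bernstein_rem _ lw) /= !bernsteinB.
ring.
Qed.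
End bernstein.

Section bernstein_estimate.
Context {R : realType} {n : nat}.
Variables (K : R) (x : 'rV[R]_n).
Implicit Types (F G : multinom n -> R) (w : seq 'I_n).
Local Notation u i := (peval (bern_var K i) x).
Local Notation E w F := (peval (bernstein K w F) x).
Hypothesis u01 : forall i, 0 <= u i <= 1.

Lemma peval_bernstein_cons i w F :
  E (i :: w) F = u i * E w (bern_step i F) + (1 - u i) * E w F.
Proof. by rewrite /= pevalD !pevalM pevalB peval1. Qed.

(** Where the [u i] are probabilities, the value is a convex combination of the values of [F] at the
    endpoints that the walk can reach. *)
Lemma ler_bernstein w F G :
  (forall a : multinom n, (forall l, (a l <= count_mem l w)%N) -> F a <= G a) ->
  E w F <= E w G.
Proof.
elim: w F G => [|i w IH] F G FG; first by rewrite /= !pevalC FG// => l; rewrite mnm0E.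
have /andP[u0 u1] := u01 i.
rewrite !peval_bernstein_cons lerD// ler_wpM2l ?subr_ge0//; apply: IH => a aw.
  apply: FG => l; rewrite mnmDE mnm1E addnC.
  by apply: leq_add.
apply: FG => l; exact: leq_trans (aw l) (leq_addl _ _).
Qed.

Lemma peval_bernstein_cst w c : E w (fun=> c) = c.
Proof.
elim: w => [|i w IH]; first exact: pevalC.
by rewrite peval_bernstein_cons -[bern_step i _]/(fun=> c) IH; ring.
Qed.

Lemma peval_bernsteinD w F G : E w (fun a => F a + G a) = E w F + E w G.
Proof.
elim: w F G => [|i w IH] F G; first by rewrite /= -pevalD -mpolyCD.
rewrite !peval_bernstein_cons IH.
by rewrite -[bern_step i _]/(fun a => bern_step i F a + bern_step i G a) IH; ring.
Qed.

Lemma peval_bernsteinZ w c F : E w (fun a => c * F a) = c * E w F.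
Proof.
elim: w F => [|i w IH] F; first by rewrite /= !pevalC.
rewrite !peval_bernstein_cons IH.
by rewrite -[bern_step i _]/(fun a => c * bern_step i F a) IH; ring.
Qed.

Lemma peval_bernstein_sum w (I : Type) (r : seq I) (F : I -> multinom n -> R) :
  E w (fun a => \sum_(l <- r) F l a) = \sum_(l <- r) E w (F l).
Proof.
elim: r => [|l r IH].
  rewrite big_nil (_ : (fun _ => _) = fun=> 0) ?peval_bernstein_cst//.
  by apply/funext => a; rewrite big_nil.
rewrite big_cons -IH -peval_bernsteinD; congr (peval (bernstein _ _ _) _).
by apply/funext => a; rewrite big_cons.
Qed.

(** [a l] is a sum of [N] independent Bernoulli variables of mean [u l], whence variance plus
    squared bias. The centre [c] is left free because a step in direction [l] replaces it by [c - 1]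
    in the induction. *)
Lemma peval_bernstein_var w l c : let N := (count_mem l w)%:R in
  E w (fun a => ((a l)%:R - c) ^+ 2) = N * (u l * (1 - u l)) + (N * u l - c) ^+ 2.
Proof.
elim: w c => [|i w IH] c /=.
  by rewrite pevalC mnm0E; ring.
rewrite -/(bernstein K (i :: w) _) peval_bernstein_cons IH.
have [->|il] := eqVneq i l.
  rewrite (_ : bern_step l _ = (fun a => ((a l)%:R - (c - 1)) ^+ 2)); last first.
    by apply/funext => a; rewrite /bern_step mnmDE mnm1E eqxx addn1 -natr1; congr (_ ^+ 2); ring.
  rewrite IH add1n -natr1; ring.
rewrite (_ : bern_step i _ = (fun a => ((a l)%:R - c) ^+ 2)); last first.
  by apply/funext => a; rewrite /bern_step mnmDE mnm1E (negbTE il) addn0.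
by rewrite IH add0n; ring.
Qed.

(* Chebyshev's inequality: the random walk has variance at most k in each
   coordinate. *)
Lemma bernstein_estimate w F z e M k : 0 <= M ->
  (forall l, (count_mem l w <= k)%N) ->
  (forall a : multinom n, (forall l, (a l <= count_mem l w)%N) ->
    `|F a - z| <= e + M * \sum_l ((a l)%:R - (count_mem l w)%:R * u l) ^+ 2) ->
  `|E w F - z| <= e + M * (n * k)%:R.
Proof.
move=> M0 wk Fz.
have B : E w (fun a => e + M * \sum_l ((a l)%:R - (count_mem l w)%:R * u l) ^+ 2)
    <= e + M * (n * k)%:R.
  rewrite peval_bernsteinD peval_bernstein_cst lerD2l peval_bernsteinZ ler_wpM2l//.
  rewrite peval_bernstein_sum.
  apply: (@le_trans _ _ (\sum_(l < n) k%:R)); last first.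
    by rewrite sumr_const card_ord natrM mulrC mulr_natr.
  apply: ler_sum => l _; rewrite peval_bernstein_var subrr expr0n addr0.
  have /andP[u0 u1] := u01 l.
  have uu : u l * (1 - u l) <= 1 by nra.
  rewrite (le_trans (ler_wpM2l _ uu))// mulr1 ler_nat; exact: wk.
rewrite ler_distl; apply/andP; split.
  rewrite lerBlDr; apply: le_trans (lerD (lexx (E w F)) B).
  rewrite -peval_bernsteinD -[leLHS](peval_bernstein_cst w); apply: ler_bernstein => a aw.
  by rewrite -lerBlDl; apply: le_trans (Fz a aw); rewrite distrC ler_norm.
apply: le_trans (lerD (lexx z) B).
rewrite -[X in _ <= X + _](peval_bernstein_cst w) -peval_bernsteinD.
apply: ler_bernstein => a aw.
by rewrite -lerBlDl; apply: le_trans (Fz a aw); rewrite ler_norm.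
Qed.

End bernstein_estimate.

Section weierstrass.
Context {R : realType} {n : nat}.

Definition cube_rV (K : R) : set 'rV[R]_n := box_rV (fun=> - K) (fun=> K).

Lemma compact_cube_rV (K : R) : compact (cube_rV K).
Proof.
rewrite (_ : cube_rV K = [set v : 'rV[R]_n | forall i, `[- K, K]%classic (v ord0 i)]).
  by apply: (@rV_compact R^o n (fun=> `[- K, K]%classic)) => i; exact: segment_compact.
by apply/seteqP; split => v Kv i; have := Kv i; rewrite /= in_itv.
Qed.

Lemma unif_continuous_compact (phi : 'rV[R]_n -> R) (A : set 'rV[R]_n) (e : R) :
  continuous phi -> compact A -> 0 < e ->
  exists2 d : R, 0 < d & forall x y, A x -> ball x d y -> `|phi x - phi y| <= e.
Proof.
move=> cphi /compact_near_coveringP cA e0.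
pose P (d : R) (x : 'rV[R]_n) := forall y, ball x d y -> `|phi x - phi y| <= e.
have nP x : A x -> \forall x' \near x & d \near (0 : R)^'+, P d x'.
  move=> Ax; have e2 : 0 < e / 2 by rewrite divr_gt0.
  have /cphi/nbhs_ballP[r /= r0 rP] := @nbhsx_ballx _ R (phi x) _ e2.
  have r2 : 0 < r / 2 by rewrite divr_gt0.
  exists (ball x (r / 2), [set d | 0 < d < r / 2]) => /=.
    split; first exact: nbhsx_ballx.
    near=> d; apply/andP; split => //; near: d; exact: nbhs_right_lt.
  move=> [x' d] /= [xx' /andP[d0 dr]] y x'y.
  have /rP/ltW px' : ball x r x'.
    by apply: le_ball xx'; rewrite ler_pdivrMr// ler_peMr ?ler1n// ltW.
  have /rP/ltW py : ball x r y.
    rewrite [r]splitr; apply: ball_triangle xx' _.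
    by apply: le_ball x'y; exact: ltW.
  rewrite [e]splitr (le_trans (ler_distD (phi x) _ _))// lerD//.
  by rewrite distrC.
have [r /= r0 rP] := cA _ (0 : R)^'+ P _ nP.
have r2 : 0 < r / 2 by rewrite divr_gt0.
exists (r / 2) => // x y Ax; apply: (rP (r / 2)) => //=.
by rewrite sub0r normrN gtr0_norm// ltr_pdivrMr// ltr_pMr// ltr1n.
Unshelve. all: by end_near. Qed.

Lemma bounded_compact (phi : 'rV[R]_n -> R) (A : set 'rV[R]_n) :
  continuous phi -> compact A -> exists2 S : R, 0 < S & forall x, A x -> `|phi x| <= S.
Proof.
move=> cphi cA.
have /compact_bounded[M [_ MA]] : compact (phi @` A).
  by apply: continuous_compact => //; exact: continuous_subspaceT.
exists (`|M| + 1); first by rewrite ltr_wpDl.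
by move=> x Ax; apply: (MA (`|M| + 1)); [rewrite ltr_pwDr// ler_norm|exists x].
Qed.

End weierstrass.

Section bernstein_approximation.
Context {R : realType} {n : nat}.

(** The hypotheses leave the slack that derivatives need: differentiation removes one step from the
    walk, so a count may be [k - 1], and the mean value theorem gives sample points [xi] off the
    grid by up to one mesh width 2 K / k. *)
Lemma bernstein_weierstrass (K : R) (phi : 'rV[R]_n -> R) (e : R) :
  0 < K -> continuous phi -> 0 < e -> exists2 k0 : nat, (0 < k0)%N &
  forall k, (k0 <= k)%N -> forall w : seq 'I_n,
  (forall l, (count_mem l w <= k <= (count_mem l w).+1)%N) ->
  forall F : multinom n -> R,
  (forall a : multinom n, (forall l, (a l <= count_mem l w)%N) ->
     exists2 xi : 'rV[R]_n, F a = phi xi &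
     forall l, `|xi 0 l - (K *+ 2 * (a l)%:R / k%:R - K)| <= K *+ 2 / k%:R) ->
  forall x, cube_rV K x -> `|peval (bernstein K w F) x - phi x| <= e.
Proof.
move=> K0 cphi e0.
have e2 : 0 < e / 2 by rewrite divr_gt0.
have [d d0 dP] := unif_continuous_compact cphi (@compact_cube_rV R n K) e2.
(* A sample point has coordinates of size at most K + 2 K / k <= 3 K, so [S] bounds [phi] there as
   well. *)
have [S S0 SP] := bounded_compact cphi (@compact_cube_rV R n (K *+ 3)).
(* The first term makes two mesh widths, 4 K / k, at most [d / 2]; the second makes the variance
   term [M * (n * k)] at most [e / 2]. *)
pose B := 8 * K / d + 64 * S * K ^+ 2 * n%:R / (d ^+ 2 * e) + 1.
have B0 : 0 < B.
  rewrite /B ltr_wpDl// addr_ge0// divr_ge0 ?mulr_ge0 ?ler0n ?exprn_ge0 ?ltW//.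
exists (Num.truncn B).+1 => // k Bk w wk F FP x Kx.
have {}Bk : B <= k%:R.
  by rewrite (le_trans (ltW (truncnS_gt _)))// ler_nat.
have k0 : 0 < k%:R :> R := lt_le_trans B0 Bk.
have kd : 8 * K <= k%:R * d.
  rewrite -ler_pdivrMr//; apply: le_trans Bk; rewrite /B -addrA lerDl.
  by rewrite addr_ge0// divr_ge0 ?mulr_ge0 ?ler0n ?exprn_ge0 ?ltW.
have ke : 64 * S * K ^+ 2 * n%:R <= k%:R * (d ^+ 2 * e).
  rewrite -ler_pdivrMr ?mulr_gt0 ?exprn_gt0//; apply: le_trans Bk.
  rewrite /B [8 * K / d + _]addrC -addrA lerDl.
  by rewrite addr_ge0// divr_ge0 ?mulr_ge0 ?ler0n ?exprn_ge0 ?ltW.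
have K2 : 0 < K *+ 2 by rewrite pmulrn_lgt0.
pose u l := peval (bern_var K l) x.
have uE l : x 0 l = K *+ 2 * u l - K.
  rewrite /u /bern_var pevalZ pevalD pevalXU pevalC mulrA divff ?mul1r ?addrK//.
  by rewrite mulrn_eq0/= gt_eqF.
have u01 l : 0 <= u l <= 1.
  have /andP[] := Kx l; rewrite uE.
  by move: (u l) => v; move: (K) K0 => K' *; apply/andP; split; nra.
(* [M] times the square of the threshold d k / (4 K) for far endpoints is exactly [2 * S]. *)
pose M := 32 * S * K ^+ 2 / (d ^+ 2 * k%:R ^+ 2).
have M0 : 0 <= M by rewrite divr_ge0 ?mulr_ge0 ?exprn_ge0 ?ltW.
apply: (@le_trans _ _ (e / 2 + M * (n * k)%:R)); last first.
  rewrite [leRHS]splitr lerD2l /M natrM mulrAC ler_pdivrMr ?mulr_gt0 ?exprn_gt0//.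
  have := ler_wpM2r (ltW k0) ke.
  by lra.
apply: bernstein_estimate => // [l|a aw]; first by have /andP[] := wk l.
have [xi -> xiP] := FP a aw.
(* One of the two extra mesh widths is the distance of [xi] from the grid, the other is due to the
   step that may be missing in [w]. *)
have xix l : `|xi 0 l - x 0 l| <= K *+ 2 / k%:R * (`|(a l)%:R - (count_mem l w)%:R * u l| + 2).
  set D := (a l)%:R - _.
  have -> : xi 0 l - x 0 l = (xi 0 l - (K *+ 2 * (a l)%:R / k%:R - K)) +
      K *+ 2 / k%:R * (D - (k%:R - (count_mem l w)%:R) * u l).
    by rewrite uE /D; field; rewrite gt_eqF// -(ltr0n R).
  apply: le_trans (ler_normD _ _) _.
  have Kk : 0 < K *+ 2 / k%:R by exact: divr_gt0.
  rewrite normrM (gtr0_norm Kk).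
  have kw : `|D - (k%:R - (count_mem l w)%:R) * u l| <= `|D| + 1.
    apply: le_trans (ler_normB _ _) _; rewrite lerD2l.
    have /andP[cl lc] := wk l.
    have /andP[u0 u1] := u01 l.
    rewrite normrM !ger0_norm ?subr_ge0 ?ler_nat//.
    rewrite mulr_ile1// ?subr_ge0 ?ler_nat//.
    by rewrite lerBlDl natr1 ler_nat.
  have := ler_wpM2l (ltW Kk) kw.
  have := xiP l; lra.
have sq0 (j : 'I_n) : true -> 0 <= ((a j)%:R - (count_mem j w)%:R * u j) ^+ 2 by rewrite sqr_ge0.
(* Near endpoints are handled by uniform continuity. At far ones the crude bound [S + S] is absorbed
   by the variance term of a single coordinate. *)
have [near|] := boolP [forall l, `|(a l)%:R - (count_mem l w)%:R * u l| < d * k%:R / (4 * K)].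
  apply: (@le_trans _ _ (e / 2)); last by rewrite lerDl mulr_ge0// sumr_ge0.
  rewrite distrC; apply: dP => //; split => // i l; rewrite ord1 /ball/= distrC.
  apply: le_lt_trans (xix l) _.
  have := forallP near l; set D := `|_|.
  rewrite ltr_pdivlMr ?mulr_gt0// => Dd.
  by rewrite mulrAC ltr_pdivrMr//; lra.
rewrite negb_forall => /existsP[l]; rewrite -leNgt => far.
apply: (@le_trans _ _ (S + S)).
  apply: le_trans (ler_normB _ _) _; rewrite lerD// SP// => j.
    have := xiP j; rewrite ler_distl => /andP[].
    have a0 : 0 <= K *+ 2 * (a j)%:R / k%:R.
      by apply: divr_ge0 => //; apply: mulr_ge0 => //; exact: ltW.
    have a1 : K *+ 2 * (a j)%:R / k%:R <= K *+ 2.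
      rewrite ler_pdivrMr// (ler_wpM2l (ltW K2))// ler_nat.
      by have /andP[+ _] := wk j; apply: leq_trans.
    have k1 : K *+ 2 / k%:R <= K *+ 2.
      rewrite ler_pdivrMr// (ler_peMr (ltW K2))// ler1n -(ltr0n R); exact: k0.
    by move=> ? ?; lra.
  by have /andP[] := Kx j; move=> ? ?; lra.
apply: (@le_trans _ _ (M * ((a l)%:R - (count_mem l w)%:R * u l) ^+ 2)); last first.
  rewrite (bigD1 l)//= mulrDr addrCA lerDl addr_ge0 ?(ltW e2)// mulr_ge0// sumr_ge0// => j _.
  exact: sqr_ge0.
rewrite -real_normK ?num_real//.
apply: (@le_trans _ _ (M * (d * k%:R / (4 * K)) ^+ 2)).
  rewrite /M [leRHS](_ : _ = S + S)//; field.
  by rewrite !gt_eqF.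
rewrite ler_wpM2l// ler_pXn2r ?nnegrE// divr_ge0 ?mulr_ge0 ?ltW//.
Qed.
End bernstein_approximation.

Section C1_approximation.
Context {R : realType} {n : nat}.

(** With [k] steps in each direction, [bernstein] is the classical tensor-product Bernstein
    polynomial of degree [k] in each variable. *)
Definition uniform_walk k : seq 'I_n := flatten (nseq k (enum 'I_n)).

Lemma count_uniform_walk k l : count_mem l (uniform_walk k) = k.
Proof.
elim: k => //= k IH; rewrite /uniform_walk /= count_cat IH.
by rewrite count_uniq_mem ?enum_uniq// mem_enum.
Qed.

Definition grid (K : R) k (a : multinom n) : 'rV[R]_n :=
  \row_l (K *+ 2 * (a l)%:R / k%:R - K).

Theorem weierstrass (K : R) (phi : 'rV[R]_n -> R) (e : R) :
  0 < K -> continuous phi -> 0 < e ->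
  exists q : mpoly n R, forall x, cube_rV K x -> `|peval q x - phi x| <= e.
Proof.
move=> K0 cphi e0.
have [k k0 kP] := bernstein_weierstrass K0 cphi e0.
exists (bernstein K (uniform_walk k) (phi \o grid K k)) => x.
apply: (kP k) => // [l|a _]; first by rewrite count_uniform_walk leqnn leqnSn.
exists (grid K k a) => // l; rewrite mxE subrr normr0.
by rewrite divr_ge0// mulrn_wge0// ltW.
Qed.

Lemma mean_value_rV (v : 'rV[R]_n -> R) (x u : 'rV[R]_n) (s : R) : 0 < s ->
  (forall y, differentiable v y) ->
  exists2 r : R, 0 < r < s & v (s *: u + x) - v x = 'D_u v (r *: u + x) * s.
Proof.
move=> s0 dv; pose f (r : R) := v (r *: u + x).
have df r : is_derive r (1 : R) f ('D_u v (r *: u + x)).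
  have /diff_derivable-/(_ u) := dv (r *: u + x).
  rewrite /derive /derivable.
  rewrite (_ : (fun h => h^-1 *: ((v \o _) (h *: u) - _)) =
    (fun h => h^-1 *: ((f \o shift r) (h *: 1) - f r))); last first.
    apply/funext => h; rewrite /= /f; congr (_ *: (v _ - _)).
    by rewrite /shift/= scalerDl -addrA [h *: 1]mulr1.
  by move=> ?; exact: DeriveDef.
have cf : {within `[0, s], continuous f}.
  apply: continuous_subspaceT => r.
  by apply/differentiable_continuous/derivable1_diffP; have [] := df r.
have [r rs] := MVT s0 (fun r _ => df r) cf.
rewrite subr0 /f scale0r add0r => ->; exists r => //.
Qed.

(** The i-th derivative of the Bernstein polynomial of [v] is the Bernstein polynomial of the
    difference quotients of [v] over one mesh width. By the mean value theorem these are values of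
    the i-th partial derivative less than one mesh width away, so the estimate for continuous
    functions applies, with one polynomial for all [i]. Only gradients are approximated, since
    invariance sees nothing else of a test function. *)
Theorem weierstrass_C1 (K : R) (v : 'rV[R]_n -> R) (e : R) :
  0 < K -> C1 v -> 0 < e ->
  exists q : mpoly n R, forall i x, cube_rV K x ->
    `|peval (mderiv i q) x - 'D_(delta_mx 0 i) v x| <= e.
Proof.
move=> K0 [dv cdv] e0.
have /choice[k kP] : forall i, exists k0 : nat, forall k, (k0 <= k)%N ->
  forall w : seq 'I_n,
  (forall l, (count_mem l w <= k <= (count_mem l w).+1)%N) ->
  forall F : multinom n -> R,
  (forall a : multinom n, (forall l, (a l <= count_mem l w)%N) ->
     exists2 xi : 'rV[R]_n, F a = 'D_(delta_mx 0 i) v xi &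
     forall l, `|xi 0 l - (K *+ 2 * (a l)%:R / k%:R - K)| <= K *+ 2 / k%:R) ->
  forall x, cube_rV K x ->
    `|peval (bernstein K w F) x - 'D_(delta_mx 0 i) v x| <= e.
  move=> i; have [k _ kP] := bernstein_weierstrass K0 (cdv i) e0.
  by exists k.
pose N := (\max_i k i).+1.
have K2 : 0 < K *+ 2 by rewrite pmulrn_lgt0.
have N0 : 0 < N%:R :> R by [].
exists (bernstein K (uniform_walk N) (v \o grid K N)) => i x Kx.
rewrite mderiv_bernstein count_uniform_walk pevalZ -peval_bernsteinZ.
apply: (kP i N _ (rem i (uniform_walk N))) => //.
- by apply: leqW; apply: leq_bigmax.
- move=> l; rewrite count_rem !count_uniform_walk.
  by case: ((i \in _) && _); rewrite /=; lia.
move=> a _; pose s := K *+ 2 / N%:R.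
have s0 : 0 < s by exact: divr_gt0.
have [r /andP[r0 rs] rE] := mean_value_rV (grid K N a) (delta_mx 0 i) s0 dv.
exists (r *: delta_mx 0 i + grid K N a).
  rewrite /bern_step /= (_ : grid K N (mnm_add _ _) = s *: delta_mx 0 i + grid K N a).
    by rewrite rE /s; field; rewrite !gt_eqF.
  apply/rowP => l; rewrite !mxE mnmDE mnm1E natrD eq_sym /s.
  by case: eqP => _; rewrite ?mulr1 ?mulr0 /=; ring.
move=> l; rewrite !mxE addrK eqxx /= -/s.
by case: eqP => _; rewrite ?mulr0 ?mulr1 ?normr0 ?ltW// gtr0_norm// ltW.
Qed.

End C1_approximation.

(** * Approximation of Borel sets by squares of polynomials *)

Lemma ler_dist_max (R : realDomainType) (a b c d : R) :
  `|Num.max a b - Num.max c d| <= `|a - c| + `|b - d|.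
Proof.
have := ler_norm (a - c); have := ler_norm (b - d).
have := ler_norm (c - a); have := ler_norm (d - b).
rewrite (distrC c) (distrC d) => *; rewrite ler_distl.
by case: (leP a b) => ?; case: (leP c d) => ?; apply/andP; split; lra.
Qed.

Section continuous_approximation.
Context {R : realType} {n : nat}.
Local Open Scope ereal_scope.

Lemma continuous_measurable_rV (phi : 'rV[R]_n -> R) :
  continuous phi -> measurable_fun setT phi.
Proof.
move=> cphi; apply: (measurability _ (RGenOpens.measurableE R)) => _ [_ [a [b ->] <-]].
rewrite setTI; apply: open_measurable_rV.
by apply: open_comp => [x _|]; [exact: cphi|exact: interval_open].
Qed.

Variable rho : {finite_measure set 'rV[R]_n -> \bar R}.

(** The range [0, 1] is preserved by the operations used for complements and unions, [1 - phi] and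
    [max], and it makes the square root of [phi] available and bounded by 1. *)
Definition approximable (A : set 'rV[R]_n) : Prop := measurable A /\
  forall e : R, (0 < e)%R -> exists phi : 'rV[R]_n -> R,
    [/\ continuous phi, forall x, (0 <= phi x <= 1)%R &
        \int[rho]_x `|\1_A x - phi x|%:E < e%:E].

Lemma approximableC A : approximable A -> approximable (~` A).
Proof.
move=> [mA H]; split => [|e e0]; first exact: measurableC.
have [phi [cphi phi01 phiA]] := H e e0.
exists (fun x => 1 - phi x)%R; split.
- by move=> x; apply: continuousB; [exact: cst_continuous|exact: cphi].
- by move=> x; have /andP[? ?] := phi01 x; rewrite subr_ge0 lerBlDr lerDl; apply/andP.
- rewrite (eq_integral (fun x => `|\1_A x - phi x|%:E)) // => x _.
  rewrite !indicE in_setC -normrN; congr (`| _ |%:E)%R.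
  by case: (x \in A) => /=; ring.
Qed.

Lemma measurable_fun_dist (f g : 'rV[R]_n -> R) :
  measurable_fun setT f -> measurable_fun setT g ->
  measurable_fun setT (fun x => `|f x - g x|%:E).
Proof.
move=> mf mg; apply/measurable_EFinP; apply: measurableT_comp => //.
exact: measurable_funB.
Qed.

Lemma approximableU A B : approximable A -> approximable B -> approximable (A `|` B).
Proof.
move=> [mA HA] [mB HB]; split => [|e e0]; first exact: measurableU.
have e2 : (0 < e / 2)%R by rewrite divr_gt0.
have [phi [cphi phi01 phiA]] := HA _ e2; have [psi [cpsi psi01 psiB]] := HB _ e2.
exists (fun x => Num.max (phi x) (psi x)); split.
- by move=> x; apply: continuous_max; [exact: cphi|exact: cpsi].
- move=> x; have /andP[? ?] := phi01 x; have /andP[? ?] := psi01 x.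
  by rewrite le_max ge_max; apply/andP; split; [apply/orP; left|apply/andP].
apply: (@le_lt_trans _ _ (\int[rho]_x (`|\1_A x - phi x|%:E + `|\1_B x - psi x|%:E))).
  have mphi := continuous_measurable_rV cphi.
  have mpsi := continuous_measurable_rV cpsi.
  apply: ge0_le_integral => //.
  - apply: measurable_fun_dist; last exact: measurable_maxr.
    by apply: measurable_indic; exact: measurableU.
  - by apply: emeasurable_funD; exact: measurable_fun_dist.
  move=> x _; rewrite -EFinD lee_fin.
  have -> : \1_(A `|` B) x = Num.max (\1_A x) (\1_B x) :> R.
    by rewrite !indicE in_setU; case: (x \in A); case: (x \in B);
      rewrite /= ?maxxx// /Num.max ?ltxx ?ltr01 ?ltr10.
  exact: ler_dist_max.
rewrite ge0_integralD//.
  by rewrite [e]splitr EFinD lteD.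
all: apply: measurable_fun_dist => //; exact: continuous_measurable_rV.
Qed.

Lemma measure_bigcup_approx (F : (set 'rV[R]_n)^nat) (e : R) :
  (forall k, measurable (F k)) -> nondecreasing_seq F -> (0 < e)%R ->
  exists k, rho ((\bigcup_k F k) `\` F k) < e%:E.
Proof.
move=> mF ndF e0.
have mU : measurable (\bigcup_k F k) by exact: bigcup_measurable.
have fU : rho (\bigcup_k F k) \is a fin_num by exact: fin_num_measure.
have fF k : rho (F k) \is a fin_num by exact: fin_num_measure.
have cF : fine (rho (F k)) @[k --> \oo] --> fine (rho (\bigcup_k F k)).
  by apply: fine_cvg; rewrite fineK//; exact: nondecreasing_cvg_mu.
have /cvgrPdist_lt/(_ e e0)[k _ /(_ k (leqnn k)) /= kP] := cF.
exists k; rewrite measureD//; last by rewrite ltey_eq fU.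
rewrite setIidr; last exact: bigcup_sup.
rewrite -[X in X - _]fineK; last exact: fU.
rewrite -[X in _ - X]fineK; last exact: fF.
rewrite -EFinB lte_fin.
exact: le_lt_trans (ler_norm _) kP.
Qed.

Lemma approximable_bigcup (F : (set 'rV[R]_n)^nat) :
  (forall k, approximable (F k)) -> nondecreasing_seq F ->
  approximable (\bigcup_k F k).
Proof.
move=> HF ndF; have mF k : measurable (F k) by have [] := HF k.
have mU : measurable (\bigcup_k F k) by exact: bigcup_measurable.
split=> // e e0; have e2 : (0 < e / 2)%R by rewrite divr_gt0.
have [k kP] := measure_bigcup_approx mF ndF e2.
have [phi [cphi phi01 phiA]] := (HF k).2 _ e2.
have mphi := continuous_measurable_rV cphi.
exists phi; split => //.
apply: (@le_lt_trans _ _ (\int[rho]_x ((\1_(\bigcup_k F k `\` F k) x)%:E +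
    `|\1_(F k) x - phi x|%:E))).
  apply: ge0_le_integral => //.
  - exact: measurable_fun_dist.
  - apply: emeasurable_funD; last exact: measurable_fun_dist.
    by apply/measurable_EFinP/measurable_indic; exact: measurableD.
  move=> x _; rewrite -EFinD lee_fin.
  rewrite -(subrKA (\1_(F k) x)) (le_trans (ler_normD _ _))// lerD2r.
  rewrite ger0_norm.
    rewrite lerBlDr !indicE -natrD ler_nat in_setD.
    by case: (x \in F k); case: (x \in _).
  rewrite subr_ge0 !indicE ler_nat; case: (boolP (x \in F k)) => // /set_mem Fx.
  by rewrite mem_set//; exists k.
rewrite ge0_integralD//.
- rewrite integral_indic// ?setIT; last exact: measurableD.
  by rewrite [e]splitr EFinD lteD.
- by apply/measurable_EFinP/measurable_indic; exact: measurableD.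
- exact: measurable_fun_dist.
Qed.

End continuous_approximation.

Section polynomial_approximation.
Context {R : realType} {n : nat}.
Variable rho : {finite_measure set 'rV[R]_n -> \bar R}.
Local Open Scope ereal_scope.

Lemma approximable_halfspace (i : 'I_n) (a : R) :
  approximable rho [set x : 'rV[R]_n | (a < x 0%R i)%R].
Proof.
set H := (X in approximable _ X).
pose B k := [set x : 'rV[R]_n | (a + k.+1%:R^-1 <= x 0%R i)%R].
have mB k : measurable (B k).
  rewrite (_ : B k = (fun x : 'rV[R]_n => x 0%R i) @^-1` `[(a + k.+1%:R^-1)%R, +oo[).
    by rewrite -[X in measurable X]setTI; exact: measurable_coord_rV.
  by apply/seteqP; split => x /=; rewrite in_itv/= andbT.
have HE : H = \bigcup_k B k.
  apply/seteqP; split => [x /= ax|x [k _] /=]; last first.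
    by apply: lt_le_trans; rewrite ltrDl invr_gt0.
  have [k /ltW kP] := ltr_add_invr ax; exists k => //=.
have mH : measurable H by rewrite HE; exact: bigcup_measurable.
split=> // e e0.
have ndB : nondecreasing_seq B.
  move=> k l kl; apply/subsetPset => x; rewrite /B /=; apply: le_trans.
  by rewrite lerD2l lef_pV2 ?posrE// ler_nat.
have [k kP] := measure_bigcup_approx rho mB ndB e0.
(* A steep ramp that is 0 off the half-space and 1 on [B k]: it differs from the indicator only on
   the small set between them. *)
pose phi (x : 'rV[R]_n) := (Num.min 1 (Num.max 0 (k.+1%:R * (x 0%R i - a))))%R.
have cphi : continuous phi.
  move=> x; apply: (@continuous_min _ _ (fun=> 1%R) _ x); first exact: cst_continuous.
  apply: (@continuous_max _ _ (fun=> 0%R) _ x); first exact: cst_continuous.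
  apply: continuousM; first exact: cst_continuous.
  by apply: continuousB; [exact: coord_continuous|exact: cst_continuous].
exists phi; split => //.
- by move=> x; rewrite /phi le_min ge_min lexx le_max lexx ler01.
apply: le_lt_trans kP; rewrite -HE.
rewrite -[H `\` B k]setIT -integral_indic//; last exact: measurableD.
apply: ge0_le_integral => //.
- apply: measurable_fun_dist; [exact: measurable_indic|].
  exact: continuous_measurable_rV.
- by apply/measurable_EFinP/measurable_indic; exact: measurableD.
move=> x _; rewrite lee_fin !indicE in_setD /phi.
have k0 : (0 < k.+1%:R :> R)%R by [].
case: (boolP (x \in H)) => [/set_mem /= ax|/negP xH] /=.
  case: (boolP (x \in B k)) => [/set_mem /= bx|_] /=.
    rewrite min_l ?subrr ?normr0//.
    rewrite le_max -ler_pdivrMl// mulr1 lerBrDl bx orbT//.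
  rewrite ger0_norm; last by rewrite subr_ge0 ge_min lexx.
  by rewrite lerBlDr lerDl le_min ler01 le_max lexx.
have xa : (x 0%R i <= a)%R by rewrite leNgt; apply/negP => ?; apply: xH; exact: mem_set.
rewrite max_l ?min_r ?subrr ?normr0//.
by rewrite pmulr_rle0// subr_le0.
Qed.

Lemma approximable_bigcup_gen (F : (set 'rV[R]_n)^nat) :
  (forall k, approximable rho (F k)) -> approximable rho (\bigcup_k F k).
Proof.
move=> HF; rewrite -bigcup_bigsetU_bigcup; apply: approximable_bigcup => [k|].
  elim: k => [|k IH]; first by rewrite big_ord1.
  by rewrite big_ord_recr /=; exact: approximableU.
move=> k l kl; apply/subsetPset; exact: (@subset_bigsetU _ F).
Qed.

Lemma approximable0 : approximable rho set0.
Proof.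
split => // e e0; exists (fun=> 0%R); split.
- by move=> x; exact: cst_continuous.
- by move=> x; rewrite lexx ler01.
- rewrite (eq_integral (cst 0)) ?integral0 ?lte_fin//.
  by move=> x _; rewrite indic0 subrr normr0.
Qed.

(** The approximable sets form a sigma-algebra [G]. That it contains the Borel sets is read as
    measurability of the identity from R^n with [G] to R^n, which can be checked coordinatewise,
    hence on half-spaces. *)
Lemma approximable_measurable A : measurable A -> approximable rho A.
Proof.
pose G := [set A | approximable rho A].
have sG : sigma_algebra setT G.
  split; [exact: approximable0|move=> B HB|exact: approximable_bigcup_gen].
  by rewrite setTD; exact: approximableC.
have mid : measurable_fun setT (id : g_sigma_algebraType G -> 'rV[R]_n).
  apply: measurable_fun_rV => i.
  apply: (measurability _ (RGenOInfty.measurableE R)) => _ [_ [a ->] <-].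
  rewrite setTI; apply: sub_sigma_algebra; rewrite /G /=.
  rewrite (_ : _ @^-1` _ = [set x : 'rV[R]_n | (a < x 0%R i)%R]).
    exact: approximable_halfspace.
  by apply/seteqP; split => x /=; rewrite in_itv/= andbT.
move=> mA; have := mid measurableT _ mA; rewrite setTI.
by apply: (smallest_sub sG).
Qed.

Lemma polynomial_approximation (K : R) (A : set 'rV[R]_n) (e : R) :
  (0 < K)%R -> rho (~` cube_rV K) = 0 -> measurable A -> (0 < e)%R ->
  exists q : mpoly n R, \int[rho]_x `|\1_A x - peval (q ^+ 2) x|%:E < e%:E.
Proof.
move=> K0 rhoK mA e0.
have e2 : (0 < e / 2)%R by rewrite divr_gt0.
have [_ /(_ _ e2)[phi [cphi phi01 phiA]]] := approximable_measurable mA.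
have fT : rho setT \is a fin_num by exact: fin_num_measure.
(* The added 1 covers a null [rho]. If s = sqrt phi <= 1 and |q - s| <= d <= 1, then |q^2 - s^2| <=
   d (2 s + d) <= 3 d, and 3 d m <= e / 2. *)
pose m := (fine (rho setT) + 1)%R.
have m0 : (0 < m)%R by rewrite ltr_wpDl// fine_ge0.
pose d := (Num.min 1 (e / (6 * m)))%R.
have d0 : (0 < d)%R by rewrite lt_min ltr01 divr_gt0// mulr_gt0.
(* Approximating sqrt phi instead of phi makes the approximant a square. *)
have csq : continuous (fun x => Num.sqrt (phi x)).
  by move=> x; apply: continuous_comp; [exact: cphi|exact: sqrt_continuous].
have [q qP] := weierstrass K0 csq d0.
exists q.
have mphi := continuous_measurable_rV cphi.
have mq := @measurable_peval R n (q ^+ 2)%R.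
apply: (@le_lt_trans _ _ (\int[rho]_x (`|\1_A x - phi x|%:E + (cst (3 * d)%:E) x))).
  have m1 : measurable_fun setT (fun x => `|\1_A x - phi x|%:E).
    exact: measurable_fun_dist.
  apply: ae_ge0_le_integral => //.
  - exact: measurable_fun_dist.
  - by move=> x _; rewrite -EFinD lee_fin addr_ge0// mulr_ge0// ltW.
  - exact: emeasurable_funD.
  exists (~` cube_rV K); split; [by apply: measurableC; exact: measurable_box_rV|exact: rhoK|].
  apply: subsetC => x Kx _ /=; rewrite -EFinD lee_fin.
  rewrite -(subrKA (phi x)) (le_trans (ler_normD _ _))// lerD2l.
  have /andP[p0 p1] := phi01 x.
  have s1 : (Num.sqrt (phi x) <= 1)%R by rewrite -sqrtr1 ler_wsqrtr.
  have s0 := sqrtr_ge0 (phi x).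
  have d1 : (d <= 1)%R by rewrite ge_min lexx.
  have := qP x Kx; rewrite pevalXn -{2}(sqr_sqrtr p0); move: s0 s1.
  move: (Num.sqrt _) (peval q x) => s z s0 s1.
  rewrite ler_distl => /andP[h1 h2].
  rewrite ler_distl; apply/andP; split; nra.
rewrite ge0_integralD//; last 2 first.
- exact: measurable_fun_dist.
- by move=> x _; rewrite lee_fin mulr_ge0// ltW.
rewrite integral_cst// -[X in (_ * X)]fineK; last exact: fT.
rewrite -EFinM [e]splitr EFinD; apply: lte_leD => //; rewrite lee_fin.
have dm : (d * (6 * m) <= e)%R by rewrite -ler_pdivlMr ?mulr_gt0// ge_min lexx orbT.
move: dm; rewrite /m; have := fine_ge0 (measure_ge0 rho setT); nra.
Qed.

End polynomial_approximation.

(** * Densities and moments *)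

Section finite_sum.
Context d (T : measurableType d) (R : realType).
Variables m1 m2 : {finite_measure set T -> \bar R}.

Let measure_add_fin : fin_num_fun (measure_add m1 m2).
Proof.
by move=> A mA; rewrite measure_addE fin_numD !fin_num_measure.
Qed.

HB.instance Definition _ := Measure.copy (measure_add m1 m2)
  (msum (fun n => if n is 0%N then m1 : {measure set T -> \bar R} else m2) 2).

HB.instance Definition _ :=
  @Measure_isFinite.Build d T R (measure_add m1 m2) measure_add_fin.

End finite_sum.

Section density.
Context d (T : measurableType d) (R : realType).
Implicit Types (rho : {finite_measure set T -> \bar R}) (h : T -> R) (X : set T).
Local Open Scope ereal_scope.

Lemma ae_null rho X (P : T -> Prop) : measurable X -> rho (~` X) = 0 ->
  (forall x, X x -> P x) -> \forall x \ae rho, P x.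
Proof.
move=> mX rX XP; exists (~` X); split => //; first exact: measurableC.
by apply: subsetC => x /XP.
Qed.

Lemma integrable_mul_bounded rho X (F h : T -> R) C :
  measurable X -> rho (~` X) = 0 -> measurable_fun setT F ->
  (forall x, X x -> (`|F x| <= C)%R) -> rho.-integrable setT (EFin \o h) ->
  rho.-integrable setT (fun x => (F x * h x)%:E).
Proof.
move=> mX rX mF FC ih.
have mh : measurable_fun setT h by exact/measurable_EFinP/(measurable_int rho).
have mFh : measurable_fun setT (fun x => F x * h x)%R by exact: measurable_funM.
apply/integrableP; split; first exact/measurable_EFinP.
apply: (@le_lt_trans _ _ (\int[rho]_x (`|C%:E| * `|(h x)%:E|))).
  apply: ae_ge0_le_integral => //.
  - by apply: measurableT_comp => //; exact/measurable_EFinP.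
  - by apply: measurable_funeM; apply: measurableT_comp => //; exact/measurable_EFinP.
  apply: ae_null mX rX _ => x Xx _.
  rewrite /= lee_fin normrM ler_wpM2r//; apply: le_trans (ler_norm _).
  exact: FC.
rewrite ge0_integralZl//; last first.
  by apply: measurableT_comp => //; exact/measurable_EFinP.
rewrite lte_mul_pinfty//; first by move/integrableP : ih => [].
Qed.

Lemma integrable_bounded rho X (F : T -> R) C :
  measurable X -> rho (~` X) = 0 -> measurable_fun setT F ->
  (forall x, X x -> (`|F x| <= C)%R) -> rho.-integrable setT (EFin \o F).
Proof.
move=> mX rX mF FC.
have i1 : rho.-integrable setT (EFin \o (fun=> 1%R)).
  by apply: finite_measure_integrable_cst.
have := integrable_mul_bounded mX rX mF FC i1.
by apply: eq_integrable => // x _ /=; rewrite mulr1.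
Qed.

(** [h] agrees almost everywhere with the Radon-Nikodym derivative of [nu], for which the change of
    variables is known. *)
Lemma integral_density (nu lam : {finite_measure set T -> \bar R}) h (f : T -> \bar R) :
  measurable_fun setT h ->
  (forall A, measurable A -> nu A = \int[lam]_(x in A) (h x)%:E) ->
  nu.-integrable setT f ->
  \int[nu]_x f x = \int[lam]_x (f x * (h x)%:E).
Proof.
move=> mh nuE intf.
have nl : nu `<< lam.
  apply/null_content_dominatesP => A mA lA; rewrite nuE// null_set_integral//.
  by apply/measurable_funTS/measurable_EFinP.
rewrite -(Radon_Nikodym_change_of_variables nl)//.
have iR := @Radon_Nikodym_integrable _ _ _ (charge_of_finite_measure nu) lam nl.
apply: ae_eq_integral => //.
- by apply: emeasurable_funM; [exact: measurable_int intf|exact: measurable_int iR].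
- by apply: emeasurable_funM; [exact: measurable_int intf|exact/measurable_EFinP].
apply: ae_eqe_mul2l; apply: integral_ae_eq => //; first exact/measurable_EFinP.
move=> E _ mE; rewrite -nuE// -Radon_Nikodym_integral//.
Qed.

(** On the set of integration [h] equals -|h|, so a nonnegative integral forces the integral of |h|
    there to be 0. *)
Lemma ae_ge0_integral_neg (lam : {finite_measure set T -> \bar R}) h :
  measurable_fun setT h ->
  0 <= \int[lam]_(x in [set x | (h x < 0)%R]) (h x)%:E ->
  \forall x \ae lam, (0 <= h x)%R.
Proof.
move=> mh; set A := (X in _ <= integral _ X _).
have mA : measurable A.
  rewrite (_ : A = h @^-1` `]-oo, 0%R[).
    by rewrite -[X in measurable X]setTI; exact: mh.
  by apply/seteqP; split => x /=; rewrite in_itv.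
have mEh : measurable_fun A (EFin \o h) by exact/measurable_funTS/measurable_EFinP.
rewrite (eq_integral (fun x => - `|(h x)%:E|)); last first.
  by move=> x /set_mem /= hx; rewrite ltr0_norm// opprK.
rewrite integral_ge0N// leeNr oppe0 => le0.
have /(ae_eq_integral_abs lam mA mEh) : \int[lam]_(x in A) `|(EFin \o h) x| = 0.
  by apply/eqP; rewrite eq_le le0 integral_ge0.
apply: filterS => x /= hA; rewrite leNgt; apply/negP => hx.
by have [h0] := hA hx; rewrite h0 ltxx in hx.
Qed.

(** The integral of [h] over the set where it is negative is a value of [nu], hence nonnegative; so
    [h] is nonnegative almost everywhere, and the integral of |h| is the finite number [nu setT]. *)
Lemma density_integrable (nu lam : {finite_measure set T -> \bar R}) h :
  measurable_fun setT h ->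
  (forall A, measurable A -> nu A = \int[lam]_(x in A) (h x)%:E) ->
  lam.-integrable setT (EFin \o h) /\ \forall x \ae lam, (0 <= h x)%R.
Proof.
move=> mh nuE; have h0 : \forall x \ae lam, (0 <= h x)%R.
  apply: ae_ge0_integral_neg => //; rewrite -nuE//.
  rewrite (_ : [set x | _] = h @^-1` `]-oo, 0%R[).
    by rewrite -[X in measurable X]setTI; exact: mh.
  by apply/seteqP; split => x /=; rewrite in_itv.
have mEh : measurable_fun setT (EFin \o h) by exact/measurable_EFinP.
split => //; apply/integrableP; split => //.
rewrite (ae_eq_integral (EFin \o h)) -?nuE//.
- by rewrite ltey_eq fin_num_measure.
- exact: measurableT_comp.
- by apply: filterS h0 => x h0 _ /=; rewrite ger0_norm.
Qed.

End density.

Section density_measure.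
Context d (T : measurableType d) (R : realType).
Variables (lam : {finite_measure set T -> \bar R}) (h : T -> R).
Hypothesis (h0 : forall x, 0 <= h x) (ih : lam.-integrable setT (EFin \o h)).
Local Open Scope ereal_scope.

(* The proofs are arguments so that the measure instances can be keyed on the
   density. *)
Definition density_measure & (forall x, (0 <= h x)%R)
    & lam.-integrable setT (EFin \o h) : set T -> \bar R :=
  fun A => \int[lam]_(x in A) (h x)%:E.

Local Notation nu := (density_measure h0 ih).

Let nu0 : nu set0 = 0. Proof. exact: integral_set0. Qed.

Let nu_ge0 A : 0 <= nu A.
Proof. by apply: integral_ge0 => x _; rewrite lee_fin. Qed.

Let nu_sigma_additive : semi_sigma_additive nu.
Proof.
apply: semi_sigma_additive_nng_induced; first exact: (measurable_int lam).
by move=> x; rewrite lee_fin.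
Qed.

HB.instance Definition _ := isMeasure.Build _ _ _ nu nu0 nu_ge0 nu_sigma_additive.

Let nu_fin : fin_num_fun nu.
Proof. by move=> A mA; apply: integrable_fin_num => //; exact: integrableS ih. Qed.

HB.instance Definition _ := @Measure_isFinite.Build d T R nu nu_fin.

End density_measure.

Section moments.
Context {R : realType} {n : nat}.
Variable K : R.
Hypothesis K0 : 0 < K.
Local Open Scope ereal_scope.
Local Notation X := (cube_rV K : set 'rV[R]_n).

Let mX : measurable X.
Proof. exact: measurable_box_rV. Qed.

Lemma peval_bounded (q : mpoly n R) :
  exists C : R, forall x, X x -> (`|peval q x| <= C)%R.
Proof.
have [C _ CP] := bounded_compact (@continuous_peval R n q) (@compact_cube_rV R n K).
by exists C.
Qed.

Lemma integrable_indic_sqr (rho : {finite_measure set 'rV[R]_n -> \bar R}) A (q : mpoly n R) :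
  rho (~` X) = 0 -> measurable A ->
  rho.-integrable setT (EFin \o (fun x => \1_A x - peval (q ^+ 2) x)%R).
Proof.
move=> rX mA; have [C CP] := peval_bounded (q ^+ 2)%R.
apply: (@integrable_bounded _ _ _ rho X _ (1 + C)%R mX rX).
  by apply: measurable_funB; [exact: measurable_indic|exact: measurable_peval].
move=> x Xx; apply: le_trans (ler_normB _ _) _; rewrite lerD ?CP//.
by rewrite indicE ger0_norm ?ler0n// lern1 leq_b1.
Qed.

(** One polynomial has to approximate the indicator of [A] in L^1 of both measures, so the
    approximation is carried out for their sum. *)
Lemma measure_moments_le (m1 m2 : {finite_measure set 'rV[R]_n -> \bar R}) :
  m1 (~` X) = 0 -> m2 (~` X) = 0 ->
  (forall q : mpoly n R, \int[m1]_x (peval q x)%:E = \int[m2]_x (peval q x)%:E) ->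
  forall A, measurable A -> m1 A <= m2 A.
Proof.
move=> m1X m2X m12 A mA.
apply/lee_addgt0Pr => e e0; have e2 : (0 < e / 2)%R by rewrite divr_gt0.
have rX : measure_add m1 m2 (~` X) = 0.
  by rewrite measure_addE [X in X + _]m1X [X in _ + X]m2X adde0.
have [q qA] := polynomial_approximation K0 rX mA e2.
have mq : measurable_fun setT (fun x : 'rV[R]_n => (peval (q ^+ 2) x)%:E).
  by apply/measurable_EFinP; exact: measurable_peval.
have q0 x : 0 <= (peval (q ^+ 2) x)%:E by rewrite lee_fin pevalXn sqr_ge0.
have mD : measurable_fun setT (fun x => `|\1_A x - peval (q ^+ 2) x|%:E).
  by apply: measurable_fun_dist; [exact: measurable_indic|exact: measurable_peval].
have m1A : measurable_fun setT (fun x : 'rV[R]_n => (\1_A x : R)%:E).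
  by apply/measurable_EFinP; exact: measurable_indic.
move: qA; rewrite ge0_integral_measure_add// => qA.
have B1 : m1 A <= \int[m1]_x `|\1_A x - peval (q ^+ 2) x|%:E +
    \int[m1]_x (peval (q ^+ 2) x)%:E.
  rewrite -[A in m1 A]setIT -integral_indic// -ge0_integralD//.
  apply: ge0_le_integral => //; first exact: emeasurable_funD.
  by move=> x _; rewrite -EFinD lee_fin -lerBlDr ler_norm.
have B2 : \int[m2]_x (peval (q ^+ 2) x)%:E <=
    \int[m2]_x `|\1_A x - peval (q ^+ 2) x|%:E + m2 A.
  rewrite -[A in m2 A]setIT -integral_indic// -ge0_integralD//.
  apply: ge0_le_integral => //; first exact: emeasurable_funD.
  by move=> x _; rewrite -EFinD lee_fin -lerBlDr distrC ler_norm.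
apply: le_trans B1 _; rewrite m12; apply: le_trans (leeD2l _ B2) _.
rewrite addeA addeC leeD2l//; apply: ltW; apply: lt_le_trans qA _.
by rewrite lee_fin ler_pdivrMr// ler_peMr ?ler1n// ltW.
Qed.

Lemma measure_moments_eq (m1 m2 : {finite_measure set 'rV[R]_n -> \bar R}) :
  m1 (~` X) = 0 -> m2 (~` X) = 0 ->
  (forall q : mpoly n R, \int[m1]_x (peval q x)%:E = \int[m2]_x (peval q x)%:E) ->
  forall A, measurable A -> m1 A = m2 A.
Proof.
move=> m1X m2X m12 A mA; apply/eqP; rewrite eq_le.
by rewrite !measure_moments_le.
Qed.

End moments.

Section positivity.
Context {R : realType} {n : nat}.
Variable K : R.
Hypothesis K0 : 0 < K.
Local Notation X := (cube_rV K : set 'rV[R]_n).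
Variable lam : {finite_measure set 'rV[R]_n -> \bar R}.
Hypothesis lamX : lam (~` X) = 0%E.

Let mX : measurable X.
Proof. exact: measurable_box_rV. Qed.

Lemma integrable_peval_mul (q : mpoly n R) h :
  lam.-integrable setT (EFin \o h) ->
  lam.-integrable setT (fun x => (peval q x * h x)%:E).
Proof.
have [C CP] := peval_bounded K q.
exact: (integrable_mul_bounded mX lamX (measurable_peval q) CP).
Qed.

(** The indicator of the set where [h] is negative is approximated by a square in L^1 of the measure
    |h| dlam: the error is then already weighted by [h], and integrability of [h] suffices. *)
Lemma ae_ge0_sqr_moments (h : 'rV[R]_n -> R) :
  lam.-integrable setT (EFin \o h) ->
  (forall q : mpoly n R, 0 <= \int[lam]_x (peval (q ^+ 2) x * h x)) ->
  \forall x \ae lam, 0 <= h x.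
Proof.
move=> ih hq.
have mh : measurable_fun setT h.
  by apply/measurable_EFinP; exact: measurable_int ih.
apply: ae_ge0_integral_neg => //; set A := [set x | h x < 0].
have mA : measurable A.
  rewrite (_ : A = h @^-1` `]-oo, 0%R[).
    by rewrite -[Y in measurable Y]setTI; exact: mh.
  by apply/seteqP; split => x /=; rewrite in_itv.
have ihA : lam.-integrable A (EFin \o h) by exact: integrableS ih.
rewrite -(fineK (integrable_fin_num mA ihA)) lee_fin -[fine _]/(\int[lam]_(x in A) h x).
have ah0 x : 0 <= `|h x| by [].
have iah : lam.-integrable setT (EFin \o (fun x => `|h x|)).
  by have := integrable_abse ih; apply: eq_integrable.
pose rho := density_measure ah0 iah.
have rX : rho (~` X) = 0%E.
  rewrite /rho /density_measure null_set_integral//; first exact: measurableC.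
  by apply: measurable_funTS; exact: measurable_int iah.
apply/ler_addgt0Pr => e e0; rewrite -lerBlDr sub0r.
have [q qA] := @polynomial_approximation R n rho K A e K0 rX mA e0.
have iq := @integrable_indic_sqr R n K rho A q rX mA.
have iA : lam.-integrable setT (EFin \o (fun x => \1_A x * h x)).
  have A1 x : X x -> `|\1_A x| <= 1 :> R.
    by move=> _; rewrite indicE ger0_norm ?ler0n// lern1 leq_b1.
  exact: (integrable_mul_bounded mX lamX _ A1).
have iqh := integrable_peval_mul (q ^+ 2) ih.
have IA : \int[lam]_(x in A) h x = \int[lam]_x (\1_A x * h x).
  rewrite Rintegral_mkcond; apply: eq_Rintegral => x _.
  by rewrite patchE indicE; case: (x \in A); rewrite ?mul1r ?mul0r.
have iD : lam.-integrable setT (EFin \o (fun x => \1_A x * h x - peval (q ^+ 2) x * h x)).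
  by have := integrableB measurableT iA iqh; apply: eq_integrable.
have -> : \int[lam]_(x in A) h x = \int[lam]_x (peval (q ^+ 2) x * h x) +
    \int[lam]_x (\1_A x * h x - peval (q ^+ 2) x * h x).
  by rewrite RintegralB// IA addrC subrK.
have le_e : `|\int[lam]_x (\1_A x * h x - peval (q ^+ 2) x * h x)| <= e.
  apply: le_trans (le_normr_Rintegral _ iD) _ => //.
  rewrite /Rintegral -[e]/(fine e%:E) fine_le//.
    apply: integrable_fin_num => //.
    by have := integrable_abse iD; apply: eq_integrable.
  apply/ltW/(le_lt_trans _ qA).
  rewrite (@integral_density _ _ _ rho lam (fun x => `|h x|))//.
  - rewrite le_eqVlt; apply/orP; left; apply/eqP; apply: eq_integral => x _.
    by rewrite -EFinM -normrM mulrBl.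
  - exact: measurableT_comp.
  - by have := integrable_abse iq; apply: eq_integrable.
have := hq q; move: le_e; rewrite ler_norml => /andP[? _] ?; lra.
Qed.

End positivity.

(** * Moment matrices as Gram matrices of polynomials *)

Section gram.
Context {R : realType} {n : nat}.
Implicit Types (y : multinom n -> R) (p q w : mpoly n R) (d : nat).
Local Notation basis d := (bmultinom n d.+1).

Lemma rieszZ y c p : riesz y (c *: p) = c * riesz y p.
Proof. exact: linearZ. Qed.

Lemma riesz_sum y (I : Type) (r : seq I) (P : pred I) (F : I -> mpoly n R) :
  riesz y (\sum_(i <- r | P i) F i) = \sum_(i <- r | P i) riesz y (F i).
Proof. exact: linear_sum. Qed.

Definition vec_poly d (u : 'cV[R]_#|{: basis d}|) : mpoly n R :=
  \sum_i u i 0 *: mpolyX R (basis_elt i).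

Definition poly_vec d q : 'cV[R]_#|{: basis d}| :=
  \col_i mcoeff (basis_elt i) q.

Lemma poly_vecK d q : (mmeasure mdeg q <= d.+1)%N -> vec_poly (poly_vec d q) = q.
Proof.
move=> qd; rewrite [RHS](mpolywE qd) /vec_poly.
rewrite (reindex (@enum_val _ {: basis d})) /=; last first.
  by exists enum_rank => i _; [exact: enum_valK|exact: enum_rankK].
by apply: eq_bigr => i _; rewrite mxE.
Qed.

Lemma vec_polyK d (u : 'cV[R]_#|{: basis d}|) : poly_vec d (vec_poly u) = u.
Proof.
apply/colP => i; rewrite mxE /vec_poly raddf_sum (bigD1 i)//= big1 => [|j ji].
  by rewrite mcoeffZ mcoeffX eqxx mulr1 addr0.
rewrite mcoeffZ mcoeffX /basis_elt.
case: eqP => [/val_inj/enum_val_inj ij|]; last by rewrite mulr0.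
by rewrite ij eqxx in ji.
Qed.

Lemma msize_vec_poly d (u : 'cV[R]_#|{: basis d}|) :
  (mmeasure mdeg (vec_poly u) <= d.+1)%N.
Proof.
apply: leq_trans (mmeasure_sum _ _ _ _) _; apply/bigmax_leqP => i _.
apply: leq_trans (mmeasureZ_le _ _ _) _; rewrite mmeasureX.
exact: bmdeg (enum_val i).
Qed.

(** Through this identity every semidefinite condition is used in polynomial form; matrices remain
    only in the inverse that defines h^r. *)
Lemma localizing_form d w y (u v : 'cV[R]_#|{: basis d}|) :
  (u^T *m localizing d w y *m v) 0 0 = riesz y (w * vec_poly u * vec_poly v).
Proof.
rewrite mxE /vec_poly mulr_sumr riesz_sum; apply: eq_bigr => j _.
rewrite mxE -scalerAr rieszZ [RHS]mulrC; congr (_ * _).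
rewrite -mulrA mulr_suml mulr_sumr riesz_sum; apply: eq_bigr => i _.
by rewrite !mxE mpolyXD -scalerAl -scalerAr rieszZ.
Qed.

Lemma low_moments_form d y (u : 'cV[R]_#|{: basis d}|) :
  (u^T *m low_moments d y) 0 0 = riesz y (vec_poly u).
Proof.
rewrite mxE /vec_poly riesz_sum; apply: eq_bigr => i _.
by rewrite !mxE rieszZ rieszX.
Qed.

Lemma localizing_sym d w y : (localizing d w y)^T = localizing d w y :> 'M[R]_#|{: basis d}|.
Proof.
apply/matrixP => i j; rewrite !mxE; congr (riesz y (w * mpolyX _ _)).
by apply/mnmP => k; rewrite !mnmDE addnC.
Qed.

Lemma psd_localizing d w y :
  psd (localizing d w y : 'M[R]_#|{: basis d}|) <->
  forall q, (mmeasure mdeg q <= d.+1)%N -> 0 <= riesz y (w * q ^+ 2).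
Proof.
split => [[_ H] q qd|H].
  by have := H (poly_vec d q); rewrite localizing_form poly_vecK// -mulrA.
split => [|v]; first exact: localizing_sym.
by rewrite localizing_form -mulrA; exact/H/msize_vec_poly.
Qed.

(** A kernel vector of the moment matrix is the coefficient vector of a polynomial [q] with l(q^2) =
    0. *)
Lemma moment_mx_unit d y :
  (forall q, riesz y (q ^+ 2) = 0 -> q = 0) ->
  (moment_mx d y : 'M[R]_#|{: basis d}|) \in unitmx.
Proof.
move=> H; rewrite -row_free_unit -kermx_eq0; apply/rowV0P => v /sub_kermxP vM.
have /H : riesz y (vec_poly v^T ^+ 2) = 0.
  have := localizing_form 1 y v^T v^T; rewrite mul1r => <-.
  by rewrite trmxK -/(moment_mx d y) vM mul0mx mxE.
move=> /(congr1 (poly_vec d)); rewrite vec_polyK => /(congr1 trmx).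
rewrite trmxK => ->; apply/rowP => i; rewrite !mxE mcoeff0//.
Qed.

(* The truncated Riesz representative of l for the inner product given by z. *)
Lemma gram_representation d z y q :
  (moment_mx d z : 'M[R]_#|{: basis d}|) \in unitmx ->
  (mmeasure mdeg q <= d.+1)%N ->
  riesz z (q * vec_poly (invmx (moment_mx d z) *m low_moments d y)) = riesz y q.
Proof.
move=> uM qd; rewrite -[q in LHS](poly_vecK qd) -[vec_poly _ * _]mul1r mulrA.
rewrite -localizing_form -/(moment_mx d z) -mulmxA mulKVmx//.
by rewrite low_moments_form poly_vecK.
Qed.

End gram.

(** * Riesz representation in L^2 *)

Section L2_complete.
Context d (T : measurableType d) (R : realType).
Variable lam : {finite_measure set T -> \bar R}.
Variable f : nat -> T -> R.
Hypothesis mf : forall k, measurable_fun setT (f k).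
Local Open Scope ereal_scope.
Hypothesis cauchy : forall k j, (k <= j)%N ->
  \int[lam]_x ((f j x - f k x) ^+ 2)%:E <= (4^-1 ^+ k)%:E.

Let m_dist k j : measurable_fun setT (fun x => `|f j x - f k x|%:E).
Proof.
by apply/measurable_EFinP; apply: measurableT_comp => //; exact: measurable_funB.
Qed.

Let m_sqr k j : measurable_fun setT (fun x => ((f j x - f k x) ^+ 2)%:E).
Proof. by apply/measurable_EFinP; apply: measurable_funX; exact: measurable_funB. Qed.

Let L := fine (lam setT).

Let lamE : lam setT = L%:E.
Proof. by rewrite fineK// fin_num_measure. Qed.

Let L0 : (0 <= L)%R.
Proof. exact: fine_ge0. Qed.

(* Cauchy-Schwarz in the form |a| <= 2^k a^2 + 2^-k. *)
Let step_L1 k : \int[lam]_x `|f k.+1 x - f k x|%:E <=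
  ((1 + L) * 2 / (2 ^ k.+1)%:R)%:E.
Proof.
have p0 : (0 < 2 ^+ k :> R)%R by rewrite exprn_gt0.
apply: (@le_trans _ _ (\int[lam]_x ((2 ^+ k)%:E * ((f k.+1 x - f k x) ^+ 2)%:E +
    (2 ^- k)%:E))).
  apply: ge0_le_integral => //.
  - by apply: emeasurable_funD => //; exact: measurable_funeM.
  move=> x _; rewrite -EFinM -EFinD lee_fin.
  rewrite -real_normK ?num_real//; move: `| _ |%R (normr_ge0 (f k.+1 x - f k x)%R) => a a0.
  rewrite -(ler_pM2l p0) mulrDr divff ?gt_eqF//.
  move: (2 ^+ k)%R p0 => s s0; have : (0 <= (s * a - 1) ^+ 2 + s * a)%R.
    by rewrite addr_ge0 ?sqr_ge0// mulr_ge0// ltW.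
  by lra.
rewrite ge0_integralD//; last 2 first.
- by move=> x _; rewrite -EFinM lee_fin mulr_ge0 ?sqr_ge0// ltW.
- exact: measurable_funeM.
rewrite ge0_integralZl//; last by move=> x _; rewrite lee_fin sqr_ge0.
rewrite integral_cst// [X in _ + _ * X]lamE.
apply: (@le_trans _ _ ((2 ^+ k)%:E * (4^-1 ^+ k)%:E + (2 ^- k)%:E * L%:E)).
  by rewrite leeD2r// lee_wpmul2l ?cauchy// lee_fin ltW.
rewrite -!EFinM -EFinD lee_fin natrX exprS.
rewrite le_eqVlt; apply/orP; left; apply/eqP.
have -> : (4^-1 ^+ k = 2 ^- k * 2 ^- k :> R)%R.
  by rewrite -invfM -exprMn -exprVn; congr (_^-1 ^+ k)%R; ring.
by field; rewrite gt_eqF.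
Qed.

(** The increments have summable L^1 norms, so the sum of their absolute values is integrable, hence
    finite almost everywhere, and the telescoping series converges absolutely there. *)
Lemma ae_cvg_L2 : \forall x \ae lam, cvgn (fun k => f k x).
Proof.
pose g x := \big[+%E/0]_(0 <= k <oo) `|f k.+1 x - f k x|%:E.
have ig : \int[lam]_x g x < +oo.
  rewrite integral_nneseries//.
  apply: (@le_lt_trans _ _ ((1 + L) * 2)%:E); last exact: ltry.
  apply: le_trans (epsilon_trick0 xpredT _); last by rewrite mulr_ge0// addr_ge0.
  by apply: lee_nneseries => k *; [exact: integral_ge0|exact: step_L1].
have g0 x : 0 <= g x by apply: nneseries_ge0.
have mg : measurable_fun setT g by apply: ge0_emeasurable_sum.
have /(integrable_ae measurableT) : lam.-integrable setT g.
  apply/integrableP; split => //; under eq_integral do rewrite gee0_abs//.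
  exact: ig.
apply: filterS => x /(_ I) gx.
have : cvgn (series (telescope (f ^~ x))).
  apply: normed_cvg; apply: nondecreasing_is_cvgn.
    by apply: nondecreasing_series => k _ _ /=.
  exists (fine (g x)) => _ [k _ <-] /=.
  rewrite -lee_fin fineK// -sumEFin.
  exact: (nneseries_lim_ge (u_ := fun k => `|f k.+1 x - f k x|%:E)).
rewrite telescopeK => cf.
rewrite (_ : (fun k => f k x) = (fun k => (f k x - f 0%N x) + f 0%N x)%R).
  by apply: is_cvgD => //; exact: is_cvg_cst.
by apply/funext => k; rewrite subrK.
Qed.

Lemma L2_complete : exists2 h : T -> R, measurable_fun setT h &
  forall k, \int[lam]_x ((h x - f k x) ^+ 2)%:E <= (4^-1 ^+ k)%:E.
Proof.
(* The upper limit is measurable everywhere, whether or not the sequence converges at [x]. *)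
pose h x := fine (limn_esup (fun k => (f k x)%:E)).
have mh : measurable_fun setT h.
  apply: (measurableT_comp (fine_measurable measurableT)).
  by apply: measurable_fun_limn_esup => k; exact/measurable_EFinP.
exists h => // k.
pose F j x := ((f (k + j)%N x - f k x) ^+ 2)%:E.
have mF j : measurable_fun setT (F j) by exact: m_sqr.
(* Almost everywhere the integrand is the limit of [F j x], so Fatou's lemma carries the Cauchy
   bound over to [h]. *)
apply: (@le_trans _ _ (\int[lam]_x limn_einf (F ^~ x))).
  apply: ae_ge0_le_integral => //.
  - by move=> x _; rewrite lee_fin sqr_ge0.
  - by apply/measurable_EFinP; apply: measurable_funX; exact: measurable_funB.
  - move=> x _; rewrite limn_einf_lim; apply: lime_ge; first exact: is_cvg_einfs.
    apply: nearW => j; apply: le_ereal_inf_tmp => _ [i _ <-].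
    by rewrite lee_fin sqr_ge0.
  - rewrite (_ : (fun x => _) = (fun x => - limn_esup (fun j => - F j x))).
      apply: measurableT_comp => //; apply: measurable_fun_limn_esup => j.
      by apply: measurableT_comp => //.
    by apply/funext => x; rewrite (limn_esupN (F ^~ x)) oppeK.
  apply: filterS ae_cvg_L2 => x cf _.
  have cfh : f j x @[j --> \oo] --> h x.
    rewrite /h (_ : limn_esup _ = (limn (fun k => f k x))%:E) //.
    have cE : (f j x)%:E @[j --> \oo] --> (limn (fun k => f k x))%:E.
      by apply: cvg_EFin; [exact: nearW|exact: cf].
    by have [_ ->] := cvg_limn_einf_sup cE.
  rewrite (cvg_limn_einf_sup (l := ((h x - f k x) ^+ 2)%:E))//.
  apply: cvg_EFin; first exact: nearW.
  have cd : (f (k + j)%N x - f k x)%R @[j --> \oo] --> (h x - f k x)%R.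
    apply: cvgB; last exact: cvg_cst.
    rewrite (_ : (fun j => _) = (fun j => f (j + k)%N x)).
      by rewrite (cvg_shiftn k (fun j => f j x)).
    by apply/funext => j; rewrite addnC.
  rewrite (_ : _ \o _ = (fun j => (f (k + j)%N x - f k x) * (f (k + j)%N x - f k x))%R).
    by rewrite expr2; exact: cvgM.
  by apply/funext => j; rewrite /F /= expr2.
apply: le_trans (fatou _ measurableT mF _) _; first by move=> j x _; rewrite lee_fin sqr_ge0.
rewrite limn_einf_lim; apply: lime_le; first exact: is_cvg_einfs.
apply: nearW => j; apply: (@le_trans _ _ (\int[lam]_x F j x)).
  by apply: ereal_inf_lbound; exists j => /=.
by apply: cauchy; exact: leq_addr.
Qed.

End L2_complete.

Section square_integrable.
Context d (T : measurableType d) (R : realType).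
Variable lam : {finite_measure set T -> \bar R}.
Implicit Types f g : T -> R.

Definition square_integrable f := measurable_fun setT f /\
  lam.-integrable setT (EFin \o (fun x => f x ^+ 2)).

Lemma square_integrableP f : measurable_fun setT f ->
  (\int[lam]_x (f x ^+ 2)%:E < +oo)%E -> square_integrable f.
Proof.
move=> mf fi; split => //; apply/integrableP; split.
  by apply/measurable_EFinP; exact: measurable_funX.
apply: le_lt_trans fi; rewrite le_eqVlt; apply/orP; left; apply/eqP.
by apply: eq_integral => x _ /=; rewrite ger0_norm ?sqr_ge0.
Qed.

Lemma square_integrableM f g : square_integrable f -> square_integrable g ->
  lam.-integrable setT (EFin \o (fun x => f x * g x)).
Proof.
move=> [mf fi] [mg gi]; apply: (le_integrable measurableT _ _ (integrableD measurableT fi gi)).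
  by apply/measurable_EFinP; exact: measurable_funM.
move=> x _ /=; rewrite lee_fin [leRHS]ger0_norm ?addr_ge0 ?sqr_ge0//.
rewrite ler_norml; apply/andP.
have := sqr_ge0 (f x - g x); have := sqr_ge0 (f x + g x).
by have := sqr_ge0 (f x); have := sqr_ge0 (g x); split; nra.
Qed.

Lemma square_integrable_cst c : square_integrable (cst c).
Proof. by split => //; exact: (finite_measure_integrable_cst lam (c ^+ 2)). Qed.

Lemma square_integrableW f : square_integrable f -> lam.-integrable setT (EFin \o f).
Proof.
move=> fi; have := square_integrableM fi (square_integrable_cst 1).
by apply: eq_integrable => // x _ /=; rewrite mulr1.
Qed.

Lemma square_integrableZ c f : square_integrable f -> square_integrable (fun x => c * f x).
Proof.
move=> [mf fi]; split; first exact: measurable_funM.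
have := integrableZl measurableT (c ^+ 2) fi.
by apply: eq_integrable => // x _ /=; rewrite exprMn.
Qed.

Lemma square_integrableD f g : square_integrable f -> square_integrable g ->
  square_integrable (fun x => f x + g x).
Proof.
move=> fi gi; split; first by apply: measurable_funD; [exact: fi.1|exact: gi.1].
have := integrableD measurableT (integrableD measurableT fi.2 gi.2)
  (square_integrableM (square_integrableZ 2 fi) gi).
by apply: eq_integrable => // x _ /=; congr (_%:E); ring.
Qed.

Lemma square_integrableB f g : square_integrable f -> square_integrable g ->
  square_integrable (fun x => f x - g x).
Proof.
move=> fi gi; have := square_integrableD fi (square_integrableZ (-1) gi).
rewrite (_ : (fun x => f x + -1 * g x) = (fun x => f x - g x))//.
by apply/funext => x; rewrite mulN1r.
Qed.

End square_integrable.

Lemma riesz_scalarE {R : realType} {n : nat} (l : mpoly n R -> R) :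
  scalar l -> forall q, riesz (fun a => l (mpolyX R a)) q = l q.
Proof.
move=> hl q.
pose H := GRing.isLinear.Build R (mpoly n R) R *%R l hl.
pose L : {scalar mpoly n R} := HB.pack l H.
exact: (riesz_id L).
Qed.

Section riesz_representation.
Context {R : realType} {n : nat}.
Variable K : R.
Variable lam : {finite_measure set 'rV[R]_n -> \bar R}.
Hypothesis lamX : lam (~` (cube_rV K : set 'rV[R]_n)) = 0%E.
Implicit Types (p q : mpoly n R).

Lemma square_integrable_peval q : square_integrable lam (peval q).
Proof.
split; first exact: measurable_peval.
have [C CP] := peval_bounded K (q ^+ 2).
have mX : measurable (cube_rV K : set 'rV[R]_n) by exact: measurable_box_rV.
have := integrable_bounded mX lamX (measurable_peval (q ^+ 2)) CP.
by apply: eq_integrable => // x _ /=; rewrite pevalXn.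
Qed.

Lemma integrable_peval q : lam.-integrable setT (EFin \o peval q).
Proof. exact/square_integrableW/square_integrable_peval. Qed.

Lemma weighted_scalar (h : 'rV[R]_n -> R) : lam.-integrable setT (EFin \o h) ->
  scalar (fun q => \int[lam]_x (peval q x * h x)).
Proof.
move=> ih c p q.
have ip := integrable_peval_mul lamX p ih; have iq := integrable_peval_mul lamX q ih.
have icp : lam.-integrable setT (EFin \o (fun x => c * (peval p x * h x))).
  by have := integrableZl measurableT c ip; apply: eq_integrable.
rewrite -RintegralZl// -RintegralD//; apply: eq_Rintegral => x _.
by rewrite pevalD pevalZ; ring.
Qed.

Lemma mean_scalar : scalar (fun q => \int[lam]_x peval q x).
Proof.
have i1 : lam.-integrable setT (EFin \o (fun=> 1 : R)).
  exact: finite_measure_integrable_cst.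
have E q : \int[lam]_x peval q x = \int[lam]_x (peval q x * 1).
  by apply: eq_Rintegral => x _; rewrite mulr1.
by move=> c p q; rewrite !E; exact: weighted_scalar.
Qed.

End riesz_representation.

Lemma half_expr_le {R : archiRealFieldType} (e : R) k0 : 0 < e ->
  exists2 k, (k0 <= k)%N & 2^-1 ^+ k <= e.
Proof.
move=> e0; pose k := maxn k0 (Num.truncn e^-1).+1.
exists k; first exact: leq_maxl.
rewrite exprVn -[leRHS]invrK lef_pV2 ?posrE ?invr_gt0 ?exprn_gt0//.
apply: (le_trans (ltW (truncnS_gt _))); rewrite -natrX ler_nat.
by apply: leq_trans (ltnW (ltn_expl k (ltnSn 1))); exact: leq_maxr.
Qed.

(** A substitute for the Cauchy-Schwarz inequality, |a b| <= s a^2 + b^2 / s; the weight [s] is free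
    and will be matched to the rate of convergence. *)
Lemma square_integrable_amgm d (T : measurableType d) (R : realType)
    (lam : {finite_measure set T -> \bar R}) (f g : T -> R) (s : R) : 0 < s ->
  square_integrable lam f -> square_integrable lam g ->
  `|\int[lam]_x (f x * g x)| <= s * \int[lam]_x (f x ^+ 2) + s^-1 * \int[lam]_x (g x ^+ 2).
Proof.
move=> s0 fi gi; have fg := square_integrableM fi gi.
have sf : lam.-integrable setT (EFin \o (fun x => s * f x ^+ 2)).
  by have := integrableZl measurableT s fi.2; apply: eq_integrable.
have sg : lam.-integrable setT (EFin \o (fun x => s^-1 * g x ^+ 2)).
  by have := integrableZl measurableT s^-1 gi.2; apply: eq_integrable.
have afg : lam.-integrable setT (EFin \o (fun x => `|f x * g x|)).
  by have := integrable_abse fg; apply: eq_integrable.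
apply: le_trans (le_normr_Rintegral _ fg) _ => //.
rewrite -RintegralZl//; last exact: fi.2.
rewrite -RintegralZl//; last exact: gi.2.
rewrite -RintegralD//; apply: le_Rintegral => //.
  by have := integrableD measurableT sf sg; apply: eq_integrable.
move=> x _; rewrite -(ler_pM2l s0) mulrDr [s * (s^-1 * _)]mulrA divff ?gt_eqF// mul1r.
rewrite normrM -(real_normK (num_real (f x))) -(real_normK (num_real (g x))).
move: `|f x| `|g x| (normr_ge0 (f x)) (normr_ge0 (g x)) => a b a0 b0.
have : 0 <= (s * a - b) ^+ 2 + s * (a * b) by rewrite addr_ge0 ?sqr_ge0// !mulr_ge0// ltW.
nra.
Qed.

Section riesz_theorem.
Context {R : realType} {n : nat}.
Variable K : R.
Variable lam : {finite_measure set 'rV[R]_n -> \bar R}.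
Hypothesis lamX : lam (~` (cube_rV K : set 'rV[R]_n)) = 0%E.
Implicit Types (p q : mpoly n R).
Local Notation E q := (\int[lam]_x peval q x).
Hypothesis nondegenerate : forall q, E (q ^+ 2) = 0 -> q = 0.
Variables (l : mpoly n R -> R) (C : R).
Hypothesis C0 : 0 <= C.
Hypotheses (hl : scalar l) (lC : forall q, l q ^+ 2 <= C * E (q ^+ 2)).

Let z a := E (mpolyX R a).

Let zE q : riesz z q = E q.
Proof. exact: (riesz_scalarE (mean_scalar lamX)). Qed.

Let E_sqr_ge0 q : 0 <= E (q ^+ 2).
Proof. by apply: Rintegral_ge0 => x _; rewrite pevalXn sqr_ge0. Qed.

(** The representative of [l] among polynomials of degree at most [d], that is, the L^2 projection
    of the density sought onto these polynomials. *)
Let h d := vec_poly (invmx (moment_mx d z) *m low_moments d (fun a => l (mpolyX R a))).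

Let Eh d q : (mmeasure mdeg q <= d.+1)%N -> E (q * h d) = l q.
Proof.
move=> qd; rewrite -zE gram_representation//; first exact: riesz_scalarE.
by apply: moment_mx_unit => w; rewrite zE; exact: nondegenerate.
Qed.

Let N d := E (h d ^+ 2).

Let N_l d : N d = l (h d).
Proof. by rewrite /N expr2 Eh//; exact: msize_vec_poly. Qed.

(** [N d] is both the squared norm of [h d] and [l (h d)], so the bound on [l] reads N^2 <= C N. *)
Let N_C d : N d <= C.
Proof.
have := E_sqr_ge0 (h d); rewrite -/(N d) le_eqVlt => /predU1P[<-//|N0].
have := lC (h d); rewrite -N_l -/(N d) expr2.
by rewrite ler_pM2r.
Qed.

Let E_sub p q : E (p - q) = E p - E q.
Proof.
rewrite -RintegralB//; [|exact: (integrable_peval lamX)..].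
by apply: eq_Rintegral => x _; rewrite pevalB.
Qed.

(* The N d increase and are bounded by C, so this makes the h d a Cauchy sequence
   of L^2. *)
Let E_dist d e : (d <= e)%N -> E ((h e - h d) ^+ 2) = N e - N d.
Proof.
move=> de; have -> : (h e - h d) ^+ 2 = h e ^+ 2 - h d * h e - (h d * h e - h d ^+ 2).
  by move: (h e) (h d) => a b; ring.
have Ede : E (h d * h e) = N d.
  by rewrite N_l; apply: Eh; apply: leq_trans (msize_vec_poly _) _; rewrite ltnS.
rewrite E_sub [X in X - _]E_sub [X in _ - X]E_sub Ede.
by rewrite -/(N e) -/(N d) subrr subr0.
Qed.

Lemma riesz_representation : exists h : 'rV[R]_n -> R,
  [/\ square_integrable lam h, forall q, \int[lam]_x (peval q x * h x) = l q &
      \int[lam]_x (h x ^+ 2) <= C].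
Proof.
have ndN : nondecreasing_seq N.
  by move=> d e de; rewrite -subr_ge0 -E_dist.
have cN : cvgn N.
  by apply: nondecreasing_is_cvgn => //; exists C => _ [d _ <-]; exact: N_C.
pose S := limn N.
have NS d : N d <= S by exact: nondecreasing_cvgn_le.
have SN : forall k : nat, exists D, forall d, (D <= d)%N -> S - N d <= 4^-1 ^+ k.
  move=> k; have p0 : 0 < 4^-1 ^+ k :> R by rewrite exprn_gt0.
  have /cvgrPdist_le/(_ _ p0)[D _ DP] := cN.
  by exists D => d /DP; exact: le_trans (ler_norm _).
have [D DP] := choice SN.
(* Taking the maximum of [D i] over [i <= k] makes [dk] nondecreasing and gives the rate 4^-k;
   adding [k] ensures that every polynomial eventually has degree at most [dk k]. *)
pose dk k := (k + \max_(i < k.+1) D i)%N.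
have dk_k k : (k <= dk k)%N by exact: leq_addr.
have dk_D k : S - N (dk k) <= 4^-1 ^+ k.
  apply: DP; apply: leq_trans (leq_addl _ _).
  exact: (leq_bigmax (ord_max : 'I_k.+1)).
have dk_le k j : (k <= j)%N -> (dk k <= dk j)%N.
  move=> kj; apply: leq_add => //; apply/bigmax_leqP => i _.
  have ij : (i < j.+1)%N by apply: leq_trans (ltn_ord i) _.
  exact: (leq_bigmax (Ordinal ij)).
pose f k := peval (h (dk k)).
have si k : square_integrable lam (f k) by exact: (square_integrable_peval lamX).
have fine_si (u : 'rV[R]_n -> R) : square_integrable lam u ->
    (\int[lam]_x (u x ^+ 2)%:E = (\int[lam]_x (u x ^+ 2))%:E)%E.
  by move=> [_ iu]; rewrite /Rintegral fineK//; exact: integrable_fin_num.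
have [k j kj|u mu uP] := @L2_complete _ _ _ lam f (fun k => (si k).1).
  rewrite fine_si; last exact: square_integrableB.
  rewrite lee_fin (eq_Rintegral lam (g := peval ((h (dk j) - h (dk k)) ^+ 2))); last first.
    by move=> x _; rewrite pevalXn pevalB.
  by rewrite E_dist ?dk_le//; apply: le_trans (dk_D k); rewrite lerB.
have sid k : square_integrable lam (fun x => u x - f k x).
  apply: square_integrableP; first by apply: measurable_funB => //; exact: (si k).1.
  by apply: le_lt_trans (uP k) _; rewrite ltry.
have siu : square_integrable lam u.
  have := square_integrableD (sid 0) (si 0).
  by rewrite (_ : (fun x => _) = u)//; apply/funext => x; rewrite subrK.
have {}uP k : \int[lam]_x ((u x - f k x) ^+ 2) <= 4^-1 ^+ k.
  by rewrite -lee_fin -fine_si.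
have p42 k : 4^-1 ^+ k = 2^-1 ^+ k * 2^-1 ^+ k :> R.
  by rewrite -exprMn; congr (_ ^+ k); field.
have uq q : \int[lam]_x (peval q x * u x) = l q.
  have siq := square_integrable_peval lamX q.
  have E1 k : (mmeasure mdeg q <= k)%N ->
      `|\int[lam]_x (peval q x * u x) - l q| <= 2^-1 ^+ k * (E (q ^+ 2) + 1).
    move=> qk.
    have <- : \int[lam]_x (peval q x * f k x) = l q.
      rewrite -(Eh (d := dk k)).
        by apply: eq_Rintegral => x _; rewrite pevalM.
      by apply: leq_trans qk _; apply: leqW; exact: dk_k.
    have <- : \int[lam]_x (peval q x * (u x - f k x)) =
        \int[lam]_x (peval q x * u x) - \int[lam]_x (peval q x * f k x).
      rewrite -RintegralB//; try exact: square_integrableM.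
      by apply: eq_Rintegral => x _; rewrite mulrBr.
    have p0 : 0 < 2^-1 ^+ k :> R by rewrite exprn_gt0.
    (* With weight 2^-k the two terms are 2^-k E(q^2) and at most 2^k 4^-k = 2^-k. *)
    apply: le_trans (square_integrable_amgm p0 siq (sid k)) _.
    rewrite mulrDr mulr1 lerD//.
      rewrite le_eqVlt (_ : \int[lam]_x (peval q x ^+ 2) = E (q ^+ 2)) ?eqxx//.
      by apply: eq_Rintegral => x _; rewrite pevalXn.
    have := ler_wpM2l (ltW (_ : 0 < (2^-1 ^+ k)^-1 :> R)) (uP k).
    rewrite invr_gt0 => /(_ p0)/le_trans; apply.
    by rewrite p42 mulrA mulVf ?gt_eqF// mul1r.
  apply/eqP; rewrite -subr_eq0 -normr_eq0 eq_le normr_ge0 andbT.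
  apply/ler_addgt0Pr => e e0; rewrite add0r.
  have M0 : 0 < E (q ^+ 2) + 1 by rewrite ltr_wpDl// E_sqr_ge0.
  have [k k1 k2] := half_expr_le (mmeasure mdeg q) (divr_gt0 e0 M0).
  by apply: le_trans (E1 k k1) _; rewrite -ler_pdivlMr.
exists u; split => //.
apply/ler_addgt0Pr => e e0.
have [k _ k2] := half_expr_le 0 e0.
(* Pythagoras: [u - f k] is orthogonal to [f k], because [f k] has the same integral against [u] as
   against itself. *)
have -> : \int[lam]_x (u x ^+ 2) = \int[lam]_x ((u x - f k x) ^+ 2) + N (dk k).
  have Nl : \int[lam]_x (f k x * u x) = N (dk k) by rewrite N_l -uq.
  have Nf : \int[lam]_x (f k x ^+ 2) = N (dk k).
    by apply: eq_Rintegral => x _; rewrite pevalXn.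
  have ifu : lam.-integrable setT (EFin \o (fun x => f k x * u x)) by exact: square_integrableM.
  have iB : lam.-integrable setT (EFin \o (fun x => f k x * u x - f k x ^+ 2)).
    by have := integrableB measurableT ifu (si k).2; apply: eq_integrable.
  have iD : lam.-integrable setT (EFin \o (fun x => u x ^+ 2 - f k x * u x)).
    by have := integrableB measurableT siu.2 ifu; apply: eq_integrable.
  rewrite [X in _ = X + _](eq_Rintegral lam (g := fun x =>
    (u x ^+ 2 - f k x * u x) - (f k x * u x - f k x ^+ 2))).
    by rewrite !RintegralB//; [rewrite Nl Nf; ring|exact: (si k).2|exact: siu.2].
  by move=> x _; ring.
rewrite [leRHS]addrC; apply: lerD; last exact: N_C.
apply: le_trans (uP k) _; apply: le_trans k2; rewrite p42 ler_piMr//.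
by rewrite exprn_ile1// invf_le1// ler1n.
Qed.
End riesz_theorem.

(** * Lebesgue measure on the semialgebraic set *)

Lemma poly_roots_finite {F : fieldType} (P : {poly F}) : P != 0 ->
  exists s : seq F, forall t, root P t -> t \in s.
Proof.
have [k] := ubnP (size P); elim: k P => // k IH P Pk P0.
have [[a ra]|nr] := pselect (exists a, root P a); last first.
  by exists [::] => t rt; exfalso; apply: nr; exists t.
have /factor_theorem[Q PQ] := ra.
have Q0 : Q != 0 by apply: contra_neq P0 => Q0; rewrite PQ Q0 mul0r.
have [|s sP] := IH Q _ Q0.
  by move: Pk; rewrite PQ size_Mmonic ?monicXsubC// size_XsubC addn2.
exists (a :: s) => t; rewrite PQ rootM root_XsubC inE orbC => /orP[->//|/sP ->].
by rewrite orbT.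
Qed.

Section zero_set.
Context {R : realType}.

Lemma peval_first_coord n (q : mpoly n.+1 R) (v : 'rV[R]_n) :
  exists P : {poly R}, forall t, P.[t] = peval q (rV_cons (t, v)).
Proof.
move: q; apply: mpoly_ring_ind => [c|i|p q [P PE] [Q QE]|p q [P PE] [Q QE]].
- by exists c%:P => t; rewrite hornerC pevalC.
- case: (unliftP ord0 i) => [j|] ->.
    by exists (v 0 j)%:P => t; rewrite hornerC pevalXU rV_consS.
  by exists 'X => t; rewrite hornerX pevalXU rV_cons0.
- by exists (P + Q) => t; rewrite hornerD pevalD PE QE.
- by exists (P * Q) => t; rewrite hornerM pevalM PE QE.
Qed.

Lemma peval_slice n (q : mpoly n.+1 R) (t : R) :
  exists p : mpoly n R, forall v, peval p v = peval q (rV_cons (t, v)).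
Proof.
move: q; apply: mpoly_ring_ind => [c|i|p q [P PE] [Q QE]|p q [P PE] [Q QE]].
- by exists (mpolyC n c) => v; rewrite !pevalC.
- case: (unliftP ord0 i) => [j|] ->.
    by exists (mpolyX R (mnm1 j)) => v; rewrite !pevalXU rV_consS.
  by exists (mpolyC n t) => v; rewrite pevalXU rV_cons0 pevalC.
- by exists (P + Q) => v; rewrite !pevalD PE QE.
- by exists (P * Q) => v; rewrite !pevalM PE QE.
Qed.

Lemma measurable_zero_set n (q : mpoly n R) : measurable [set x | peval q x = 0].
Proof.
rewrite (_ : [set x | _] = peval q @^-1` [set 0]) //.
by rewrite -[X in measurable X]setTI; exact: measurable_peval.
Qed.

(** Fubini and induction: [q] restricted to the line through [v0] in the first coordinate is a
    nonzero univariate polynomial. Off its finitely many roots [t], the slice of [q] at [t] does not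
    vanish at [v0], so its zero set is null. *)
Lemma lebesgue_zero_set n (q : mpoly n R) (x0 : 'rV[R]_n) : peval q x0 <> 0 ->
  lebesgue_rV n [set x | peval q x = 0] = 0%E.
Proof.
elim: n q x0 => [|n IH] q x0 qx0.
  rewrite /= diracE memNset// => q0; apply: qx0; rewrite -q0.
  by congr peval; apply/rowP => -[].
have [t0 [v0 qtv]] : exists t v, peval q (rV_cons (t, v)) <> 0.
  exists (x0 0 ord0), (\row_j x0 0 (lift ord0 j)).
  rewrite (_ : rV_cons _ = x0)//; apply/rowP => i.
  by rewrite !mxE; case: (unliftP ord0 i) => [j|] ->; rewrite ?liftK ?unlift_none ?mxE.
rewrite [LHS]/= /lebesgue_rV_step /pushforward /product_measure1 /=.
set A := _ @^-1` _.
have mA : measurable A.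
  by rewrite -[X in measurable X]setTI; apply: measurable_rV_cons => //; exact: measurable_zero_set.
have [P PE] := peval_first_coord q v0.
have P0 : P != 0 by apply/eqP => P0; apply: qtv; rewrite -PE P0 horner0.
have [s sP] := poly_roots_finite P0.
rewrite (ae_eq_integral (cst 0%E)) ?integral0//.
  exact: measurable_fun_xsection.
exists [set` s]; split.
- apply: countable_measurable; first exact: measurable_set1.
  by apply: finite_set_countable; exact: finite_seq.
- by apply: countable_lebesgue_measure0; apply: finite_set_countable; exact: finite_seq.
move=> t /=; apply: contra_notP => ts _.
have [p pE] := peval_slice q t.
rewrite (_ : xsection A t = [set v | peval p v = 0]).
  apply: (IH p v0); rewrite pE -PE => Pt0; apply: ts; apply: sP.
  exact/rootP.
by apply/seteqP; split => v; rewrite /xsection /A /= inE /= pE.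
Qed.

End zero_set.

(** * Convergence along ultrafilters *)

Lemma ultra_fmap (T U : Type) (f : T -> U) (F : set_system T) :
  UltraFilter F -> UltraFilter (f @ F).
Proof.
move=> uF; apply: Build_UltraFilter => G pG FG.
apply/seteqP; split => [A GA|//]; rewrite /nbhs /=.
have [//|nA] := in_ultra_setVsetC (f @^-1` A) uF.
have GnA : G (~` A) by exact: FG.
by have [x []] := filter_ex (filterI GA GnA).
Qed.

(** If [u] does not converge to [l], some set [B] of indices where it stays at distance at least [e]
    meets every tail. An ultrafilter containing [B] and all tails then contradicts the
    hypothesis. *)
Lemma cvg_ultra_subfilter {R : realType} (u : R^nat) (l : R) :
  (forall U : set_system nat, UltraFilter U -> \oo `<=` U -> u @ U --> l) ->
  u @ \oo --> l.
Proof.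
move=> H; apply/cvgrPdist_lt => e e0; apply: contrapT => nu.
pose B := [set k : nat | e <= `|l - u k|].
have pF : ProperFilter (within B \oo).
  split; last exact: within_filter.
  rewrite /within /= => B0; apply: nu; apply: filterS B0 => k kB.
  by rewrite ltNge; apply/negP.
have [U [uU FU]] := ultraFilterLemma pF.
have oU : \oo `<=` U.
  by move=> A oA; apply: FU; apply: filterS oA => k.
have := H U uU oU => /cvgrPdist_lt/(_ _ e0) UA.
have UB : U B by apply: FU; rewrite /within /=; exact: nearW.
have [k [/= kA]] := filter_ex (filterI UA UB).
by rewrite /B /= leNgt kA.
Qed.

Section lebesgue_on_compact.
Context {R : realType} {n m : nat}.
Variable g : 'I_m -> mpoly n R.
Hypothesis cX : compact (semialg g).
Local Notation X := (semialg g).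

Lemma semialg_cube : exists2 K : R, 0 < K & X `<=` cube_rV K.
Proof.
have /choice[M MP] : forall i : 'I_n, exists M : R, forall x, X x -> `|x 0 i| <= M.
  move=> i; have [M _ MP] := bounded_compact (@coord_continuous R 1 n 0 i) cX.
  by exists M.
exists (1 + \sum_i `|M i|); first by rewrite ltr_pwDl// sumr_ge0.
move=> x Xx i /=; rewrite -ler_norml; apply: le_trans (MP i x Xx) _.
apply: le_trans (ler_norm _) _; rewrite (bigD1 i)//= addrCA lerDl.
by rewrite addr_ge0// sumr_ge0.
Qed.

(** Compactness of [X] is an argument because the finite-measure instance rests on it; the values
    are those of [lebesgue_on g]. *)
Definition fin_lebesgue & compact X : set 'rV[R]_n -> \bar R := lebesgue_on g.

HB.instance Definition _ := Measure.copy (fin_lebesgue cX) (lebesgue_on g).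

Let fin_lebesgue_fin : fin_num_fun (fin_lebesgue cX).
Proof.
move=> A mA; rewrite ge0_fin_numE ?measure_ge0//.
have [K K0 XK] := semialg_cube.
have mX := measurable_semialg g.
apply: (@le_lt_trans _ _ (lebesgue_rV n (cube_rV K))).
  rewrite /fin_lebesgue /lebesgue_on /= /mrestr le_measure ?inE//.
  - exact: measurableI.
  - exact: measurable_box_rV.
  - by move=> x [_ /XK].
rewrite lebesgue_rV_box ?ltry// => i; apply: ltW.
by rewrite (@lt_trans _ _ 0)// oppr_lt0.
Qed.

HB.instance Definition _ :=
  @Measure_isFinite.Build _ _ _ (fin_lebesgue cX) fin_lebesgue_fin.

Local Notation L := (fin_lebesgue cX).

Lemma fin_lebesgueE (f : 'rV[R]_n -> R) : L.-integrable setT (EFin \o f) ->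
  \int[lebesgue_rV n]_(x in X) f x = \int[L]_x f x.
Proof.
move=> fi; rewrite /Rintegral; congr fine.
have mX := measurable_semialg g.
have LX : L (~` X) = 0%E.
  by rewrite /fin_lebesgue /lebesgue_on /= /mrestr setICl measure0.
rewrite (negligible_integral (measurableC mX) measurableT fi LX).
rewrite setTD setCK; apply: eq_measure_integral => A mA AX.
by rewrite -[RHS]/(lebesgue_rV n (A `&` X)) setIidl.
Qed.

Lemma fin_lebesgue_cube K : X `<=` cube_rV K -> L (~` cube_rV K) = 0%E.
Proof.
move=> XK; rewrite /fin_lebesgue /lebesgue_on /= /mrestr.
rewrite (_ : _ `&` _ = set0) ?measure0//.
by apply/seteqP; split => // x [/= nK /XK].
Qed.

(** A vanishing integral makes [q] zero almost everywhere, whereas the zero set of a nonzero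
    polynomial is null. *)
Lemma fin_lebesgue_nondegenerate (q : mpoly n R) : L setT <> 0%E ->
  \int[L]_x peval (q ^+ 2) x = 0 -> q = 0.
Proof.
move=> LT Lq; apply: contrapT => q0.
have [x0 qx0] : exists x0, peval q x0 <> 0.
  apply: contrapT => nx; apply: q0; apply: peval_inj => x.
  by apply: contrapT => ?; apply: nx; exists x.
have [K K0 XK] := semialg_cube; have LK := fin_lebesgue_cube XK.
have iq := integrable_peval LK (q ^+ 2).
have mq : measurable_fun setT (EFin \o peval (q ^+ 2)) by exact: measurable_int iq.
have : (\int[L]_x `|(EFin \o peval (q ^+ 2)%R) x| = 0)%E.
  rewrite -[RHS]/(0%:E) -Lq /Rintegral fineK ?integrable_fin_num//.
  by apply: eq_integral => x _ /=; rewrite ger0_norm// pevalXn sqr_ge0.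
move=> /(ae_eq_integral_abs L measurableT mq) [N [mN LN qN]].
apply: LT; apply/eqP; rewrite eq_le measure_ge0 andbT.
have mZ := measurable_zero_set q.
have LZ : L [set x | peval q x = 0] = 0%E.
  apply/eqP; rewrite eq_le measure_ge0 andbT -(lebesgue_zero_set qx0).
  rewrite /fin_lebesgue /lebesgue_on /= /mrestr le_measure ?inE//.
  by apply: measurableI => //; exact: measurable_semialg.
apply: (@le_trans _ _ (L (N `|` [set x | peval q x = 0]))).
  rewrite le_measure ?inE//; first exact: measurableU.
  move=> x _; case: (eqVneq (peval q x) 0) => [?|qx]; [by right|left].
  apply: qN => /= /(_ I) [] /eqP; rewrite pevalXn sqrf_eq0.
  by rewrite (negbTE qx).
apply: le_trans (measureU2 _ _ _) _ => //.
by rewrite [X in (X + _ <= _)%E]LN [X in (_ + X <= _)%E]LZ adde0.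
Qed.

End lebesgue_on_compact.

(** * Invariance in terms of moments *)

Lemma cvg_sumr {R : realType} (T I : Type) (U : set_system T) (r : seq I)
    (F : I -> T -> R) (l : I -> R) : Filter U ->
  (forall i, F i @ U --> l i) ->
  (fun x => \sum_(i <- r) F i x) @ U --> \sum_(i <- r) l i.
Proof.
move=> fU Fl; elim: r => [|i r IH].
  rewrite big_nil (_ : (fun _ => _) = cst 0); first exact: cvg_cst.
  by apply/funext => x; rewrite big_nil.
rewrite big_cons (_ : (fun _ => _) = (fun x => F i x + \sum_(j <- r) F j x)).
  exact: cvgD.
by apply/funext => x; rewrite big_cons.
Qed.

Section finite_pushforward.
Context d1 d2 (T1 : measurableType d1) (T2 : measurableType d2) (R : realType).
Variables (mu : {finite_measure set T1 -> \bar R}) (phi : T1 -> T2).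
Hypothesis mphi : measurable_fun setT phi.

Definition finite_pushforward & measurable_fun setT phi : set T2 -> \bar R :=
  pushforward mu phi.

Local Notation nu := (finite_pushforward mphi).

Let nu0 : nu set0 = 0%E. Proof. exact: measure0. Qed.

Let nu_ge0 A : (0 <= nu A)%E. Proof. exact: measure_ge0. Qed.

Let nu_sigma_additive : semi_sigma_additive nu.
Proof.
exact: (@measure_semi_sigma_additive _ _ _
  (measure_function_pushforward__canonical__measure_function_Measure mu mphi)).
Qed.

HB.instance Definition _ := isMeasure.Build _ _ _ nu nu0 nu_ge0 nu_sigma_additive.

Let nu_fin : fin_num_fun nu.
Proof.
move=> A mA; apply: fin_num_measure.
by rewrite -[X in measurable X]setTI; exact: mphi.
Qed.

HB.instance Definition _ := @Measure_isFinite.Build _ _ _ nu nu_fin.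

End finite_pushforward.

Section invariance.
Context {R : realType} {n m : nat}.
Variables (t : time) (f : n.-tuple (mpoly n R)) (g : 'I_m -> mpoly n R).
Hypothesis cX : compact (semialg g).
Local Notation X := (semialg g).

(** The invariance operator on polynomials themselves, so that one condition can be imposed on
    sequences, on functionals and on measures. *)
Definition inv_poly (q : mpoly n R) : mpoly n R :=
  match t with
  | Discrete => comp_mpoly f q - q
  | Continuous => grad_dot f q
  end.

Lemma invariance_formE y q : invariance_form t f y q = riesz y (inv_poly q).
Proof. by rewrite /invariance_form /inv_poly; case: t => //; rewrite linearB. Qed.

Lemma inv_poly_linear : linear inv_poly.
Proof.
move=> c p q; rewrite /inv_poly; case: t; first by rewrite linearP -!mul_mpolyC; ring.
rewrite /grad_dot scaler_sumr -big_split; apply: eq_bigr => i _ /=.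
by rewrite mderivD mderivZ mulrDl scalerAl.
Qed.

Lemma measurable_pmap_eval : measurable_fun setT (pmap_eval f).
Proof.
apply: measurable_fun_rV => i; rewrite (_ : (fun _ => _) = peval (tnth f i)).
  exact: measurable_peval.
by apply/funext => x; rewrite mxE.
Qed.

HB.instance Definition _ :=
  isMeasurableFun.Build _ _ _ _ (pmap_eval f) measurable_pmap_eval.

Lemma peval_grad_dot q x :
  peval (grad_dot f q) x = \sum_(i < n) peval (mderiv i q) x * pmap_eval f x 0 i.
Proof. by rewrite /grad_dot peval_sum; apply: eq_bigr => i _; rewrite pevalM mxE. Qed.

Variable mu : {finite_measure set 'rV[R]_n -> \bar R}.

Let mX := measurable_semialg g.

Lemma integral_supp (F : 'rV[R]_n -> \bar R) : mu (~` X) = 0%E ->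
  mu.-integrable setT F -> (\int[mu]_(x in X) F x = \int[mu]_x F x)%E.
Proof.
move=> muX iF; rewrite [RHS](negligible_integral (measurableC mX) measurableT iF muX).
by rewrite setTD setCK.
Qed.

Lemma supp_cube K : X `<=` cube_rV K -> mu (~` X) = 0%E -> mu (~` cube_rV K) = 0%E.
Proof.
move=> XK muX; apply/eqP; rewrite eq_le measure_ge0 andbT -muX le_measure ?inE//.
- by apply: measurableC; exact: measurable_box_rV.
- exact: measurableC.
- exact: subsetC.
Qed.

Let integrable_supp q : mu (~` X) = 0%E -> mu.-integrable setT (EFin \o peval q).
Proof.
move=> muX; have [K K0 XK] := semialg_cube cX.
exact: (integrable_peval (supp_cube XK muX)).
Qed.

Lemma supp_setI A : mu (~` X) = 0%E -> measurable A -> mu (A `&` X) = mu A.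
Proof.
move=> muX mA; rewrite (measureDI mu mA mX) [Y in _ = (Y + _)%E](_ : _ = 0%E) ?add0e//.
apply/eqP; rewrite eq_le measure_ge0 andbT -muX le_measure ?inE//.
- exact: measurableD.
- exact: measurableC.
Qed.

Lemma measurable_preimage_pmap A : measurable A -> measurable (pmap_eval f @^-1` A).
Proof. by move=> mA; rewrite -[Y in measurable Y]setTI; exact: measurable_pmap_eval. Qed.

Lemma integral_push q : mu (~` X) = 0%E ->
  (\int[pushforward mu (pmap_eval f)]_x (peval q x)%:E =
   \int[mu]_x (peval (comp_mpoly f q) x)%:E)%E.
Proof.
move=> muX; have iqf := integrable_supp (comp_mpoly f q) muX.
rewrite (eq_integral ((EFin \o peval q) \o pmap_eval f) (fun x => (peval (comp_mpoly f q) x)%:E)).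
  rewrite -[setT in RHS](preimage_setT (pmap_eval f)).
  rewrite -(integral_pushforward measurable_pmap_eval)//.
    by apply/measurable_EFinP; exact: measurable_peval.
  rewrite preimage_setT; apply: eq_integrable iqf => // x _ /=.
  by rewrite peval_comp.
by move=> x _ /=; rewrite peval_comp.
Qed.

(** In discrete time the definition speaks only of subsets of [X], and [f] may map points out of
    [X]. Testing it on [X] itself shows that the points leaving [X] are null; hence the push-forward
    of [mu] equals [mu] on all Borel sets. *)
Lemma invariant_moments (q : mpoly n R) : Defs.invariant t f g mu ->
  \int[mu]_x peval (inv_poly q) x = 0.
Proof.
rewrite /Defs.invariant /inv_poly; case: t => -[muX inv].
- have mfA := measurable_preimage_pmap.
  have push A : measurable A -> A `<=` X -> mu (pmap_eval f @^-1` A) = mu A.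
    by move=> mA AX; rewrite -(supp_setI muX (mfA A mA)) setIC; exact: inv.
  have push0 : mu (pmap_eval f @^-1` (~` X)) = 0%E.
    have mE : (mu setT = mu (pmap_eval f @^-1` (~` X)) + mu (pmap_eval f @^-1` X))%E.
      have := measureDI mu (@measurableT _ _) (mfA X mX).
      by rewrite setTI setTD -preimage_setC => h; exact: h.
    have fX : mu X \is a fin_num by exact: fin_num_measure.
    have muT : mu [set: 'rV[R]_n] = mu X.
      by have := supp_setI muX measurableT; rewrite setTI => h; exact/esym/h.
    move: mE; rewrite (push X mX (@subset_refl _ X)) muT.
    move=> /(congr1 (fun z => z - mu X)%E).
    by rewrite (subee fX) (addeK _ fX) => /esym.
  have pushE A : measurable A -> pushforward mu (pmap_eval f) A = mu A.
    move=> mA; rewrite -(supp_setI muX mA) -push; last 2 first.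
    - exact: measurableI.
    - by move=> x [].
    rewrite /pushforward (measureDI mu (mfA A mA) (mfA X mX)).
    rewrite [Y in (Y + _)%E](_ : _ = 0%E) ?add0e//.
    apply/eqP; rewrite eq_le measure_ge0 andbT -push0 le_measure ?inE//.
    - by apply: measurableD; exact: mfA.
    - by apply: mfA; exact: measurableC.
  have iq := integrable_supp q muX.
  have iqf := integrable_supp (comp_mpoly f q) muX.
  transitivity (\int[mu]_x peval (comp_mpoly f q) x - \int[mu]_x peval q x).
    rewrite -RintegralB//.
    by apply: eq_Rintegral => x _; rewrite pevalB.
  apply/eqP; rewrite subr_eq0; apply/eqP; rewrite /Rintegral -integral_push//.
  by congr fine; apply: eq_measure_integral => A mA _; exact: pushE.
- have iq := integrable_supp (grad_dot f q) muX.
  have := inv _ (C1_peval q); rewrite (eq_integral (EFin \o peval (grad_dot f q))).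
    by rewrite integral_supp// /Rintegral => ->.
  move=> x _ /=; rewrite peval_grad_dot; congr (_%:E); apply: eq_bigr => i _.
  congr (_ * _); exact: (congr1 (@^~ x) (derive_peval q i)).
Qed.

(* In discrete time, the push-forward of mu and mu have the same moments and
   compact supports, even if f does not map X to itself. *)
Lemma moments_invariant : mu (~` X) = 0%E ->
  (forall q : mpoly n R, \int[mu]_x peval (inv_poly q) x = 0) ->
  Defs.invariant t f g mu.
Proof.
rewrite /Defs.invariant /inv_poly => muX inv; split => //.
move: t inv => [] inv.
- move=> A mA AX; have mfA := measurable_preimage_pmap.
  rewrite setIC; transitivity (mu (pmap_eval f @^-1` A)).
    exact: supp_setI (mfA A mA).
  have [K K0 XK] := semialg_cube cX.
  (* One cube must carry both [mu] and its push-forward for their moments to determine them. *)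
  have [K' K'0 [KK' fK']] : exists2 K' : R, 0 < K' & X `<=` cube_rV K' /\
      forall x, X x -> cube_rV K' (pmap_eval f x).
    have /choice[M MP] : forall i : 'I_n, exists M : R, forall x, X x -> `|peval (tnth f i) x| <= M.
      move=> i; have [M _ MP] := bounded_compact (@continuous_peval R n (tnth f i)) cX.
      by exists M.
    have S0 : 0 <= \sum_i `|M i| by exact: sumr_ge0.
    exists (K + \sum_i `|M i|); first by rewrite ltr_wpDr.
    split => x Xx i /=; rewrite -ler_norml.
      by rewrite (@le_trans _ _ K) ?lerDl// ler_norml; exact: (XK x Xx i).
    rewrite mxE; apply: le_trans (MP i x Xx) _; apply: le_trans (ler_norm _) _.
    by rewrite (bigD1 i)//= addrCA lerDl addr_ge0 ?(ltW K0)// sumr_ge0.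
  have muK' := supp_cube KK' muX.
  have mK' : measurable (cube_rV K' : set 'rV[R]_n) by exact: measurable_box_rV.
  pose nu := finite_pushforward mu measurable_pmap_eval.
  apply: (@measure_moments_eq R n K' K'0 nu mu) => //.
    rewrite -[LHS]/(mu (pmap_eval f @^-1` (~` cube_rV K'))).
    apply/eqP; rewrite eq_le measure_ge0 andbT -muX le_measure ?inE//.
    - by apply: mfA; exact: measurableC.
    - exact: measurableC.
    - by move=> x; apply: contra_not => /fK'.
  move=> q; have iq := integrable_supp q muX.
  have iqf := integrable_supp (comp_mpoly f q) muX.
  transitivity (\int[pushforward mu (pmap_eval f)]_x (peval q x)%:E)%E.
    by apply: eq_measure_integral.
  rewrite integral_push//.
  have := inv q; rewrite (eq_Rintegral mu
    (g := fun x => peval (comp_mpoly f q) x - peval q x)); last first.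
    by move=> x _; rewrite pevalB.
  rewrite RintegralB// => /eqP; rewrite subr_eq0 => /eqP.
  move=> e; rewrite -[RHS]fineK; last exact: integrable_fin_num iq.
  rewrite -[LHS]fineK; last exact: integrable_fin_num iqf.
  by congr EFin; exact: e.
- move=> v C1v.
  have [K K0 XK] := semialg_cube cX.
  have muK := supp_cube XK muX.
  have mK : measurable (cube_rV K : set 'rV[R]_n) by exact: measurable_box_rV.
  pose F x := \sum_(i < n) 'D_(delta_mx 0 i) v x * pmap_eval f x 0 i.
  have cF : continuous F.
    move=> x; apply: (@cvg_sumr R _ _ (nbhs x)) => i; apply: cvgM; first exact: C1v.2.
    rewrite (_ : (fun x => _) = peval (tnth f i)); last by apply/funext => z; rewrite mxE.
    by rewrite mxE; exact: continuous_peval.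
  have [C _ FC] := bounded_compact cF (@compact_cube_rV R n K).
  have iF := integrable_bounded mK muK (continuous_measurable_rV cF) FC.
  have iFX : mu.-integrable X (EFin \o F) by exact: integrableS iF.
  rewrite -[LHS]fineK; last exact: integrable_fin_num.
  congr EFin; rewrite -[LHS]/(\int[mu]_(x in X) F x).
  apply/eqP; rewrite -normr_eq0 eq_le normr_ge0 andbT.
  apply/ler_addgt0Pr => e e0; rewrite add0r.
  have /choice[M MP] : forall i : 'I_n, exists M : R, forall x, X x -> `|peval (tnth f i) x| <= M.
    move=> i; have [M _ MP] := bounded_compact (@continuous_peval R n (tnth f i)) cX.
    by exists M.
  pose S := \sum_i `|M i|.
  have S0 : 0 <= S by exact: sumr_ge0.
  pose c := fine (mu X).
  have c0 : 0 <= c by exact: fine_ge0.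
  have d0 : 0 < S * c + 1 by rewrite ltr_wpDl// mulr_ge0.
  (* [S] bounds the sum of the |f_i| on [X] and [c] is the mass of [X], so the total error is at
     most e S c / (S c + 1) <= e. *)
  have [q qP] := weierstrass_C1 K0 C1v (divr_gt0 e0 d0).
  have iq := integrable_supp (grad_dot f q) muX.
  have iqX : mu.-integrable X (EFin \o peval (grad_dot f q)) by exact: integrableS iq.
  have IE : \int[mu]_(x in X) F x = \int[mu]_(x in X) (F x - peval (grad_dot f q) x).
    rewrite RintegralB// [X in _ = _ - X](_ : _ = 0) ?subr0//.
    by rewrite -(inv q) /Rintegral integral_supp.
  have iD : mu.-integrable X (EFin \o (fun x => F x - peval (grad_dot f q) x)).
    by have := integrableB mX iFX iqX; apply: eq_integrable.
  rewrite IE; apply: le_trans (le_normr_Rintegral mX iD) _.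
  apply: (@le_trans _ _ (\int[mu]_(x in X) (e / (S * c + 1) * S))).
    apply: le_Rintegral => //.
    - by have := integrable_abse iD; apply: eq_integrable.
    - by apply: (integrableS measurableT) => //; apply: finite_measure_integrable_cst.
    move=> x Xx; rewrite peval_grad_dot /F -sumrB mulr_sumr.
    apply: le_trans (ler_norm_sum _ _ _) _; apply: ler_sum => i _.
    rewrite -mulrBl normrM ler_pM//.
      by rewrite distrC; exact: qP i x (XK x Xx).
    by rewrite mxE; apply: le_trans (MP i x Xx) (ler_norm _).
  rewrite Rintegral_cst// -/c.
  have -> : e / (S * c + 1) * S * c = e * (S * c) / (S * c + 1) by ring.
  by rewrite ler_pdivrMr// ler_wpM2l ?(ltW e0)// lerDl.
Qed.

End invariance.

(** * The relaxations *)

Section unit_balls.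
Context d (T : measurableType d) (R : realType).
Variable lam : {finite_measure set T -> \bar R}.
Implicit Types h : T -> R.

Lemma Lnorm2_le1 h : measurable_fun setT h ->
  (h \in Lfun lam 2%:E /\ ('N[lam]_2%:E[EFin \o h] <= 1)%E) <->
  (square_integrable lam h /\ \int[lam]_x (h x ^+ 2) <= 1).
Proof.
move=> mh.
have N2 : ('N[lam]_2%:E[EFin \o h] `^ 2 = \int[lam]_x (h x ^+ 2)%:E)%E.
  rewrite powR_Lnorm//; apply: eq_integral => x _ /=.
  by rewrite powR_mulrn// real_normK// num_real.
have N0 := Lnorm_ge0 lam 2%:E (EFin \o h).
have Nle : ('N[lam]_2%:E[EFin \o h] <= 1)%E = (\int[lam]_x (h x ^+ 2)%:E <= 1)%E.
  have nnE (x : \bar R) : (0 <= x)%E -> x \in (`[0%E, +oo%E]%O : interval _).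
    by move=> x0; rewrite in_itv/= x0 leey.
  apply/idP/idP => le1; last first.
    have -> : ('N[lam]_2%:E[EFin \o h] = (\int[lam]_x (h x ^+ 2)%:E) `^ 2^-1)%E.
      by rewrite -N2 -poweRrM divff// poweRe1.
    rewrite -(poweR1r 2^-1); apply: gt0_ler_poweR => //; apply: nnE => //.
    by apply: integral_ge0 => x _; rewrite lee_fin sqr_ge0.
  by rewrite -N2 -(poweR1r 2); apply: gt0_ler_poweR => //; exact: nnE.
have fin : (\int[lam]_x (h x ^+ 2)%:E < +oo)%E ->
    (\int[lam]_x (h x ^+ 2)%:E <= 1)%E = (\int[lam]_x (h x ^+ 2) <= 1).
  move=> fi; rewrite -lee_fin fineK// ge0_fin_numE//.
  by apply: integral_ge0 => x _; rewrite lee_fin sqr_ge0.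
split => [[hL]|[[_ hi] h1]].
  rewrite Nle => h1; have hoo : (\int[lam]_x (h x ^+ 2)%:E < +oo)%E.
    exact: le_lt_trans h1 (ltry 1).
  by split; [exact: square_integrableP|rewrite -fin].
have hoo : (\int[lam]_x (h x ^+ 2)%:E < +oo)%E.
  rewrite -ge0_fin_numE ?integrable_fin_num//.
  by apply: integral_ge0 => x _; rewrite lee_fin sqr_ge0.
have hN : ('N[lam]_2%:E[EFin \o h] <= 1)%E by rewrite Nle fin.
split => //; apply/andP; split; rewrite inE//=.
exact: le_lt_trans hN (ltry 1).
Qed.

Lemma Lnormoo_le1 h : measurable_fun setT h -> lam setT <> 0%E ->
  (h \in Lfun lam +oo%E /\ ('N[lam]_+oo%E[EFin \o h] <= 1)%E) <->
  \forall x \ae lam, `|h x| <= 1.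
Proof.
move=> mh lamT.
have T0 : (0 < lam setT)%E by rewrite lt0e measure_ge0 andbT; apply/eqP.
have NE : ('N[lam]_+oo%E[EFin \o h] = ess_sup lam (abse \o (EFin \o h)))%E.
  by rewrite unlock T0.
split => [[_]|h1].
  by rewrite NE => /ess_supP; apply: filterS => x; rewrite /= lee_fin.
have hN : ('N[lam]_+oo%E[EFin \o h] <= 1)%E.
  by rewrite NE; apply/ess_supP; apply: filterS h1 => x; rewrite /= lee_fin.
split => //; apply/andP; split; rewrite inE//=.
exact: le_lt_trans hN (ltry 1).
Qed.

End unit_balls.

Section relaxation.
Context {R : realType} {n m : nat}.
Variable g : 'I_m -> mpoly n R.
Hypothesis cX : compact (semialg g).
Local Notation X := (semialg g).
Local Notation L := (fin_lebesgue cX).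
Local Notation z := (lebesgue_moment g).
Implicit Types (y : multinom n -> R) (q : mpoly n R) (r : nat).

Lemma riesz_lebesgue_moment q : riesz z q = \int[L]_x peval q x.
Proof.
have [K K0 XK] := semialg_cube cX; have LK := fin_lebesgue_cube cX XK.
rewrite -(riesz_scalarE (mean_scalar LK) q); congr riesz; apply/funext => a.
by rewrite /lebesgue_moment (@fin_lebesgueE _ _ _ _ cX)//; exact: integrable_peval LK _.
Qed.

(** The block matrix is evaluated at the coefficients of [q] followed by the scalar [s]; letting [s]
    vary contains the Schur complement. *)
Lemma psd_C2_mx r y : psd (C2_mx g r y) <->
  forall q s, (mmeasure mdeg q <= r.+1)%N ->
    0 <= riesz z (q ^+ 2) + s * riesz y q *+ 2 + s ^+ 2.
Proof.
have form (u : 'cV[R]_#|{: bmultinom n r.+1}|) (w : 'cV[R]_1) :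
    ((col_mx u w)^T *m C2_mx g r y *m col_mx u w) 0 0 =
    riesz z (vec_poly u ^+ 2) + w 0 0 * riesz y (vec_poly u) *+ 2 + w 0 0 ^+ 2.
  rewrite /C2_mx tr_col_mx mul_row_block mul_row_col !mulmxDl mulmx1.
  have uw : (u^T *m low_moments r y *m w) 0 0 = w 0 0 * riesz y (vec_poly u).
    by rewrite mxE big_ord1 low_moments_form mulrC.
  have wu : (w^T *m (low_moments r y)^T *m u) 0 0 = w 0 0 * riesz y (vec_poly u).
    rewrite -mulmxA mxE big_ord1 mxE -low_moments_form; congr (_ * _).
    by rewrite -[_ *m u]trmxK mxE trmx_mul trmxK.
  have uu : (u^T *m moment_mx r z *m u) 0 0 = riesz z (vec_poly u ^+ 2).
    by rewrite localizing_form mul1r expr2.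
  have ww : (w^T *m w) 0 0 = w 0 0 ^+ 2 by rewrite mxE big_ord1 mxE expr2.
  have addE (A B : 'M[R]_1) : (A + B) 0 0 = A 0 0 + B 0 0 by rewrite mxE.
  by rewrite !addE uw wu uu ww; ring.
split => [[_ H] q s qr|H].
  by have := H (col_mx (poly_vec r q) s%:M); rewrite form poly_vecK// !mxE mulr1n.
split=> [|v].
  by rewrite /C2_mx tr_block_mx trmxK trmx1 localizing_sym.
by rewrite -[v]vsubmxK form; apply: H; exact: msize_vec_poly.
Qed.

Lemma psd_Coo_mx r y : psd (Coo_mx g r y) <->
  forall q, (mmeasure mdeg q <= r.+1)%N -> riesz y (q ^+ 2) <= riesz z (q ^+ 2).
Proof.
have form (u : 'cV[R]_#|{: bmultinom n r.+1}|) :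
    (u^T *m Coo_mx g r y *m u) 0 0 = riesz z (vec_poly u ^+ 2) - riesz y (vec_poly u ^+ 2).
  rewrite /Coo_mx /moment_mx mulmxBr mulmxBl mxE [X in _ + X]mxE.
  by rewrite !localizing_form !mul1r !expr2.
split => [[_ H] q qr|H].
  by have := H (poly_vec r q); rewrite form poly_vecK// subr_ge0.
split=> [|v]; last by rewrite form subr_ge0; apply: H; exact: msize_vec_poly.
by rewrite /Coo_mx linearB /= !localizing_sym.
Qed.

Lemma constraint0 : constraint g ord0 = 1.
Proof. by rewrite /constraint unlift_none. Qed.

Lemma half_deg_constraint0 : half_deg (constraint g ord0) = 0%N.
Proof. by rewrite constraint0 /half_deg /deg mmeasure1. Qed.

(** The squared L^2 norm allowed to the limit density: 1 for [Two], and lambda(X) for [Infinity],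
    where the density is at most 1. *)
Definition riesz_bound p : R := if p is Two then 1 else fine (L setT).

Lemma norm_constraint_bound p r y : L setT <> 0%E ->
  (forall q, (mmeasure mdeg q <= r.+1)%N -> 0 <= riesz y (q ^+ 2)) ->
  norm_constraint g p r y ->
  forall q, (mmeasure mdeg q <= r.+1)%N ->
    riesz y q ^+ 2 <= riesz_bound p * riesz z (q ^+ 2).
Proof.
move=> LT y0; case: p => /= [/psd_C2_mx yz q qr|/psd_Coo_mx yz q qr].
  (* This value of [s] minimizes the quadratic polynomial in [s]. *)
  by have := yz q (- riesz y q) qr; rewrite mul1r; lra.
set Z := fine (L setT); have Z0 : 0 < Z.
  by apply: fine_gt0; rewrite ltey_eq fin_num_measure// andbT lt0e measure_ge0 andbT; apply/eqP.
have zZ : riesz z 1 = Z.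
  rewrite riesz_lebesgue_moment (eq_Rintegral _ (g := cst 1)); last by move=> x _; rewrite peval1.
  by rewrite Rintegral_cst// mul1r.
(* y((q + s)^2) <= z(q^2) + 2 s y(q) + s^2 Z, whose right-hand side is minimal
   at this s. *)
pose s := - riesz y q / Z.
have qs : (mmeasure mdeg (q + s *: 1) <= r.+1)%N.
  apply: leq_trans (mmeasureD_le _ _ _) _; rewrite geq_max qr.
  by apply: leq_trans (mmeasureZ_le _ _ _) _; rewrite mmeasure1.
have := y0 _ qs; have := yz 1; rewrite mmeasure1 expr1n zZ => /(_ isT).
have -> : (q + s *: 1) ^+ 2 = q ^+ 2 + (2 * s) *: q + s ^+ 2 *: 1.
  by rewrite sqrrD mulr_algr exprZn expr1n scalerMnl mulr_natl.
rewrite !linearD/= !rieszZ => y1 h; have := yz q qr => h2.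
have : 0 <= riesz z (q ^+ 2) + 2 * s * riesz y q + s ^+ 2 * Z.
  apply: le_trans h _; rewrite !lerD// ler_wpM2l ?sqr_ge0//.
have -> : riesz z (q ^+ 2) + 2 * s * riesz y q + s ^+ 2 * Z = riesz z (q ^+ 2) - riesz y q ^+ 2 / Z.
  by rewrite /s; field; rewrite gt_eqF.
by rewrite subr_ge0 ler_pdivrMr// mulrC.
Qed.

Lemma sdp_feasible_riesz t f p r (y : {ffun bmultinom n (2 * r).+1 -> R}) : L setT <> 0%E ->
  sdp_feasible t f g p y ->
  (forall q, (mmeasure mdeg q <= r.+1)%N -> 0 <= riesz (extend y) (q ^+ 2)) /\
  (forall q, (mmeasure mdeg q <= r.+1)%N ->
     riesz (extend y) q ^+ 2 <= riesz_bound p * \int[L]_x peval (q ^+ 2) x).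
Proof.
move=> LT [_ nc /(_ ord0)]; rewrite half_deg_constraint0 subn0 constraint0 => /psd_localizing y0.
have y0' q : (mmeasure mdeg q <= r.+1)%N -> 0 <= riesz (extend y) (q ^+ 2).
  by move=> qr; have := y0 q qr; rewrite mul1r.
split => // q qr; rewrite -riesz_lebesgue_moment.
exact: norm_constraint_bound LT y0' nc q qr.
Qed.

Lemma integral_density_approx r (y : {ffun bmultinom n (2 * r).+1 -> R}) q :
  L setT <> 0%E -> (mmeasure mdeg q <= r.+1)%N ->
  \int[lebesgue_rV n]_(x in X) (peval q x * peval (density_approx g y) x) =
  riesz (extend y) q.
Proof.
move=> LT qr; have [K K0 XK] := semialg_cube cX; have LK := fin_lebesgue_cube cX XK.
have uM : (moment_mx r z : 'M[R]_#|{: bmultinom n r.+1}|) \in unitmx.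
  by apply: moment_mx_unit => q'; rewrite riesz_lebesgue_moment; exact: fin_lebesgue_nondegenerate.
rewrite -(gram_representation (extend y) uM qr) riesz_lebesgue_moment -(@fin_lebesgueE _ _ _ _ cX).
  by apply: eq_Rintegral => x _; rewrite pevalM.
exact: integrable_peval LK _.
Qed.

End relaxation.

Lemma ae_Rintegral_eq d (T : measurableType d) (R : realType)
    (mu : {measure set T -> \bar R}) (f h : T -> R) :
  measurable_fun setT f -> measurable_fun setT h ->
  (\forall x \ae mu, f x = h x) -> \int[mu]_x f x = \int[mu]_x h x.
Proof.
move=> mf mh fh; rewrite /Rintegral; congr fine; apply: ae_eq_integral => //.
- exact/measurable_EFinP.
- exact/measurable_EFinP.
- by apply: filterS fh => x /= ->.
Qed.

Lemma ae_Rintegral_ge0 d (T : measurableType d) (R : realType)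
    (mu : {measure set T -> \bar R}) (f : T -> R) :
  measurable_fun setT f -> (\forall x \ae mu, 0 <= f x) -> 0 <= \int[mu]_x f x.
Proof.
move=> mf f0; rewrite (@ae_Rintegral_eq _ _ _ mu _ (fun x => `|f x|))//.
- by apply: Rintegral_ge0.
- exact: measurableT_comp.
- by apply: filterS f0 => x f0; rewrite ger0_norm.
Qed.

Section lp_to_sdp.
Context {R : realType} {n m : nat}.
Variable g : 'I_m -> mpoly n R.
Variable p : exponent.
Hypothesis cX : compact (semialg g).
Local Notation X := (semialg g).
Local Notation L := (fin_lebesgue cX).
Local Notation z := (lebesgue_moment g).
Hypothesis LT : L setT <> 0%E.
Implicit Types (h : 'rV[R]_n -> R) (q : mpoly n R) (r : nat).

Definition unit_ball h : Prop :=
  if p is Two then square_integrable L h /\ \int[L]_x (h x ^+ 2) <= 1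
  else \forall x \ae L, `|h x| <= 1.

Lemma unit_ballP h : measurable_fun setT h ->
  h \in Lfun (lebesgue_on g) (exponent_val R p) /\
    ('N[lebesgue_on g]_(exponent_val R p)[EFin \o h] <= 1)%E <-> unit_ball h.
Proof.
move=> mh; rewrite /unit_ball; case: p => /=.
  exact: (@Lnorm2_le1 _ _ _ L h mh).
exact: (@Lnormoo_le1 _ _ _ L h mh LT).
Qed.

Definition truncated_moments h r : {ffun bmultinom n (2 * r).+1 -> R} :=
  [ffun a => \int[L]_x (peval (mpolyX R (bmnm a)) x * h x)].

Lemma extend_truncated_moments h r q : L.-integrable setT (EFin \o h) ->
  (mmeasure mdeg q <= (2 * r).+1)%N ->
  riesz (extend (truncated_moments h r)) q = \int[L]_x (peval q x * h x).
Proof.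
move=> ih qr; have [K K0 XK] := semialg_cube cX; have LK := fin_lebesgue_cube cX XK.
rewrite -(riesz_scalarE (weighted_scalar LK ih) q); apply: eq_riesz => a aq.
rewrite /extend; case: insubP => [b _ <-|]; first by rewrite ffunE.
by rewrite (leq_trans (msize_mdeg_lt aq) qr).
Qed.

(** For [Two], the integral of (q + s h)^2 is nonnegative and that of h^2 is at most 1; for
    [Infinity], q^2 (1 - h) is nonnegative almost everywhere. *)
Lemma truncated_moments_norm_constraint h r :
  measurable_fun setT h -> L.-integrable setT (EFin \o h) ->
  unit_ball h -> norm_constraint g p r (extend (truncated_moments h r)).
Proof.
move=> mh ih; have [K K0 XK] := semialg_cube cX; have LK := fin_lebesgue_cube cX XK.
have double q : (mmeasure mdeg q <= r.+1)%N -> (mmeasure mdeg (q ^+ 2) <= (2 * r).+1)%N.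
  move=> qr; have [->|q0] := eqVneq q 0; first by rewrite expr0n mmeasure0.
  rewrite expr2 msizeM//; move: (mmeasure _ _) qr => s; lia.
rewrite /unit_ball /norm_constraint; case: p => [[hs h1]|h1]; last first.
  apply/psd_Coo_mx => q qr; rewrite extend_truncated_moments ?double//.
  rewrite (riesz_lebesgue_moment cX) -subr_ge0 -RintegralB//; last 2 first.
  - exact: integrable_peval LK _.
  - exact: (integrable_peval_mul LK (q ^+ 2) ih).
  apply: ae_Rintegral_ge0.
    apply: measurable_funB; first exact: measurable_peval.
    by apply: measurable_funM => //; exact: measurable_peval.
  apply: filterS h1 => x h1; rewrite -[X in X - _]mulr1 -mulrBr pevalXn.
  by rewrite mulr_ge0 ?sqr_ge0// subr_ge0 (le_trans (ler_norm _)).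
apply/psd_C2_mx => q s qr; have qr2 : (mmeasure mdeg q <= (2 * r).+1)%N by lia.
rewrite extend_truncated_moments// (riesz_lebesgue_moment cX).
have sq := square_integrable_peval LK q.
have sh : square_integrable L (fun x => s * h x) by exact: square_integrableZ.
have i1 : L.-integrable setT (EFin \o (fun x => peval q x ^+ 2)) by exact: sq.2.
have i2 : L.-integrable setT (EFin \o (fun x => peval q x * h x)).
  exact: square_integrableM.
have i2' : L.-integrable setT (EFin \o (fun x => (s *+ 2) * (peval q x * h x))).
  by have := integrableZl measurableT (s *+ 2) i2; apply: eq_integrable.
have i3 : L.-integrable setT (EFin \o (fun x => (s * h x) ^+ 2)) by exact: sh.2.
have i12 : L.-integrable setT (EFin \o (fun x => peval q x ^+ 2 + (s *+ 2) * (peval q x * h x))).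
  by have := integrableD measurableT i1 i2'; apply: eq_integrable.
have : 0 <= \int[L]_x (peval q x ^+ 2 + (s *+ 2) * (peval q x * h x) + (s * h x) ^+ 2).
  by apply: Rintegral_ge0 => x _; rewrite (_ : _ + _ = (peval q x + s * h x) ^+ 2) ?sqr_ge0//; ring.
rewrite RintegralD// RintegralD// RintegralZl//.
have -> : \int[L]_x ((s * h x) ^+ 2) = s ^+ 2 * \int[L]_x (h x ^+ 2).
  rewrite -RintegralZl//; last exact: hs.2.
  by apply: eq_Rintegral => x _; rewrite exprMn.
have -> : \int[L]_x (peval q x ^+ 2) = \int[L]_x peval (q ^+ 2) x.
  by apply: eq_Rintegral => x _; rewrite pevalXn.
move=> H; apply: le_trans H _; rewrite mulrnAl lerD2l.
by rewrite -[leRHS]mulr1 ler_wpM2l ?sqr_ge0.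
Qed.

End lp_to_sdp.

Section lp_to_sdp_feasible.
Context {R : realType} {n m : nat}.
Variables (t : time) (f : n.-tuple (mpoly n R)) (g : 'I_m -> mpoly n R).
Variable p : exponent.
Hypothesis cX : compact (semialg g).
Local Notation X := (semialg g).
Local Notation L := (fin_lebesgue cX).
Variables (nu : {finite_measure set 'rV[R]_n -> \bar R}) (h : 'rV[R]_n -> R).
Hypothesis nuh : has_density g nu h.
Implicit Types q : mpoly n R.

Lemma has_density_integrable :
  L.-integrable setT (EFin \o h) /\ \forall x \ae L, 0 <= h x.
Proof. exact: (@density_integrable _ _ _ nu L h nuh.1 nuh.2). Qed.

Lemma has_density_supp : nu (~` X) = 0%E.
Proof.
have mX := measurable_semialg g; have mC := measurableC mX.
rewrite nuh.2//; apply: null_set_integral => //.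
  have mEh : measurable_fun setT (EFin \o h) by apply/measurable_EFinP; exact: nuh.1.
  exact: measurable_funTS mEh.
by rewrite /lebesgue_on /= /mrestr setICl measure0.
Qed.

Lemma has_density_Rintegral q : \int[nu]_x peval q x = \int[L]_x (peval q x * h x).
Proof.
have [K K0 XK] := semialg_cube cX; have nuK := supp_cube XK has_density_supp.
rewrite /Rintegral (@integral_density _ _ _ nu L h _ nuh.1 nuh.2)//.
exact: integrable_peval nuK _.
Qed.

Lemma lp_sdp_feasible r : L setT <> 0%E -> Defs.invariant t f g nu ->
  unit_ball p cX h -> (rmin g <= r)%N ->
  sdp_feasible t f g p (truncated_moments cX h r).
Proof.
move=> LT inv hp rr; have [ih h0] := has_density_integrable.
have [K K0 XK] := semialg_cube cX; have LK := fin_lebesgue_cube cX XK.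
split.
- move=> a; rewrite invariance_formE => /andP[ar deg_r].
  rewrite extend_truncated_moments//.
    by rewrite -has_density_Rintegral (invariant_moments cX).
  have pred_le k : (k.-1 <= 2 * r)%N -> (k <= (2 * r).+1)%N by case: k.
  move: deg_r; rewrite /inv_poly /deg; case: t => /pred_le // deg_r.
  apply: leq_trans (mmeasureD_le _ _ _) _; rewrite geq_max mmeasureN mmeasureX ltnS ar andbT.
  exact: deg_r.
- by apply: truncated_moments_norm_constraint => //; exact: nuh.1.
- move=> j; apply/psd_localizing => q qd.
  have hd : (half_deg (constraint g j) <= r)%N.
    apply: leq_trans rr; rewrite /constraint /rmin; case: unliftP => [k _|_].
      by rewrite leq_max (leq_bigmax k) orbT.
    by rewrite /half_deg /deg mmeasure1.
  (* Twice [half_deg] is at least the degree of the constraint, so the product has degree at most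
     [2 * r], the range in which the extended sequence carries moments. Zero factors are set apart
     because degrees add up only for nonzero ones. *)
  rewrite extend_truncated_moments//; last first.
    have [->|c0] := eqVneq (constraint g j) 0; first by rewrite mul0r mmeasure0.
    have [->|q0] := eqVneq q 0; first by rewrite expr0n mulr0 mmeasure0.
    rewrite expr2 !msizeM ?mulf_neq0//.
    move: hd qd; rewrite /half_deg /deg; set a := mmeasure _ (constraint _ _).
    set b := mmeasure _ q; rewrite uphalf_half => hd qd; have := odd_double_half a.-1; lia.
  apply: ae_Rintegral_ge0.
    by apply: measurable_funM; [exact: measurable_peval|exact: nuh.1].
  have mX := measurable_semialg g.
  have LX : L (~` X) = 0%E.
    by rewrite /fin_lebesgue /lebesgue_on /= /mrestr setICl measure0.
  have aX : \forall x \ae L, X x by exact: (ae_null (rho := L) mX LX (fun x Xx => Xx)).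
  apply: filterS2 h0 aX => x h0 Xx; rewrite mulr_ge0// pevalM mulr_ge0 ?pevalXn ?sqr_ge0//.
  rewrite /constraint; case: unliftP => [k _|_]; first exact: Xx.
  by rewrite peval1.
Qed.

Lemma extend_truncated_moments0 r :
  extend (truncated_moments cX h r) mnm0 = fine (nu setT).
Proof.
have [ih _] := has_density_integrable.
rewrite -rieszX mpolyX0 extend_truncated_moments ?mmeasure1// -has_density_Rintegral.
rewrite (eq_Rintegral _ (g := cst 1)); last by move=> x _; rewrite peval1.
by rewrite Rintegral_cst// mul1r.
Qed.

End lp_to_sdp_feasible.

(** * Limits of optimal solutions *)

Lemma ultra_bounded_cvg {R : realType} (U : set_system nat) (u : R^nat) (B : R) :
  UltraFilter U -> (\forall r \near U, `|u r| <= B) -> exists l : R, u @ U --> l.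
Proof.
move=> uU uB; have cB := @segment_compact R (- B) B.
rewrite compact_ultra in cB.
have [|l [_ ul]] := cB (u @ U) (ultra_fmap u uU); last by exists l.
by rewrite /nbhs /=; apply: filterS uB => r /=; rewrite in_itv/= -ler_norml.
Qed.

Section ultrafilter_limit.
Context {R : realType} {n m : nat}.
Variables (t : time) (f : n.-tuple (mpoly n R)) (g : 'I_m -> mpoly n R).
Variable p : exponent.
Hypothesis cX : compact (semialg g).
Local Notation X := (semialg g).
Local Notation L := (fin_lebesgue cX).
Hypothesis LT : L setT <> 0%E.
Variable y : forall r, {ffun bmultinom n (2 * r).+1 -> R}.
Hypothesis y_opt : forall r, (rmin g <= r)%N -> sdp_optimal t f g p (y r).
Variables (U : set_system nat) (uU : UltraFilter U).
Hypothesis oU : \oo `<=` U.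
Implicit Types q : mpoly n R.

Let UF : Filter U. Proof. exact: filter_filter. Qed.

Let near_large k (P : nat -> Prop) : (forall r, (k <= r)%N -> P r) -> \forall r \near U, P r.
Proof. by move=> kP; apply: oU; exists k => // r /= /kP. Qed.

Let cvg_ge (u : R^nat) (a c : R) : u @ U --> a -> (\forall r \near U, c <= u r) -> c <= a.
Proof. by move=> ua cu; apply: (ler_cvg_to (cvg_cst c) ua). Qed.

Let cvg_le (u : R^nat) (a c : R) : u @ U --> a -> (\forall r \near U, u r <= c) -> a <= c.
Proof. by move=> ua cu; apply: (ler_cvg_to ua (cvg_cst c)). Qed.

(** For a fixed monomial the norm constraint gives a bound independent of [r] as soon as [r] reaches
    its degree, so its moments converge along [U]; linearity passes to the limit. *)
Lemma ultra_riesz_limit : exists2 l : mpoly n R -> R, scalar l &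
  forall q, (fun r => riesz (extend (y r)) q) @ U --> l q.
Proof.
have /choice[l lP] : forall a : multinom n, exists la : R, (fun r => extend (y r) a) @ U --> la.
  move=> a; pose B := riesz_bound cX p * \int[L]_x peval (mpolyX R a ^+ 2) x.
  (* The constraint bounds the square by [B], and |e| <= 2 |e| <= 1 + e^2. *)
  apply: (@ultra_bounded_cvg _ _ _ (1 + B)) => //.
  apply: (@near_large (maxn (rmin g) (mdeg a))) => r.
  rewrite geq_max => /andP[rr ar].
  have [_ /(_ (mpolyX R a))] := sdp_feasible_riesz LT (y_opt rr).1.
  rewrite mmeasureX ltnS ar rieszX => /(_ isT); rewrite -/B.
  set e := extend _ _ => eB; have : 0 <= (`|e| - 1) ^+ 2 by exact: sqr_ge0.
  have : `|e| ^+ 2 = e ^+ 2 by rewrite real_normK ?num_real.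
  have := normr_ge0 e; nra.
exists (riesz l); first by move=> c q1 q2; exact: linearP.
move=> q; rewrite /riesz; apply: cvg_sumr => a.
by apply: cvgM; [exact: cvg_cst|exact: lP].
Qed.

Variable l : mpoly n R -> R.
Hypothesis ly : forall q, (fun r => riesz (extend (y r)) q) @ U --> l q.

Lemma ultra_limit_sqr_ge0 q : 0 <= l (q ^+ 2).
Proof.
apply: (cvg_ge (@ly (q ^+ 2))).
apply: (@near_large (maxn (rmin g) (mmeasure mdeg q))) => r.
rewrite geq_max => /andP[rr qr].
by apply: (sdp_feasible_riesz LT (y_opt rr).1).1; exact: leq_trans qr _.
Qed.

Lemma ultra_limit_bound q :
  l q ^+ 2 <= riesz_bound cX p * \int[L]_x peval (q ^+ 2) x.
Proof.
apply: (@cvg_le (fun r => riesz (extend (y r)) q ^+ 2)).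
  by rewrite expr2; apply: cvgM; exact: ly.
apply: (@near_large (maxn (rmin g) (mmeasure mdeg q))) => r.
rewrite geq_max => /andP[rr qr].
by apply: (sdp_feasible_riesz LT (y_opt rr).1).2; exact: leq_trans qr _.
Qed.

Lemma ultra_limit_le q : p = Infinity -> l (q ^+ 2) <= \int[L]_x peval (q ^+ 2) x.
Proof.
move=> pE; apply: (cvg_le (@ly (q ^+ 2))).
apply: (@near_large (maxn (rmin g) (mmeasure mdeg q))) => r.
rewrite geq_max => /andP[rr qr]; have [[_ nc _] _] := y_opt rr.
move: nc; rewrite pE /= => /psd_Coo_mx yz; rewrite -riesz_lebesgue_moment.
by apply: yz; exact: leq_trans qr _.
Qed.

(** A given monomial lies in A_r for all large [r], so its moment equation holds from some order on;
    the general case follows by linearity. *)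
Lemma ultra_limit_inv_poly q : scalar l -> l (inv_poly t f q) = 0.
Proof.
move=> hl; have lX a : l (inv_poly t f (mpolyX R a)) = 0.
  pose u r := riesz (extend (y r)) (inv_poly t f (mpolyX R a)).
  apply/esym; apply: (cvg_unique _ (F := u @ U)) => //; last exact: ly.
  apply: cvg_near_cst.
  pose D := match t with Discrete => deg (comp_mpoly f (mpolyX R a))
    | Defs.Continuous => deg (grad_dot f (mpolyX R a)) end.
  apply: (@near_large (maxn (rmin g) (maxn (mdeg a) D))) => r.
  rewrite geq_max => /andP[rr]; rewrite geq_max => /andP[ar Dr]; have [[yinv _ _] _] := y_opt rr.
  rewrite /u -invariance_formE; apply: yinv; rewrite /index_set.
  have r2 k : (k <= r)%N -> (k <= 2 * r)%N by lia.
  by rewrite r2//=; move: Dr; rewrite /D; case: t => /r2.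
have sl : scalar (fun q => l (inv_poly t f q)).
  by move=> c q1 q2; rewrite inv_poly_linear hl.
rewrite -(riesz_scalarE sl) /riesz big1// => a _.
by rewrite lX mulr0.
Qed.

Lemma ultra_limit_mass (nu : {finite_measure set 'rV[R]_n -> \bar R}) h :
  has_density g nu h -> Defs.invariant t f g nu -> unit_ball p cX h ->
  fine (nu setT) <= l 1.
Proof.
move=> nuh inv hp; apply: (cvg_ge (@ly 1)).
apply: (@near_large (rmin g)) => r rr; have [_ ymax] := y_opt rr.
have := ymax _ (lp_sdp_feasible nuh LT inv hp rr).
by rewrite (extend_truncated_moments0 cX nuh) -mpolyX0 rieszX.
Qed.

End ultrafilter_limit.

(** * Invariant densities and the limit measure *)

Section invariant_densities.
Context {R : realType} {n m : nat}.
Variables (t : time) (f : n.-tuple (mpoly n R)) (g : 'I_m -> mpoly n R).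
Variable p : exponent.
Hypothesis cX : compact (semialg g).
Local Notation X := (semialg g).
Local Notation L := (fin_lebesgue cX).
Implicit Types (q : mpoly n R) (h : 'rV[R]_n -> R).

Lemma density_invariant (nu : {finite_measure set 'rV[R]_n -> \bar R}) h :
  has_density g nu h ->
  (forall q, \int[L]_x (peval (inv_poly t f q) x * h x) = 0) ->
  Defs.invariant t f g nu.
Proof.
move=> nuh inv; apply: (moments_invariant cX (has_density_supp nuh)) => q.
by rewrite (has_density_Rintegral cX nuh).
Qed.

(** A probability with a density cannot live on a Lebesgue-null set. The definiteness of all moment
    matrices of lambda rests on this. *)
Lemma unique_invariant_lebesgue_neq0 : unique_invariant_probability t f g p ->
  L setT <> 0%E.
Proof.
move=> [P [_ [h _ [mh Ph]] _]] LT.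
have PT : P setT = 1%E by exact: probability_setT.
have mEh : measurable_fun setT (EFin \o h) by exact/measurable_EFinP.
have L0 := @null_set_integral _ _ _ L _ _ measurableT mEh LT.
by have /eqP := etrans (etrans (esym PT) (Ph setT measurableT)) L0; rewrite onee_eq0.
Qed.

(** Unless it is null, [nu] divided by its mass is an invariant probability in L^p, hence [P]. Two
    invariant measures in L^p with the same mass therefore coincide. *)
Lemma invariant_density_proportional (P : probability 'rV[R]_n R)
    (nu : {finite_measure set 'rV[R]_n -> \bar R}) h A :
  (forall Q : probability 'rV[R]_n R, Defs.invariant t f g Q -> in_Lp g p Q ->
     forall B, measurable B -> Q B = P B) ->
  Defs.invariant t f g nu -> has_density g nu h ->
  h \in Lfun (lebesgue_on g) (exponent_val R p) ->
  measurable A -> nu A = (nu setT * P A)%E.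
Proof.
move=> Puniq inv nuh hp mA.
have [nuT|nuT] := eqVneq (nu setT) 0%E.
  rewrite nuT mul0e; apply/eqP; rewrite eq_le measure_ge0 andbT -nuT.
  by rewrite le_measure ?inE.
have nufin : nu setT \is a fin_num by exact: fin_num_measure.
set c := fine (nu setT).
have c0 : c != 0 by rewrite /c fine_eq0.
have [ih _] := has_density_integrable cX nuh.
pose Q : probability 'rV[R]_n R := mnormalize nu P.
have QE B : Q B = (nu B * c^-1%:E)%E.
  rewrite /Q /= /mnormalize (negbTE nuT) /= ifF//.
  by apply/negbTE; move: nufin; rewrite fin_numE => /andP[].
have Qh : has_density g Q (fun x => c^-1 * h x).
  split; first by apply: measurable_funM => //; exact: nuh.1.
  move=> B mB; apply: etrans (QE B) _.
  rewrite (_ : nu B = \int[L]_(x in B) (h x)%:E)%E; last exact: nuh.2.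
  rewrite muleC; have ihB : L.-integrable B (EFin \o h) by exact: integrableS ih.
  exact: (esym (integralZl mB ihB c^-1)).
have <- : Q A = P A.
  apply: Puniq => //.
    apply: (density_invariant Qh) => q.
    have [K K0 XK] := semialg_cube cX; have LK := fin_lebesgue_cube cX XK.
    have iq := integrable_peval_mul LK (inv_poly t f q) ih.
    transitivity (\int[L]_x (c^-1 * (peval (inv_poly t f q) x * h x))).
      by apply: eq_Rintegral => x _; rewrite mulrCA.
    rewrite RintegralZl// -(has_density_Rintegral cX nuh) (invariant_moments cX)//.
    by rewrite mulr0.
  exists (fun x => c^-1 * h x) => //.
  have p1 : (1 <= exponent_val R p)%E.
    by case: p => /=; rewrite ?leey// lee_fin ler1n.
  have [S0 SZ] := Lfun_submod_closed (lebesgue_on g) p1.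
  by have := SZ c^-1 _ _ hp S0; rewrite addr0.
by rewrite QE -(fineK nufin) -/c muleCA -EFinM divff// mule1.
Qed.

End invariant_densities.

Section limit_measure.
Context {R : realType} {n m : nat}.
Variables (t : time) (f : n.-tuple (mpoly n R)) (g : 'I_m -> mpoly n R).
Variable p : exponent.
Hypothesis cX : compact (semialg g).
Local Notation X := (semialg g).
Local Notation L := (fin_lebesgue cX).
Implicit Types (q : mpoly n R) (h : 'rV[R]_n -> R).

Lemma moment_functional_measure (l : mpoly n R -> R) : L setT <> 0%E ->
  scalar l -> (forall q, 0 <= l (q ^+ 2)) ->
  (forall q, l q ^+ 2 <= riesz_bound cX p * \int[L]_x peval (q ^+ 2) x) ->
  (p = Infinity -> forall q, l (q ^+ 2) <= \int[L]_x peval (q ^+ 2) x) ->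
  (forall q, l (inv_poly t f q) = 0) ->
  exists (nu : {finite_measure set 'rV[R]_n -> \bar R}) h,
    [/\ has_density g nu h, forall x, 0 <= h x, unit_ball p cX h,
      Defs.invariant t f g nu & forall q, \int[nu]_x peval q x = l q].
Proof.
move=> LT hl l0 lC lle linv.
have [K K0 XK] := semialg_cube cX; have LK := fin_lebesgue_cube cX XK.
have C0 : 0 <= riesz_bound cX p by rewrite /riesz_bound; case: p => //=; exact: fine_ge0.
have [k [k2 kl kC]] :=
  riesz_representation LK (fun q => @fin_lebesgue_nondegenerate _ _ _ _ cX q LT) C0 hl lC.
have ik := square_integrableW k2.
have k0 : \forall x \ae L, 0 <= k x.
  by apply: (ae_ge0_sqr_moments K0 LK ik) => q; rewrite kl.
(* The Riesz density is nonnegative only almost everywhere, while [density_measure] asks for it at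
   every point. *)
pose h x := Num.max 0 (k x).
have mh : measurable_fun setT h by apply: measurable_maxr => //; exact: k2.1.
have h0 x : 0 <= h x by rewrite /h le_max lexx.
have kh : \forall x \ae L, k x = h x.
  by apply: filterS k0 => x k0; rewrite /h (max_idPr k0).
have sh : square_integrable L h.
  apply: square_integrableP => //.
  rewrite (ae_eq_integral (EFin \o (fun x => k x ^+ 2)))//.
  - rewrite -ge0_fin_numE ?(integrable_fin_num measurableT k2.2)//.
    by apply: integral_ge0 => x _; rewrite lee_fin sqr_ge0.
  - by apply/measurable_EFinP; apply: measurable_funX.
  - by apply/measurable_EFinP; apply: measurable_funX; exact: k2.1.
  - by apply: filterS kh => x /= ->.
have ih := square_integrableW sh.
have lh q : \int[L]_x (peval q x * h x) = l q.
  rewrite -kl; apply: ae_Rintegral_eq.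
  - by apply: measurable_funM => //; exact: measurable_peval.
  - by apply: measurable_funM; [exact: measurable_peval|exact: k2.1].
  - by apply: filterS kh => x ->.
pose nu : {finite_measure set 'rV[R]_n -> \bar R} := density_measure h0 ih.
have nuh : has_density g nu h by split.
exists nu, h; split => //.
- rewrite /unit_ball; move: kC lle; rewrite /riesz_bound; case: p => [kC _|_ /(_ erefl) lle].
    split => //; apply: le_trans kC; rewrite le_eqVlt; apply/orP; left; apply/eqP.
    apply: ae_Rintegral_eq; [exact: measurable_funX|apply: measurable_funX; exact: k2.1|].
    by apply: filterS kh => x ->.
  have i1 : L.-integrable setT (EFin \o (fun=> 1 : R)) by exact: finite_measure_integrable_cst.
  have i1h : L.-integrable setT (EFin \o (fun x => 1 - h x)).
    by have := integrableB measurableT i1 ih; apply: eq_integrable.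
  (* The bound on l(q^2) says that [1 - h] has nonnegative integrals against squares, so the
     positivity criterion applies to it. *)
  have h1 : \forall x \ae L, 0 <= 1 - h x.
    apply: (ae_ge0_sqr_moments K0 LK i1h) => q.
    have := lle q; rewrite -subr_ge0 -lh -RintegralB//; last 2 first.
    - exact: integrable_peval LK _.
    - exact: (integrable_peval_mul LK (q ^+ 2) ih).
    by congr (0 <= _); apply: eq_Rintegral => x _; rewrite mulrBr mulr1.
  by apply: filterS h1 => x; rewrite subr_ge0 ger0_norm.
- by apply: (density_invariant (cX := cX) nuh) => q; rewrite lh.
- by move=> q; rewrite (has_density_Rintegral cX nuh).
Qed.

End limit_measure.

Lemma lp_optimal_mass (R : realType) (n m : nat) (t : time) (p : exponent)
    (f : n.-tuple (mpoly n R)) (g : 'I_m -> mpoly n R) (cX : compact (semialg g))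
    (mu nu : {finite_measure set 'rV[R]_n -> \bar R}) (h : 'rV[R]_n -> R) :
  fin_lebesgue cX setT <> 0%E -> lp_optimal t f g p mu ->
  Defs.invariant t f g nu -> has_density g nu h -> (forall x, 0 <= h x) ->
  unit_ball p cX h -> fine (nu setT) <= fine (mu setT).
Proof.
move=> LT [[[muX _] _] mu_max] inv nuh h0 hp.
have mX := measurable_semialg g.
have mass (rho : {finite_measure set 'rV[R]_n -> \bar R}) : rho (~` semialg g) = 0%E ->
    (\int[rho]_(x in semialg g) 1 = (fine (rho setT))%:E)%E.
  move=> rhoX; rewrite integral_cst// mul1e fineK ?fin_num_measure//.
  by rewrite -[semialg g in LHS]setTI; exact: supp_setI.
rewrite -lee_fin -(mass mu muX) -(mass nu (has_density_supp nuh)); apply: mu_max.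
have [hL hN] := (unit_ballP p LT nuh.1).2 hp.
by split=> //; exists h; split => //; exact: aeW.
Qed.

Theorem lemma3p9 (R : realType) (n m : nat) (t : time) (p : exponent)
    (f : n.-tuple (mpoly n R)) (g : 'I_m -> mpoly n R)
    (y : forall r, {ffun bmultinom n (2 * r).+1 -> R})
    (mu : {finite_measure set 'rV[R]_n -> \bar R}) (h : 'rV[R]_n -> R) :
  compact (semialg g) ->
  (exists (N : int) (j : 'I_m),
    g j = N%:~R - \sum_(i < n) mpolyX R (mnm1 i) ^+ 2) ->
  unique_invariant_probability t f g p ->
  (forall r, (rmin g <= r)%N -> sdp_optimal t f g p (y r)) ->
  lp_optimal t f g p mu ->
  has_density g mu h ->
  forall q : mpoly n R,
    (fun r => \int[lebesgue_rV n]_(x in semialg g)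
                (peval q x * peval (density_approx g (y r)) x)) @ \oo -->
    \int[lebesgue_rV n]_(x in semialg g) (peval q x * h x).
Proof.
move=> cX _ uniq y_opt mu_opt muh q.
have LT := unique_invariant_lebesgue_neq0 (cX := cX) uniq.
have [K K0 XK] := semialg_cube cX; have LK := fin_lebesgue_cube cX XK.
have [ih _] := has_density_integrable cX muh.
rewrite (@fin_lebesgueE _ _ _ _ cX _ (integrable_peval_mul LK q ih)).
rewrite -(has_density_Rintegral cX muh).
apply: cvg_ultra_subfilter => U uU oU.
have UF : Filter U by exact: filter_filter.
have [l hl ly] := ultra_riesz_limit (cX := cX) LT y_opt uU oU.
have [] := @moment_functional_measure _ _ _ t f g p cX l LT hl.
- by move=> q'; exact: (ultra_limit_sqr_ge0 LT y_opt uU oU ly).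
- by move=> q'; exact: (ultra_limit_bound LT y_opt uU oU ly).
- by move=> pE q'; exact: (ultra_limit_le cX y_opt uU oU ly).
- by move=> q'; exact: (ultra_limit_inv_poly y_opt uU oU ly).
move=> nu [k [nuk k0 kp inv nul]].
(* Feasibility supplies a density [k'] of [mu] in the unit ball; of the given [h] only [has_density]
   is known. *)
have [mu_inv [k' [k'L k'0 muk' k'N]]] := mu_opt.1.
have k'p : unit_ball p cX k' by apply/(unit_ballP p LT muk'.1).
have massE : mu setT = nu setT.
  rewrite -(fineK (fin_num_measure mu setT measurableT)).
  rewrite -(fineK (fin_num_measure nu setT measurableT)); congr EFin.
  apply/eqP; rewrite eq_le; apply/andP; split; last first.
    exact: lp_optimal_mass LT mu_opt inv nuk k0 kp.
  have := ultra_limit_mass LT y_opt uU oU ly muk' mu_inv k'p.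
  rewrite -nul (eq_Rintegral _ (g := cst 1)); last by move=> x _; rewrite peval1.
  by rewrite Rintegral_cst// mul1r.
(* Both measures are multiples of the unique probability, with the same mass. *)
have munu A : measurable A -> mu A = nu A.
  have [P [_ _ Puniq]] := uniq => mA.
  have [kL _] := (unit_ballP p LT nuk.1).2 kp.
  rewrite (invariant_density_proportional cX Puniq mu_inv muk' k'L mA) massE.
  by rewrite -(invariant_density_proportional cX Puniq inv nuk kL mA).
have -> : \int[mu]_x peval q x = l q.
  by rewrite -nul /Rintegral; congr fine; apply: eq_measure_integral => A mA _; exact: munu.
apply: cvg_trans (ly q); apply: near_eq_cvg; apply: oU.
exists (mmeasure mdeg q) => // r /= qr.
by rewrite (integral_density_approx _ LT)//; exact: leq_trans qr _.
Qed.
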